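(* Let $h^{\partial}:\partial D\to\mathbb{R}$ be an asymptotic boundary height function that is constant on $\{x=0\}$ and constant on $\{x=1\}$. Then there is a unique function $h_0\in\mathcal{H}$ that maximizes $Ent(\cdot)$ over the space $\mathcal{H}$ of admissible functions with boundary values $h^{\partial}$.
   Context: $D=[0,1]\times[0,1]$. An asymptotic boundary height function is a function $h^{\partial}:\partial D\to\mathbb{R}$ that is non-decreasing in $y$ and $\frac12$-Lipschitz in $x$. (When it is constant on $\{x=0\}$ and on $\{x=1\}$, this means: $h^\partial(\cdot,0)\le h^\partial(\cdot,1)$ are $\frac12$-Lipschitz functions on $[0,1]$ which coincide at $x=0$ and at $x=1$.) Admissible functions: $\mathcal{H}$ is the set of $h:D\to\mathbb{R}$ such that $x\mapsto h(x,y)$ is $\frac12$-Lipschitz for every $y$, $y\mapsto h(x,y)$ is non-decreasing for every $x$, and $h=h^{\partial}$ on $\partial D$. Local entropy: for $(s,t)\in[-\frac12,\frac12]\times[0,\infty]$, $ent(s,t)=0$ if $t=0$; $ent(s,t)=-\infty$ if $s=\pm\frac12,\ t\ne0$; $ent(s,t)=\left(1+\ln\frac{\cos(\pi s)}{\pi t}\right)t$ otherwise (so $ent(s,\infty)=-\infty$). Rotated coordinates: $\tilde x=x$, $\tilde y=\frac{\sqrt2}{2}(y+z)$, $\tilde z=\frac{\sqrt2}{2}(z-y)$. For $h\in\mathcal{H}$ consider the surface of all points $(x,y,z)$, $(x,y)\in D$, with $\lim_{\eta\to0^-}h(x,y+\eta)\le z\le\lim_{\eta\to0^+}h(x,y+\eta)$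 (with $h(x,\cdot)$ extended by $h(x,0)$ for $y<0$ and $h(x,1)$ for $y>1$). In the rotated coordinates this surface is the graph $\tilde z=\tilde h(\tilde x,\tilde y)$ of a Lipschitz function $\tilde h$ on the domain $\tilde D=\{(\tilde x,\tilde y):\tilde x\in[0,1],\ \frac{\sqrt2}{2}h^\partial(\tilde x,0)\le\tilde y\le\frac{\sqrt2}{2}(1+h^\partial(\tilde x,1))\}$, which depends only on $h^\partial$. For a slope $(\tilde s,\tilde t)$ with $-1\le\tilde t<1$ put $t=\frac{1+\tilde t}{1-\tilde t}$, $s=\frac{\sqrt2\,\tilde s}{1-\tilde t}$ and $\widetilde{ent}(\tilde s,\tilde t)=\frac{\sqrt2}{2}(1-\tilde t)\,ent(s,t)$; put $\widetilde{ent}(\tilde s,1)=-\infty$. Entropy functional: $Ent(h)=\iint_{\tilde D}\widetilde{ent}\left(\frac{\partial\tilde h}{\partial\tilde x},\frac{\partial\tilde h}{\partial\tilde y}\right)d\tilde x\,d\tilde y\in[-\infty,\infty)$. *)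

(* Defs.v *)
From HB Require Import structures.
From mathcomp Require Import all_boot all_order all_algebra.
From mathcomp Require Import all_classical all_reals all_analysis.

Set Implicit Arguments.
Unset Strict Implicit.
Unset Printing Implicit Defensive.

Import Order.TTheory GRing.Theory Num.Theory.
Import numFieldNormedType.Exports.

Local Open Scope classical_set_scope.
Local Open Scope ring_scope.

Section Defs.
Variable R : realType.
Implicit Types (h hb : R -> R -> R).

Definition D : set (R * R) := `[0, 1] `*` `[0, 1].

Definition bdD : set (R * R) :=
  [set p | D p /\ [\/ p.1 = 0, p.1 = 1, p.2 = 0 | p.2 = 1]].

(* Functions on [D] or [bdD] are total functions [R -> R -> R] of which only
   the values on that set are constrained or used. *)

Definition halfLipschitz_x (A : set (R * R)) h :=
  forall y, (2^-1).-lipschitz_([set x | A (x, y)]) (fun x => h x y).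

Definition nondecreasing_y (A : set (R * R)) h :=
  forall x y1 y2, A (x, y1) -> A (x, y2) -> y1 <= y2 -> h x y1 <= h x y2.

Definition boundary_height hb :=
  nondecreasing_y bdD hb /\ halfLipschitz_x bdD hb.

(* The space H of the boundary values [hb]. *)
Definition admissible hb : set (R -> R -> R) :=
  [set h | [/\ halfLipschitz_x D h,
               nondecreasing_y D h &
               forall x y, bdD (x, y) -> h x y = hb x y]].

Local Open Scope ereal_scope.

(* Meaningful for -1/2 <= s <= 1/2 and 0 <= t <= +oo. *)
Definition ent (s : R) (t : \bar R) : \bar R :=
  if t == 0 then 0
  else if (s == 2^-1)%R || (s == - 2^-1)%R then -oo
  else if t is r%:E then
    ((1 + ln (cos (pi * s) / (pi * r))) * r)%R%:E
  else -oo.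

(* Meaningful for st.2 <= 1; the case st.2 = 1 is the value -oo. *)
Definition ent_tilde (st : R * R) : \bar R :=
  let: (s, t) := st in
  if (t < 1)%R then
    (Num.sqrt 2 / 2 * (1 - t))%R%:E *
    ent (Num.sqrt 2 * s / (1 - t))%R ((1 + t) / (1 - t))%R%:E
  else -oo.

Local Close Scope ereal_scope.

(* Extension of h(x, .) from [0, 1] to R by h(x, 0) and h(x, 1). *)
Definition extend_y h (x y : R) : R := h x (Num.max 0 (Num.min 1 y)).

Definition surface h : set (R * R * R) :=
  [set p | let: (x, y, z) := p in
     [/\ D (x, y),
         lim (extend_y h x (y + eta) @[eta --> 0^'-]) <= z &
         z <= lim (extend_y h x (y + eta) @[eta --> 0^'+])]].

Definition rotate (p : R * R * R) : R * R * R :=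
  let: (x, y, z) := p in
  (x, Num.sqrt 2 / 2 * (y + z), Num.sqrt 2 / 2 * (z - y)).

(* For admissible [h] the rotated surface is a graph over [D_tilde], so the set
   below is a singleton there; the default 0 is only used off [D_tilde]. *)
Definition h_tilde h (x y : R) : R :=
  xget 0 [set z | (rotate @` surface h) (x, y, z)].

Definition D_tilde hb : set (R * R) :=
  [set p | [/\ 0 <= p.1 <= 1,
               Num.sqrt 2 / 2 * hb p.1 0 <= p.2 &
               p.2 <= Num.sqrt 2 / 2 * (1 + hb p.1 1)]].

(* Where a partial derivative does not exist, [derive1] is an arbitrary real;
   as [h_tilde h] is Lipschitz on [D_tilde hb], this is a null set. *)
Definition grad (f : R -> R -> R) (p : R * R) : R * R :=
  (derive1 (fun x => f x p.2) p.1, derive1 (f p.1) p.2).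

(* [ent_tilde] is bounded above on the slopes that occur and [D_tilde hb] is
   bounded, so the positive part of the integrand has a finite integral. *)
Definition Ent hb h : \bar R :=
  (\int[@lebesgue_measure R \x @lebesgue_measure R]_(p in D_tilde hb)
     ent_tilde (grad (h_tilde h) p))%E.

Definition maximizes_Ent hb h :=
  admissible hb h /\ forall g, admissible hb g -> (Ent hb g <= Ent hb h)%E.

End Defs.

(* Main.v *)
Require Import Defs.
From HB Require Import structures.
From mathcomp Require Import all_boot all_order all_algebra.
From mathcomp Require Import all_classical all_reals all_analysis.
From mathcomp Require Import measurable_realfun.
From mathcomp Require Import ring lra.
Set Implicit Arguments.
Unset Strict Implicit.
Unset Printing Implicit Defensive.
Import Order.TTheory GRing.Theory Num.Theory.
Import numFieldNormedType.Exports.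
Local Open Scope classical_set_scope.
Local Open Scope ring_scope.

(** The rotated surface of an admissible h is the graph of a function of the
    rotated coordinates (x, v), written [tilt h], and the proof works with these
    functions only.  If Y(x, u) denotes the height y at which y + h(x, y)
    crosses the value u, then [tilt h] at (x, v) is v - sqrt 2 * Y(x, sqrt 2 * v).
    Seen in this way, monotonicity in y and the 1/2-Lipschitz bound in x become
    two inequalities linear in f ([tilted]): f is 1-Lipschitz in v, and a step
    by (dx, sqrt 2 / 4 * |dx|) increases f by at most sqrt 2 / 4 * |dx|.  Together
    with the values outside the domain they define a convex class [heights],
    closed under pointwise limits.  Jumps of h have become segments of slope 1,
    so there is no loss of compactness.  Conversely every member of the class is
    the tilt of an admissible function ([untilt], [tilt_untilt]).

    By the definition of the entropy, Ent h is a constant minus the integral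
    [total_cost] of the cost 1 - ent_tilde of the gradient of [tilt h]
    ([Ent_total_cost]).  On the triangle [slopes], which contains every gradient,
    ent_tilde is the infimum over l > 0 of concave continuous functions
    [ent_upper l]: this is the tangent line inequality for the logarithm applied
    to the perspective [amp] of the cosine.  Hence the cost is nonnegative,
    convex and lower semicontinuous, and the midpoint inequality is strict
    between two slopes of finite cost with different v-components
    ([cost_midpoint_lt]).

    Existence ([exists_minimizer]).  Weak compactness is avoided by minimizing a
    second, uniformly convex functional, the integral of the squared gradient,
    among near-minimizers of the cost.  The parallelogram identity then makes
    the gradients of the sequence converge so fast in L2 that they converge
    almost everywhere ([minimizing_sequence], [ae_cvg_fast]).  The limit of the
    functions has the limit of the gradients as its gradient, by the fundamental
    theorem of calculus for Lipschitz functions on lines, and Fatou's lemma with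
    the semicontinuity of the cost shows that it is a minimizer.  The minimum is
    finite because of an explicit competitor ([ramp]) whose gradient takes only
    slopes of bounded cost.

    Uniqueness.  By strictness at the midpoint two minimizers have the same
    v-derivative almost everywhere, and they agree for very negative v, so they
    are equal ([unique_minimizer]).  It remains to recover h from its tilt at
    every point, although the tilt determines it only up to the choice of a
    value at each jump.  If h x y < h' x y with the same tilt f, then f has
    slope 1 in v on a vertical segment at x, and the cone inequality spreads
    this to an open set, where the cost is infinite: this contradicts the
    finiteness of the minimum ([tilt_inj_le]). *)

(** * Almost everywhere statements *)
Section AlmostEverywhere.
Context d (T : measurableType d) (R : realType) (m : {measure set T -> \bar R}).
Implicit Types P Q : T -> Prop.

Lemma ae_imp P Q : (forall x, P x -> Q x) ->
  {ae m, forall x, P x} -> {ae m, forall x, Q x}.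
Proof. by move=> PQ; apply: (@filterS _ _ (ae_filter_ringOfSetsType m)). Qed.

Lemma ae_and P Q : {ae m, forall x, P x} -> {ae m, forall x, Q x} ->
  {ae m, forall x, P x /\ Q x}.
Proof. exact: (@filterI _ _ (ae_filter_ringOfSetsType m)). Qed.

Lemma ae_imp2 P Q S : (forall x, P x -> Q x -> S x) ->
  {ae m, forall x, P x} -> {ae m, forall x, Q x} -> {ae m, forall x, S x}.
Proof.
by move=> PQS aP aQ; apply: ae_imp (ae_and aP aQ) => x [/PQS]; exact.
Qed.

Lemma ae_forall_nat (P : nat -> T -> Prop) :
  (forall n, {ae m, forall x, P n x}) -> {ae m, forall x, forall n, P n x}.
Proof.
move=> aP; have := negligible_bigcup aP.
apply: negligibleS => x /= /existsNP[n nP].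
by exists n.
Qed.

Lemma integrable_bounded (D : set T) (f : T -> R) (M : R) : measurable D ->
  (m D < +oo)%E -> measurable_fun D f -> (forall x, D x -> `|f x| <= M) ->
  m.-integrable D (EFin \o f).
Proof.
move=> mD Dfin mf fM; apply: measurable_bounded_integrable => //.
by exists M; split; [exact: num_real|move=> N MN x Dx; exact: le_trans (fM x Dx) (ltW MN)].
Qed.

End AlmostEverywhere.

(** * The fundamental theorem of calculus for Lipschitz functions *)
Section LipschitzFTC.
Variable R : realType.
Notation mu := (@lebesgue_measure R).

Lemma lebesgue_measure_oc_lty (a b : R) : (mu `]a, b]%classic < +oo)%E.
Proof. by rewrite lebesgue_measure_itv/=; case: ifP => _; rewrite ?ltry// -EFinD ltry. Qed.

Lemma integrable_cst_oc (a b L : R) :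
  mu.-integrable `]a, b] (cst L%:E).
Proof.
apply: (@integrable_bounded _ _ _ _ _ (cst L) `|L|) => //.
exact: lebesgue_measure_oc_lty.
Qed.

(** Both outer measures are infima over the same covers by half-open intervals,
    so it suffices to compare lengths of intervals. *)
Lemma lebesgue_stieltjes_le (F : cumulative R R) (L : R) : 0 < L ->
  (forall x y, x <= y -> F y - F x <= L * (y - x)) ->
  forall A, (lebesgue_stieltjes_measure F A <= L%:E * mu A)%E.
Proof.
move=> L0 FL A.
have wle X : ocitv X -> (wlength F X <= L%:E * wlength idfun X)%E.
  move=> /ocitvP[->|[[x y] /= xy ->]]; first by rewrite !wlength0 mule0.
  rewrite (wlength_itv_bnd _ _ _ (ltW xy)) (wlength_itv_bnd _ _ _ (ltW xy)).
  by rewrite -EFinM lee_fin; apply: FL; exact: ltW.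
rewrite -lee_pdivrMl// /lebesgue_measure /lebesgue_stieltjes_measure.
rewrite /measure_extension.
apply: le_ereal_inf_tmp => _ [B [mB AB] <-].
rewrite lee_pdivrMl// -nneseriesZl; last first.
  by move=> n _; exact: wlength_ge0.
apply: (@le_trans _ _ (\sum_(k <oo) wlength F (B k))%E).
  by apply: ereal_inf_lbound; exists B.
apply: lee_nneseries => [n _ _|n _]; first exact: wlength_ge0.
apply: wle; exact: (mB n).
Qed.

(** Almost every point is a Lebesgue point of the extension of g by 0, which is
    locally integrable on the whole line. *)
Lemma is_derive_integral (g : R -> R) (a b : R) : a < b ->
  mu.-integrable `]a, b] (EFin \o g) ->
  {ae mu, forall x, a < x < b ->
    is_derive x 1 (fun y => \int[mu]_(t in `]a, y]) g t) (g x)}.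
Proof.
move=> ab ig.
pose g' := g \_ `]a, b].
have lg' : locally_integrable setT g'.
  exact: integrable_locally_restrict.
have := @lebesgue_differentiation _ _ lg'.
apply: ae_imp => x g'x /andP[ax xb].
have ig' : mu.-integrable [set` Interval (BRight a) (BRight b)] (EFin \o g').
  apply: eq_integrable ig => //= y yab.
  by rewrite /g' patchE yab.
have [|dg' g'E] := @FTC1_lebesgue_pt _ g' (BRight a) x b xb ig' _ g'x.
  by rewrite /= ?bnd_simp ?ltEereal /= ?lte_fin.
have gE : g' x = g x by rewrite /g' patchE mem_set//= in_itv/= ax ltW.
have : is_derive x 1 (fun y => \int[mu]_(t in `]a, y]) g' t) (g x).
  by apply: DeriveDef => //; rewrite -derive1E g'E.
apply: near_eq_is_derive => //.
near=> y; apply: eq_Rintegral => t.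
rewrite inE/= in_itv/= => /andP[at_ ty].
rewrite /g' patchE mem_set//= in_itv/= at_/= (le_trans ty)//.
near: y; exact: (lt_le_nbhsl).
Unshelve. all: by end_near. Qed.

Lemma lipschitz_continuous (f : R -> R) (L : R) : 0 < L ->
  (forall x y, `|f x - f y| <= L * `|x - y|) -> continuous f.
Proof.
move=> L0 fL x; apply/cvgrPdist_le => e e0; near=> y.
apply: (le_trans (fL _ _)); rewrite -ler_pdivlMl//.
near: y; apply: cvgr_dist_le; first exact: cvg_id.
by rewrite mulr_gt0// invr_gt0.
Unshelve. all: by end_near. Qed.

(** Adding L * x makes f nondecreasing.  The Stieltjes measure of the sum is at
    most 2 * L times Lebesgue measure, hence has a Radon-Nikodym density, and g
    is this density minus L. *)
Lemma lipschitz_ftc (f : R -> R) (L a b : R) : 0 < L -> a < b ->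
  (forall x y, `|f x - f y| <= L * `|x - y|) ->
  exists g : R -> R, [/\ mu.-integrable `]a, b] (EFin \o g),
    forall x, a <= x <= b -> f x - f a = \int[mu]_(t in `]a, x]) g t &
    {ae mu, forall x, a < x < b -> is_derive x 1 f (g x)}].
Proof.
move=> L0 ab fL.
pose F x := f x + L * x.
have Fnd : nondecreasing F.
  move=> x y xy; rewrite /F.
  have := fL x y; rewrite (ler0_norm (_ : x - y <= 0)) ?subr_le0//.
  move=> /ler_normlP[]; lra.
have FL x y : x <= y -> F y - F x <= (2 * L) * (y - x).
  move=> xy; rewrite /F.
  have := fL x y; rewrite (ler0_norm (_ : x - y <= 0)) ?subr_le0//.
  move=> /ler_normlP[]; lra.
have Fc : right_continuous F.
  apply: right_continuousW => x.
  apply: cvgD; first exact: (lipschitz_continuous L0 fL).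
  by apply: cvgM; [exact: cvg_cst|exact: cvg_id].
pose Fcum : cumulative R R := HB.pack F (isCumulative.Build R _ R F Fnd Fc).
pose nu0 := lebesgue_stieltjes_measure Fcum.
have nu0E x : a <= x -> nu0 `]a, x]%classic = (F x - F a)%:E.
  move=> ax; rewrite /nu0 /lebesgue_stieltjes_measure /measure_extension.
  rewrite measurable_mu_extE; last exact: is_ocitv.
  exact: (wlength_itv_bnd Fcum _ _ ax).
have nu0fin : (nu0 `]a, b]%classic < +oo)%E by rewrite nu0E ?ltW ?ltry.
pose nu := mfrestr (measurable_itv `]a, b] : measurable (_ : set (measurableTypeR R))) nu0fin.
have numu : nu `<< mu.
  apply/null_content_dominatesP => A mA muA0.
  apply/eqP; rewrite -measure_le0 /nu /mfrestr /mrestr.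
  apply: (@le_trans _ _ (nu0 A)).
    by apply: le_measure; rewrite ?inE//; exact: measurableI.
  have L20 : 0 < 2 * L by rewrite mulr_gt0.
  have := @lebesgue_stieltjes_le Fcum _ L20 FL A.
  by rewrite (_ : mu A = 0)// mule0.
have [g [g0 gfin ig nuE]] := @radon_nikodym_sigma_finite _ _ R mu nu numu.
exists (fun x => fine (g x) - L).
have igE : mu.-integrable `]a, b] (EFin \o (fun x => fine (g x) - L)).
  have -> : EFin \o (fun x => fine (g x) - L) = (g \- cst L%:E)%E.
    by apply/funext => x /=; rewrite EFinB fineK.
  apply: integrableB => //; first exact: (integrableS measurableT).
  exact: integrable_cst_oc.
have gE x : ((fine (g x) - L)%:E = g x - L%:E)%E by rewrite EFinB fineK.
have ffE x : a <= x <= b -> f x - f a = \int[mu]_(t in `]a, x]) (fine (g t) - L).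
  move=> /andP[ax xb].
  have ixg : mu.-integrable `]a, x] g by exact: (integrableS measurableT).
  rewrite /Rintegral (eq_integral (fun t => g t - L%:E)%E); last by move=> t _.
  rewrite integralB//; last exact: integrable_cst_oc.
  rewrite -nuE// integral_cst//= lebesgue_measure_itv/= /nu /mfrestr /mrestr.
  rewrite setIidl; last first.
    by move=> t /=; rewrite !in_itv/= => /andP[-> /le_trans]; exact.
  rewrite -/nu0 nu0E// lte_fin; case: ltP => xa; rewrite /F.
    by rewrite /=; lra.
  by have -> : x = a; [apply/eqP; rewrite eq_le ax xa|rewrite mule0/=; lra].
split => //.
have := is_derive_integral ab igE.
apply: ae_imp => x dx /[dup] axb /dx {}dx.
have -> : f = (fun y => f a + (f y - f a)) by apply/funext => y; lra.
rewrite -[X in is_derive _ _ _ X]add0r.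
apply: is_deriveD.
apply: near_eq_is_derive dx => //.
have /andP[ax xb] := axb.
near=> y; rewrite -ffE//.
apply/andP; split.
  by apply: ltW; near: y; exact: lt_nbhsr.
by apply: ltW; near: y; exact: lt_nbhsl.
Unshelve. all: by end_near. Qed.

End LipschitzFTC.

Section LipschitzLimits.
Variable R : realType.
Notation mu := (@lebesgue_measure R).

Lemma ae_neq (b : R) : {ae mu, forall t, t != b}.
Proof.
exists [set b]; split => //; first exact: lebesgue_measure_set1.
by move=> t /= /negP/negPn/eqP.
Qed.

(** Derivatives are unique, so any bounded measurable function that is almost
    everywhere the derivative of f can replace the density of [lipschitz_ftc]. *)
Lemma lipschitz_integral (f g : R -> R) (L M a b : R) : 0 < L -> a < b ->
  (forall x y, `|f x - f y| <= L * `|x - y|) ->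
  measurable_fun setT g -> (forall x, `|g x| <= M) ->
  {ae mu, forall x, a < x < b -> is_derive x 1 f (g x)} ->
  forall x, a <= x <= b -> f x - f a = \int[mu]_(t in `]a, x]) g t.
Proof.
move=> L0 ab fL mg gM fg x axb.
have [g' [ig' fE fg']] := lipschitz_ftc L0 ab fL.
rewrite fE//; congr fine; apply: ae_eq_integral => //.
- apply/measurable_EFinP.
  have /integrableP[/measurable_EFinP mg' _] := ig'.
  apply: measurable_funS mg' => // t /=; rewrite !in_itv/= => /andP[-> /le_trans].
  by apply; case/andP: axb.
- exact/measurable_EFinP/measurable_funTS.
apply: ae_imp2 (ae_neq b) (ae_and fg fg') => t tb [gt g't] /=.
rewrite in_itv/= => /andP[at_ tx]; congr EFin.
have atb : a < t < b.
  by rewrite at_ lt_neqAle tb/= (le_trans tx)//; case/andP: axb.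
by rewrite -(@derive_val _ _ _ _ _ _ _ (gt atb)) -(@derive_val _ _ _ _ _ _ _ (g't atb)).
Qed.

Lemma cvg_lipschitz_integral (f_ g_ : nat -> R -> R) (g : R -> R) (L M a b : R) :
  0 < L -> a < b ->
  (forall n x y, `|f_ n x - f_ n y| <= L * `|x - y|) ->
  (forall n, measurable_fun setT (g_ n)) -> (forall n x, `|g_ n x| <= M) ->
  measurable_fun setT g ->
  (forall n, {ae mu, forall x, a < x < b -> is_derive x 1 (f_ n) (g_ n x)}) ->
  {ae mu, forall x, a < x < b -> g_ n x @[n --> \oo] --> g x} ->
  forall x, a <= x <= b ->
    (f_ n x - f_ n a) @[n --> \oo] --> \int[mu]_(t in `]a, x]) g t.
Proof.
move=> L0 ab fL mg_ gM mg fg gg x axb.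
rewrite [X in X @ _ --> _](_ : _ = fun n => \int[mu]_(t in `]a, x]) g_ n t); last first.
  apply/funext => n.
  exact: (lipschitz_integral L0 ab (fL n) (mg_ n) (gM n) (fg n)).
have /andP[ax xb] := axb.
have axin t : t != b -> `]a, x]%classic t -> a < t < b.
  rewrite /= in_itv/= => tb /andP[at_ tx].
  by rewrite at_ lt_neqAle tb/= (le_trans tx).
have mgn n : measurable_fun `]a, x] (EFin \o g_ n).
  exact/measurable_EFinP/measurable_funTS.
have mg' : measurable_fun `]a, x] (EFin \o g).
  exact/measurable_EFinP/measurable_funTS.
have cvg_g : {ae mu, forall t, `]a, x]%classic t ->
    (EFin \o g_ n) t @[n --> \oo] --> (EFin \o g) t}.
  apply: ae_imp2 (ae_neq b) gg => t tb gt /(axin _ tb) atb.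
  by apply: cvg_EFin; [exact: nearW|exact: gt].
have dom : {ae mu, forall t, forall n, `]a, x]%classic t ->
    (`|(EFin \o g_ n) t| <= cst M%:E t)%E}.
  by apply: aeW => t n _; rewrite /= lee_fin.
have [ig _ h] := @dominated_convergence _ (measurableTypeR R) R mu `]a, x]%classic
  (measurable_itv _) (fun n => EFin \o g_ n) (EFin \o g) (cst M%:E) mgn mg' cvg_g
  (integrable_cst_oc _ _ _) dom.
apply: fine_cvg; rewrite fineK; first exact: h.
exact: integrable_fin_num.
Qed.

(** Dominated convergence passes to the limit in the integral formula for the
    f_ n; the limit formula is then differentiated.  This is how the gradient of
    the limit of a minimizing sequence is identified, one line at a time. *)
Lemma is_derive_cvg (f_ g_ : nat -> R -> R) (f g : R -> R) (L M a b : R) :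
  0 < L -> a < b ->
  (forall n x y, `|f_ n x - f_ n y| <= L * `|x - y|) ->
  (forall n, measurable_fun setT (g_ n)) -> (forall n x, `|g_ n x| <= M) ->
  measurable_fun setT g -> (forall x, `|g x| <= M) ->
  (forall n, {ae mu, forall x, a < x < b -> is_derive x 1 (f_ n) (g_ n x)}) ->
  {ae mu, forall x, a < x < b -> g_ n x @[n --> \oo] --> g x} ->
  (forall x, a <= x <= b -> f_ n x @[n --> \oo] --> f x) ->
  {ae mu, forall x, a < x < b -> is_derive x 1 f (g x)}.
Proof.
move=> L0 ab fL mg_ g_M mg gM fg gg ff.
have ig : mu.-integrable `]a, b] (EFin \o g).
  apply: (@integrable_bounded _ (measurableTypeR R) _ mu _ g M) => //.
    exact: lebesgue_measure_oc_lty.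
  exact: measurable_funTS.
have fE x : a <= x <= b -> f x = f a + \int[mu]_(t in `]a, x]) g t.
  move=> axb.
  have h := cvg_lipschitz_integral L0 ab fL mg_ g_M mg fg gg axb.
  have h2 : (f_ n x - f_ n a) @[n --> \oo] --> f x - f a.
    by apply: cvgB; apply: ff => //; rewrite lexx ltW.
  have -> : \int[mu]_(t in `]a, x]) g t = f x - f a.
    by apply: cvg_unique h h2; exact: Rhausdorff.
  by rewrite addrC subrK.
apply: ae_imp (is_derive_integral ab ig) => x dx /[dup] /andP[ax xb] /dx {}dx.
have := is_deriveD (is_derive_cst (f a) x 1) dx; rewrite add0r.
apply: near_eq_is_derive; near=> y.
rewrite /= [RHS]fE//; apply/andP; split.
  by apply: ltW; near: y; exact: lt_nbhsr.
by apply: ltW; near: y; exact: lt_nbhsl.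
Unshelve. all: by end_near. Qed.

End LipschitzLimits.

(** * Null sets of the plane and their sections *)
Section PlaneNullSets.
Variable R : realType.
Notation mu := (@lebesgue_measure R).
Notation mu2 := (@lebesgue_measure R \x @lebesgue_measure R)%E.
Notation plane := (measurableTypeR R * measurableTypeR R)%type.

Lemma prod_ae2 (A : set plane) : measurable A ->
  {ae mu, forall x, {ae mu, forall v, A (x, v)}} -> {ae mu2, forall p, A p}.
Proof.
move=> mA Ax; have mC : measurable (~` A) by exact: measurableC.
apply/negligibleP => //.
transitivity (\int[mu]_x `|mu (xsection (~` A) x)|)%E.
  by rewrite /product_measure1/=; apply: eq_integral => x _; rewrite gee0_abs.
apply/(ae_eq_integral_abs mu measurableT (measurable_fun_xsection mu mC)).
apply: ae_imp Ax => x Ax _; apply/negligibleP; first exact: measurable_xsection.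
by apply: negligibleS Ax => v /=; rewrite xsectionE.
Qed.

(** The product measure is defined by integrating the measures of the sections at
    fixed x; Tonelli's theorem exchanges the roles of the two variables. *)
Lemma prod_measure_ysection (A : set plane) : measurable A ->
  mu2 A = (\int[mu]_v mu (ysection A v))%E.
Proof.
move=> mA; transitivity (\int[mu2]_z (\1_A z)%:E)%E.
  by rewrite integral_indic// setIT.
rewrite (@fubini_tonelli2 _ _ _ _ _ mu mu (fun z => (\1_A z)%:E)); first last.
- by move=> z; rewrite lee_fin.
- exact/measurable_EFinP/measurable_indic.
apply: eq_integral => v _; rewrite /fubini_G/=.
transitivity (\int[mu]_x (\1_(ysection A v) x)%:E)%E.
  by apply: eq_integral => x _; rewrite !indicE mem_ysection.
by rewrite integral_indic// ?setIT//; exact: measurable_ysection.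
Qed.

Lemma prod_ae1 (A : set plane) : measurable A ->
  {ae mu, forall v, {ae mu, forall x, A (x, v)}} -> {ae mu2, forall p, A p}.
Proof.
move=> mA Av; have mC : measurable (~` A) by exact: measurableC.
apply/negligibleP => //; transitivity (\int[mu]_v `|mu (ysection (~` A) v)|)%E.
  transitivity (mu2 (~` A)) => //; rewrite prod_measure_ysection//.
  by apply: eq_integral => v _; rewrite gee0_abs.
apply/(ae_eq_integral_abs mu measurableT (measurable_fun_ysection mu mC)).
apply: ae_imp Av => v Av _; apply/negligibleP; first exact: measurable_ysection.
by apply: negligibleS Av => x /=; rewrite ysectionE.
Qed.

Lemma ae_prod2 (P : plane -> Prop) : {ae mu2, forall p, P p} ->
  {ae mu, forall x, {ae mu, forall v, P (x, v)}}.
Proof.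
move=> [A [mA A0 PA]].
have h : (\int[mu]_x `|mu (xsection A x)|)%E = 0%E.
  rewrite -[RHS]A0 /product_measure1/=; apply: eq_integral => x _.
  by rewrite gee0_abs.
have := (ae_eq_integral_abs mu measurableT (measurable_fun_xsection mu mA)).1 h.
apply: ae_imp => x /(_ I) Ax0; exists (xsection A x); split => //.
  exact: measurable_xsection.
by move=> v /= nP; rewrite /xsection/= inE; exact: PA.
Qed.

Lemma ae_prod1 (P : plane -> Prop) : {ae mu2, forall p, P p} ->
  {ae mu, forall v, {ae mu, forall x, P (x, v)}}.
Proof.
move=> [A [mA A0 PA]].
have h : (\int[mu]_v `|mu (ysection A v)|)%E = 0%E.
  transitivity (mu2 A) => //; rewrite prod_measure_ysection//.
  by apply: eq_integral => v _; rewrite gee0_abs.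
have := (ae_eq_integral_abs mu measurableT (measurable_fun_ysection mu mA)).1 h.
apply: ae_imp => v /(_ I) Av0; exists (ysection A v); split => //.
  exact: measurable_ysection.
by move=> x /= nP; rewrite /ysection/= inE; exact: PA.
Qed.

End PlaneNullSets.

(** * Differentiability almost everywhere in the plane *)
Section Derivative.
Variable R : realType.

(** A form of differentiability without division, whose restriction to rational
    increments makes the set of points of differentiability measurable. *)
Lemma is_derive_epsP (f : R -> R) (x d : R) : is_derive x 1 f d <->
  forall e : R, 0 < e -> exists2 r : R, 0 < r & forall h : R, `|h| < r ->
    `|f (x + h) - f x - h * d| <= e * `|h|.
Proof.
split=> [fd e e0|fd].
  have fd' : (fun h => h^-1 *: ((f \o shift x) (h *: 1) - f x)) @ 0^' --> d.
    by have [df <-] := fd.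
  move/cvgrPdist_le : fd' => /(_ e e0) [r /= r0 rP]; exists r => // h hr.
  have [->|h0] := eqVneq h 0; first by rewrite addr0 subrr mul0r subr0 normr0 mulr0.
  have := rP h; rewrite /ball_/= sub0r normrN => /(_ hr h0).
  rewrite -ler_pdivrMr ?normr_gt0// -normf_div; apply: le_trans.
  rewrite distrC le_eqVlt; apply/orP; left; apply/eqP; congr `|_|.
  by rewrite /GRing.scale/= mulr1 (addrC h); field.
have fd' : (fun h => h^-1 *: ((f \o shift x) (h *: 1) - f x)) @ 0^' --> d.
  apply/cvgrPdist_le => e e0; have [r r0 rP] := fd e e0.
  near=> h.
  have h0 : h != 0 by near: h; exact: nbhs_dnbhs_neq.
  have hr : `|h| < r by near: h; exact: dnbhs0_lt.
  have := rP h hr.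
  rewrite -ler_pdivrMr ?normr_gt0// -normf_div; apply: le_trans.
  rewrite distrC le_eqVlt; apply/orP; left; apply/eqP; congr `|_|.
  by rewrite /GRing.scale/= mulr1 (addrC h); field.
apply: DeriveDef; first by apply/cvg_ex; exists d.
by apply/cvg_lim.
Unshelve. all: by end_near. Qed.

End Derivative.

Section PlaneLipschitz.
Variable R : realType.
Notation mu := (@lebesgue_measure R).
Notation mu2 := (@lebesgue_measure R \x @lebesgue_measure R)%E.
Notation plane := (measurableTypeR R * measurableTypeR R)%type.
Implicit Types f : R -> R -> R.

Definition lipschitz2 f :=
  forall x v x' v', `|f x v - f x' v'| <= `|x - x'| + `|v - v'|.

Lemma measurable_set_le d (T : measurableType d) (g h : T -> R) :
  measurable_fun setT g -> measurable_fun setT h ->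
  measurable [set x | g x <= h x].
Proof.
move=> mg mh; have := measurable_fun_ler mg mh.
by move=> /(_ measurableT [set true]); rewrite setTI; exact.
Qed.

Lemma measurable_set_lt d (T : measurableType d) (g h : T -> R) :
  measurable_fun setT g -> measurable_fun setT h ->
  measurable [set x | g x < h x].
Proof.
move=> mg mh; have := measurable_fun_ltr mg mh.
by move=> /(_ measurableT [set true]); rewrite setTI; exact.
Qed.

Lemma rat_near (x e : R) : 0 < e -> exists q : rat, `|x - ratr q| < e.
Proof.
move=> e0; have [|q] := @rat_in_itvoo _ (x - e) (x + e); first by lra.
by rewrite in_itv/= => /andP[q1 q2]; exists q; rewrite ltr_norml; lra.
Qed.

(** f is the supremum, over the rational points, of the downward cones below its
    graph with apex at these points. *)
Lemma lipschitz2_measurable f : lipschitz2 f ->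
  measurable_fun setT (fun p : plane => f p.1 p.2).
Proof.
move=> fL; apply: (measurability _ (RGenOInfty.measurableE R)).
move=> _ [_ [a ->] <-]; rewrite setTI.
rewrite (_ : _ @^-1` _ = \bigcup_(q1 : rat) \bigcup_(q2 : rat)
  [set p : plane | a < f (ratr q1) (ratr q2) - `|p.1 - ratr q1| - `|p.2 - ratr q2|]).
  apply: bigcupT_measurable_rat => q1; apply: bigcupT_measurable_rat => q2.
  apply: measurable_set_lt => //.
  apply: measurable_funB; first apply: measurable_funB => //.
    apply: measurableT_comp => //; apply: measurable_funB => //.
  by apply: measurableT_comp => //; apply: measurable_funB.
apply/seteqP; split => [[x v]/=|[x v] [q1 _ [q2 _]] /=]; rewrite in_itv/= andbT.
  move=> af; pose e := (f x v - a) / 4.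
  have e0 : 0 < e by rewrite divr_gt0// subr_gt0.
  have [q1 q1e] := rat_near x e0; have [q2 q2e] := rat_near v e0.
  exists q1 => //; exists q2 => //=.
  have := fL x v (ratr q1) (ratr q2); move/ler_normlP => [_].
  by rewrite /e in q1e q2e *; lra.
have := fL x v (ratr q1) (ratr q2); move/ler_normlP => []; lra.
Qed.

End PlaneLipschitz.

Section Gradient.
Variable R : realType.
Notation mu := (@lebesgue_measure R).
Notation mu2 := (@lebesgue_measure R \x @lebesgue_measure R)%E.
Notation plane := (measurableTypeR R * measurableTypeR R)%type.
Implicit Types f : R -> R -> R.

Lemma bigcapT_measurable_rat d (T : measurableType d) (F : rat -> set T) :
  (forall q, measurable (F q)) -> measurable (\bigcap_q F q).
Proof.
move=> mF; rewrite -[X in measurable X]setCK setC_bigcap; apply: measurableC.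
by apply: bigcupT_measurable_rat => q; exact: measurableC.
Qed.

Lemma invS_lt (e : R) : 0 < e -> exists m : nat, m.+1%:R^-1 < e.
Proof.
move=> e0; have [N _ NP] := near_infty_natSinv_lt (PosNum e0).
by exists N; apply: NP => /=.
Qed.

Definition dquot2 f (n : nat) (p : plane) : R :=
  n.+1%:R * (f p.1 (p.2 + n.+1%:R^-1) - f p.1 p.2).

(** A superior limit rather than a derivative, so that it is measurable and
    bounded everywhere; it is the derivative wherever that exists. *)
Definition slope2 f (p : plane) : R := limn_sup (dquot2 f ^~ p).

Lemma is_derive_slope2 f (p : plane) (d : R) :
  is_derive (p.2 : R) 1 (f p.1) d -> slope2 f p = d.
Proof.
move=> /is_derive_epsP fd.
suff : dquot2 f n p @[n --> \oo] --> d by move=> /cvg_limn_inf_sup[].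
apply/cvgrPdist_le => e e0; have [r r0 rP] := fd e e0.
near=> n.
have n0 : (0 : R) < n.+1%:R by rewrite ltr0n.
have := rP n.+1%:R^-1; rewrite gtr0_norm ?invr_gt0// => /(_ _)/wrap[].
  by near: n; exact: near_infty_natSinv_lt (PosNum r0).
rewrite ler_pdivlMr// => h.
suff -> : d - dquot2 f n p =
    - ((f p.1 (p.2 + n.+1%:R^-1) - f p.1 p.2 - n.+1%:R^-1 * d) * n.+1%:R).
  by rewrite normrN normrM (gtr0_norm n0).
rewrite /dquot2; field; by rewrite -natr1 in n0 *; rewrite gt_eqF.
Unshelve. all: by end_near. Qed.

Lemma lipschitz2_r f (x : R) : lipschitz2 f ->
  forall v w, `|f x v - f x w| <= 1 * `|v - w|.
Proof. by move=> fL v w; rewrite mul1r (le_trans (fL _ _ _ _))// subrr normr0 add0r. Qed.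

Lemma lipschitz2_flip f : lipschitz2 f -> lipschitz2 (fun v x => f x v).
Proof. by move=> fL v x v' x'; rewrite [leRHS]addrC; exact: fL. Qed.

Lemma normr_dquot2 f n p : lipschitz2 f -> `|dquot2 f n p| <= 1.
Proof.
move=> fL; rewrite /dquot2 normrM ger0_norm// -ler_pdivlMl ?ltr0n// mulr1.
apply: (le_trans (lipschitz2_r _ fL _ _)).
by rewrite mul1r addrAC subrr add0r ger0_norm// invr_ge0.
Qed.

Lemma measurable_dquot2 f n : lipschitz2 f -> measurable_fun setT (dquot2 f n).
Proof.
move=> fL; apply: measurable_funM => //; apply: measurable_funB.
  have mf := lipschitz2_measurable fL.
  pose h (p : plane) : plane := (p.1, p.2 + n.+1%:R^-1).
  have mh : measurable_fun setT h.
    by apply: measurable_fun_pair => //; exact: measurable_funD.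
  exact: (measurableT_comp mf mh).
exact: lipschitz2_measurable.
Qed.

Lemma measurable_slope2 f : lipschitz2 f -> measurable_fun setT (slope2 f).
Proof.
move=> fL; apply: measurable_fun_limn_sup => [p _|p _|n].
- exists 1 => _ [n _ <-]; by have /ler_normlP[] := normr_dquot2 n p fL.
- by exists (-1) => _ [n _ <-]; have /ler_normlP[] := normr_dquot2 n p fL; lra.
- exact: measurable_dquot2.
Qed.

Definition diff2 f : set plane :=
  [set p | is_derive (p.2 : R) 1 (f p.1) (slope2 f p)].

(** Lipschitz functions are determined up to small errors by rational
    increments, which exhibits the set of points of differentiability as a
    countable combination of measurable sets. *)
Lemma diff2E f : lipschitz2 f -> diff2 f =
  \bigcap_k \bigcup_m \bigcap_(q : rat)
    [set p : plane | `|(ratr q : R)| < m.+1%:R^-1 ->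
      `|f p.1 (p.2 + ratr q) - f p.1 p.2 - ratr q * slope2 f p|
        <= k.+1%:R^-1 * `|ratr q|].
Proof.
move=> fL; apply/seteqP; split => [p /is_derive_epsP pd k _|p pd].
  have [|r r0 rP] := pd k.+1%:R^-1; first by rewrite invr_gt0.
  have [m mr] := invS_lt r0.
  by exists m => // q _ /= qm; apply: rP; exact: lt_trans mr.
apply/is_derive_epsP => e e0.
have [k ke] := invS_lt e0.
have [m _ mP] := pd k I.
exists m.+1%:R^-1; first by rewrite invr_gt0.
move=> h hm; rewrite leNgt; apply/negP => abs.
set d := slope2 f p in mP abs.
pose eta := `|f p.1 (p.2 + h) - f p.1 p.2 - h * d| - e * `|h|.
have eta0 : 0 < eta by rewrite subr_gt0.
have C0 : 0 < 1 + `|d| + e by rewrite ltr_pwDr// addr_ge0.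
have [|q] := @rat_near _ h (Num.min (eta / (1 + `|d| + e)) (m.+1%:R^-1 - `|h|)).
  by rewrite lt_min divr_gt0//= subr_gt0.
rewrite lt_min ltr_pdivlMr// => /andP[q1 q2].
have hq : `|(ratr q : R)| <= `|h - ratr q| + `|h|.
  by have := ler_normD (ratr q - h) h; rewrite subrK (distrC _ h).
have qm : `|(ratr q : R)| < m.+1%:R^-1.
  by apply: le_lt_trans hq _; rewrite -ltrBrDr.
have := mP q I qm.
have h1 := lipschitz2_r p.1 fL (p.2 + h) (p.2 + ratr q).
rewrite mul1r (_ : p.2 + h - (p.2 + ratr q) = h - ratr q) in h1; last by lra.
have h2 : e * `|(ratr q : R)| <= e * `|h| + e * `|h - ratr q|.
  by rewrite -mulrDr ler_pM2l// addrC.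
have h3 : `|f p.1 (p.2 + h) - f p.1 p.2 - h * d| <=
  `|f p.1 (p.2 + ratr q) - f p.1 p.2 - ratr q * d| +
  `|f p.1 (p.2 + h) - f p.1 (p.2 + ratr q)| + `|h - ratr q| * `|d|.
  rewrite -normrM.
  have -> : f p.1 (p.2 + h) - f p.1 p.2 - h * d =
    (f p.1 (p.2 + ratr q) - f p.1 p.2 - ratr q * d) +
    (f p.1 (p.2 + h) - f p.1 (p.2 + ratr q)) - (h - ratr q) * d by lra.
  by rewrite (le_trans (ler_normB _ _))// lerD2r ler_normD.
have h4 : k.+1%:R^-1 * `|(ratr q : R)| <= e * `|(ratr q : R)|.
  by rewrite ler_wpM2r// ltW.
have aux (A B C X Q H D c : R) : X * (1 + D + e) < A - e * H -> C <= X ->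
    e * Q <= e * H + e * X -> A <= B + C + X * D -> c * Q <= e * Q ->
    B <= c * Q -> False by lra.
exact: (aux _ _ _ _ _ _ _ _ q1 h1 h2 h3 h4).
Qed.

Lemma measurable_diff2 f : lipschitz2 f -> measurable (diff2 f).
Proof.
move=> fL; rewrite diff2E//; apply: bigcapT_measurable => k.
apply: bigcupT_measurable => m; apply: bigcapT_measurable_rat => q.
have [qm|qm] := pselect (`|(ratr q : R)| < m.+1%:R^-1); last first.
  rewrite (_ : [set _ | _] = setT)//; apply/seteqP; split => // p _ /=.
  by move=> qm'; exfalso; exact: qm.
rewrite (_ : [set _ | _] = [set p : plane |
   `|f p.1 (p.2 + ratr q) - f p.1 p.2 - ratr q * slope2 f p|
        <= k.+1%:R^-1 * `|ratr q|]); last first.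
  by apply/seteqP; split => p /=; [exact|move=> h _].
apply: measurable_set_le => //; apply: measurableT_comp => //.
have mf := lipschitz2_measurable fL.
apply: measurable_funB; last exact: measurable_funM (measurable_slope2 fL).
apply: measurable_funB => //.
pose h (p : plane) : plane := (p.1, p.2 + ratr q).
have mh : measurable_fun setT h.
  by apply: measurable_fun_pair => //; exact: measurable_funD.
exact: (measurableT_comp mf mh).
Qed.

Lemma ae_diff2_section f (x : R) : lipschitz2 f ->
  {ae mu, forall v, diff2 f (x, v)}.
Proof.
move=> fL; have h n : {ae mu, forall v, - n.+1%:R < v < n.+1%:R -> diff2 f (x, v)}.
  have n0 : - n.+1%:R < n.+1%:R :> R by rewrite gtrN// ltr0n.
  have [g [_ _]] := lipschitz_ftc ltr01 n0 (lipschitz2_r x fL).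
  apply: ae_imp => v vP nvn.
  have /= := vP nvn => dg.
  by rewrite /diff2/= (@is_derive_slope2 f (x, v) (g v)).
apply: ae_imp (ae_forall_nat h) => v vP.
apply: (vP (Num.truncn `|v|)).
by rewrite -ltr_norml truncnS_gt.
Qed.

Lemma ae_diff2 f : lipschitz2 f -> {ae mu2, forall p, diff2 f p}.
Proof.
move=> fL; apply: prod_ae2; first exact: measurable_diff2.
by apply: aeW => x; exact: ae_diff2_section.
Qed.

Definition has_grad f (p g : R * R) :=
  is_derive p.1 1 (f ^~ p.2) g.1 /\ is_derive p.2 1 (f p.1) g.2.

Definition slope1 f (p : plane) := slope2 (fun v x => f x v) (p.2, p.1).

Lemma has_grad_grad f p g : has_grad f p g -> grad f p = g.
Proof.
case: g => g1 g2 [/= d1 d2]; rewrite /grad !derive1E.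
by rewrite (@derive_val _ _ _ _ _ _ _ d1) (@derive_val _ _ _ _ _ _ _ d2).
Qed.

Lemma has_grad_slope f p g : has_grad f p g -> (slope1 f p, slope2 f p) = g.
Proof.
case: g => g1 g2 [/= d1 d2]; rewrite (is_derive_slope2 d2) /slope1.
by rewrite (@is_derive_slope2 (fun v x => f x v) (p.2, p.1) g1).
Qed.

Definition differentiable_set f : set plane :=
  [set p | has_grad f p (slope1 f p, slope2 f p)].

Lemma differentiable_setE f : differentiable_set f =
  ((fun p => (p.2, p.1)) @^-1` diff2 (fun v x => f x v)) `&` diff2 f.
Proof. by apply/seteqP; split. Qed.

Lemma measurable_differentiable_set f : lipschitz2 f ->
  measurable (differentiable_set f).
Proof.
move=> fL; rewrite differentiable_setE; apply: measurableI.
  have := @measurable_swap _ _ (measurableTypeR R) (measurableTypeR R).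
  move=> /(_ measurableT _ (measurable_diff2 (lipschitz2_flip fL))).
  by rewrite setTI.
exact: measurable_diff2.
Qed.

(** Both partial derivatives exist almost everywhere on each line by
    [lipschitz_ftc]; since the exceptional sets are measurable, they are null in
    the plane by Tonelli's theorem. *)
Lemma ae_differentiable f : lipschitz2 f ->
  {ae mu2, forall p, differentiable_set f p}.
Proof.
move=> fL; rewrite differentiable_setE.
have flL := lipschitz2_flip fL.
have mswap : measurable ((fun p => (p.2, p.1)) @^-1` diff2 (fun v x => f x v) : set plane).
  have := @measurable_swap _ _ (measurableTypeR R) (measurableTypeR R).
  by move=> /(_ measurableT _ (measurable_diff2 flL)); rewrite setTI.
apply: ae_and; last exact: ae_diff2.
apply: (prod_ae1 mswap); apply: aeW => v.
exact: ae_diff2_section flL.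
Qed.

End Gradient.

(** * The local entropy in rotated coordinates *)
Section Entropy.
Variable R : realType.
Notation plane := (measurableTypeR R * measurableTypeR R)%type.
Implicit Types (s t : R) (z : R * R).

(** The image of the slopes |s| <= 1/2, 0 <= t <= +oo under the rotation: a
    triangle whose vertex (0, 1) corresponds to t = +oo. *)
Definition slopes : set (R * R) :=
  [set z | -1 <= z.2 <= 1 /\ `|z.1| <= Num.sqrt 2 / 4 * (1 - z.2)].

(** With r = (1 - z.2) / 2 and p = z.1 / sqrt 2 this is r * cos (pi * (p / r)),
    the perspective of the concave function cos (pi * x). *)
Definition amp z : R := (1 - z.2) / 2 * cos (pi * (Num.sqrt 2 * z.1 / (1 - z.2))).

(** With q = (1 + z.2) / 2, the entropy is sqrt 2 * q * (1 + ln (amp z / (pi * q))).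
    Replacing ln by its tangent line at l / pi gives this upper bound, which
    is concave in z and touches the entropy at amp z = l * q. *)
Definition ent_upper (l : R) z : R :=
  Num.sqrt 2 * ((1 + z.2) / 2 * ln (l / pi) + amp z / l).

Lemma sqrt2_gt0 : 0 < Num.sqrt 2 :> R.
Proof. by rewrite sqrtr_gt0. Qed.

Lemma sqrt2_sqr : Num.sqrt 2 * Num.sqrt 2 = 2 :> R.
Proof. by rewrite -expr2 sqr_sqrtr. Qed.

Lemma ln_le_sub1 (x : R) : 0 < x -> ln x <= x - 1.
Proof. by move=> x0; rewrite -[x in ln x](subrKC 1); apply: le_ln1Dx; lra. Qed.

Lemma ln_lt_sub1 (x : R) : 0 < x -> x != 1 -> ln x < x - 1.
Proof.
move=> x0 x1; pose y := ln x.
have -> : x = expR y by rewrite lnK.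
rewrite expRK ltrBrDr addrC; apply: expR_gt1Dx.
by rewrite /y ln_eq0.
Qed.

Lemma cos_tangent (a b : R) : - (pi / 2) <= a <= pi / 2 -> - (pi / 2) <= b <= pi / 2 ->
  cos b <= cos a - sin a * (b - a) ?= iff (b == a).
Proof.
move=> ha hb; apply/leifP; have [->|ba] := eqVneq b a.
  by rewrite subrr mulr0 subr0.
have dcos (x : R) : is_derive x 1 cos (- sin x) by exact: is_derive_cos.
have ccos (x y : R) : {within `[x, y], continuous (@cos R)}.
  by apply: continuous_subspaceT => z; exact: continuous_cos.
have /orP[ab|ab] : (a < b) || (b < a) by rewrite -neq_lt eq_sym.
  have [c] := @MVT R cos (fun x => - sin x) a b ab (fun x _ => dcos x) (ccos a b).
  rewrite in_itv/= => /andP[ac cb] e.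
  have : sin a < sin c.
    by rewrite ltr_sin// in_itv/=; lra.
  by rewrite -ltrBlDl e mulNr ltrN2 ltr_pM2r// subr_gt0.
have [c] := @MVT R cos (fun x => - sin x) b a ab (fun x _ => dcos x) (ccos b a).
rewrite in_itv/= => /andP[bc ca] e.
have : sin c < sin a.
  by rewrite ltr_sin// in_itv/=; lra.
move=> sc; have : - sin c * (a - b) > - sin a * (a - b).
  by rewrite !mulNr ltrN2 ltr_pM2r// subr_gt0.
rewrite -e; lra.
Qed.

Lemma slopes_angle z : slopes z -> z.2 < 1 ->
  - (pi / 2) <= pi * (Num.sqrt 2 * z.1 / (1 - z.2)) <= pi / 2.
Proof.
case: z => s t [/= _ zs] t1.
have r0 : 0 < 1 - t by rewrite subr_gt0.
have : `|Num.sqrt 2 * s / (1 - t)| <= 1 / 2.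
  rewrite normrM normrV ?unitfE ?gt_eqF// (gtr0_norm r0) ler_pdivrMr//.
  rewrite normrM (gtr0_norm sqrt2_gt0).
  apply: (@le_trans _ _ (Num.sqrt 2 * (Num.sqrt 2 / 4 * (1 - t)))).
    by rewrite ler_pM2l ?sqrt2_gt0.
  by rewrite mulrA mulrA sqrt2_sqr; lra.
move=> /ler_normlP[h1 h2]; have p0 := pi_gt0 R; nra.
Qed.

Lemma amp_ge0 z : slopes z -> 0 <= amp z.
Proof.
move=> Kz; have [t1|t1] := ltP z.2 1; last first.
  have : z.2 = 1 by case: Kz => /andP[_ h] _; apply/eqP; rewrite eq_le h.
  by rewrite /amp => ->; rewrite subrr !mul0r.
by rewrite mulr_ge0//; [rewrite divr_ge0// subr_ge0 ltW|apply: cos_ge0_pihalf; exact: slopes_angle].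
Qed.

Definition midpoint z1 z2 : R * R := ((z1.1 + z2.1) / 2, (z1.2 + z2.2) / 2).

Lemma slopes_midpoint z1 z2 : slopes z1 -> slopes z2 -> slopes (midpoint z1 z2).
Proof.
move=> [/andP[a1 b1] c1] [/andP[a2 b2] c2]; split; rewrite /midpoint/=; first by lra.
rewrite normrM (@ger0_norm _ 2^-1)//.
have := ler_normD z1.1 z2.1; lra.
Qed.

Lemma slopes_t1 z : slopes z -> 1 <= z.2 -> z.2 = 1 /\ z.1 = 0.
Proof.
move=> [/andP[_ h1] h2] h3; have t1 : z.2 = 1 by apply/eqP; rewrite eq_le h1.
split => //; apply/eqP; rewrite -normr_le0; apply: le_trans h2 _.
by rewrite t1 subrr mulr0.
Qed.

Notation angle z := (pi * (Num.sqrt 2 * z.1 / (1 - z.2))).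

(** The tangent line of the cosine at the angle m of the midpoint bounds both
    cosines; weighted by (1 - z1.2) / 2 and (1 - z2.2) / 2 the linear terms cancel,
    because the angle at the midpoint is the weighted mean of the two angles. *)
Lemma amp_midpoint z1 z2 : slopes z1 -> slopes z2 ->
  amp z1 + amp z2 <= 2 * amp (midpoint z1 z2).
Proof.
move=> K1 K2; have [t1|t1] := ltP z1.2 1; last first.
  have [e1 e2] := slopes_t1 K1 t1; rewrite /amp /midpoint e1 e2/= subrr mul0r !mul0r add0r add0r.
  have -> : Num.sqrt 2 * (z2.1 / 2) / (1 - (1 + z2.2) / 2) = Num.sqrt 2 * z2.1 / (1 - z2.2).
    have [->|t2] := eqVneq z2.2 1.
      have -> : 1 - (1 + 1) / 2 = 0 :> R by lra.
      by rewrite subrr invr0 !mulr0.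
    by field; do ?[apply/andP; split]; apply/eqP => h; move/eqP : t2; apply; lra.
  lra.
have [t2|t2] := ltP z2.2 1; last first.
  have [e1 e2] := slopes_t1 K2 t2; rewrite /amp /midpoint e1 e2/= subrr mul0r !mul0r addr0 addr0.
  have -> : Num.sqrt 2 * (z1.1 / 2) / (1 - (z1.2 + 1) / 2) = Num.sqrt 2 * z1.1 / (1 - z1.2).
    by field; do ?[apply/andP; split]; apply/eqP => h; lra.
  lra.
have tm : (midpoint z1 z2).2 < 1 by rewrite /midpoint/=; lra.
have a1 := slopes_angle K1 t1; have a2 := slopes_angle K2 t2.
have am := slopes_angle (slopes_midpoint K1 K2) tm.
have [h1 _] := cos_tangent am a1; have [h2 _] := cos_tangent am a2.
rewrite /amp.
set m := angle (midpoint z1 z2) in am h1 h2 *.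
have r1 : 0 <= (1 - z1.2) / 2 by lra.
have r2 : 0 <= (1 - z2.2) / 2 by lra.
have := lerD (ler_wpM2l r1 h1) (ler_wpM2l r2 h2); move=> /le_trans; apply.
rewrite le_eqVlt; apply/orP; left; apply/eqP.
have e : (1 - z1.2) / 2 * angle z1 + (1 - z2.2) / 2 * angle z2 =
    2 * ((1 - (midpoint z1 z2).2) / 2) * m.
  rewrite /m /midpoint/=; field.
  by apply/and3P; split; apply/eqP => h; lra.
rewrite /midpoint/= in e *.
transitivity ((1 - z1.2 + (1 - z2.2)) / 2 * cos m - sin m *
  ((1 - z1.2) / 2 * angle z1 + (1 - z2.2) / 2 * angle z2 - (1 - z1.2 + (1 - z2.2)) / 2 * m)).
  by ring.
by rewrite e; field.
Qed.

Lemma amp_midpoint_lt z1 z2 : slopes z1 -> slopes z2 -> z1.2 < 1 -> z2.2 < 1 ->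
  angle z1 != angle z2 ->
  amp z1 + amp z2 < 2 * amp (midpoint z1 z2).
Proof.
move=> K1 K2 t1 t2 ne.
have tm : (midpoint z1 z2).2 < 1 by rewrite /midpoint/=; lra.
have a1 := slopes_angle K1 t1; have a2 := slopes_angle K2 t2.
have am := slopes_angle (slopes_midpoint K1 K2) tm.
have [h1 e1] := cos_tangent am a1; have [h2 e2] := cos_tangent am a2.
rewrite /amp.
set m := angle (midpoint z1 z2) in am h1 h2 e1 e2 *.
have r1 : 0 < (1 - z1.2) / 2 by lra.
have r2 : 0 < (1 - z2.2) / 2 by lra.
have lt : (1 - z1.2) / 2 * cos (angle z1) + (1 - z2.2) / 2 * cos (angle z2) <
  (1 - z1.2) / 2 * (cos m - sin m * (angle z1 - m)) + (1 - z2.2) / 2 * (cos m - sin m * (angle z2 - m)).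
  have [e1'|n1] := eqVneq (angle z1) m.
    apply: ler_ltD; rewrite ?ler_pM2l// ltr_pM2l// lt_neqAle h2 andbT e2.
    by rewrite -e1' eq_sym.
  by apply: ltr_leD; rewrite ?ler_pM2l// ltr_pM2l// lt_neqAle h1 andbT e1.
apply: (lt_le_trans lt).
rewrite le_eqVlt; apply/orP; left; apply/eqP.
have e : (1 - z1.2) / 2 * angle z1 + (1 - z2.2) / 2 * angle z2 =
    2 * ((1 - (midpoint z1 z2).2) / 2) * m.
  rewrite /m /midpoint/=; field.
  by apply/and3P; split; apply/eqP => h; lra.
rewrite /midpoint/= in e *.
transitivity ((1 - z1.2 + (1 - z2.2)) / 2 * cos m - sin m *
  ((1 - z1.2) / 2 * angle z1 + (1 - z2.2) / 2 * angle z2 - (1 - z1.2 + (1 - z2.2)) / 2 * m)).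
  by ring.
by rewrite e; field.
Qed.

(** The three regimes of the entropy on [slopes].  The value -oo occurs on
    the two sides of the triangle that meet at (0, 1), except at their other ends:
    there amp vanishes and z.2 > -1. *)
Variant ent_tilde_spec z : \bar R -> Type :=
  | EntFlat of z.2 = -1 : ent_tilde_spec z 0%E
  | EntNy of -1 < z.2 & amp z = 0 : ent_tilde_spec z -oo%E
  | EntFin of -1 < z.2 & z.2 < 1 & 0 < amp z :
     ent_tilde_spec z (Num.sqrt 2 * ((1 + z.2) / 2 * (1 + ln (amp z / (pi * ((1 + z.2) / 2))))))%:E.

Lemma ent_tildeP z : slopes z -> ent_tilde_spec z (ent_tilde z).
Proof.
case: z => s t Kz; have [/= /andP[tm1 tp1] sK] := Kz.
have p0 := pi_gt0 R; have s20 := sqrt2_gt0.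
rewrite /ent_tilde; case: ltP => t1; last first.
  have [e1 e2] := slopes_t1 Kz t1; apply: EntNy; rewrite /= ?e1//=; first by rewrite [t]e1; lra.
  by rewrite /amp /= [t]e1 subrr !mul0r.
have r0 : 0 < 1 - t by lra.
have := slopes_angle Kz t1; rewrite /= => /andP[ang1 ang2].
rewrite /ent eqe; case: eqP => [/eqP|tau0].
  rewrite mulf_eq0 invr_eq0 (gt_eqF r0) orbF addrC addr_eq0 => /eqP ->.
  by rewrite mule0; exact: EntFlat.
have tgt : -1 < t.
  rewrite lt_neqAle tm1 andbT eq_sym; apply/eqP => tE; apply: tau0.
  by rewrite tE addrN mul0r.
case: ifPn => [sig|].
  rewrite mulrNy gtr0_sg; last by rewrite mulr_gt0// divr_gt0.
  rewrite mul1e; apply: EntNy => //=; rewrite /amp/=.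
  suff -> : cos (pi * (Num.sqrt 2 * s / (1 - t))) = 0 by rewrite mulr0.
  by case/orP : sig => /eqP ->; rewrite ?mulrN ?cosN; exact: cos_pihalf.
rewrite negb_or => /andP[sig1 sig2].
have amp0 : 0 < amp (s, t).
  rewrite /amp/= mulr_gt0 ?divr_gt0//; apply: cos_gt0_pihalf.
  rewrite !lt_neqAle ang1 ang2 !andbT; apply/andP; split.
    apply/eqP => h; move/eqP : sig2; apply.
    apply: (mulfI (lt0r_neq0 p0)); rewrite -h; lra.
  apply/eqP => h; move/eqP : sig1; apply.
  by apply: (mulfI (lt0r_neq0 p0)); rewrite h.
rewrite -EFinM.
have -> : (Num.sqrt 2 / 2 * (1 - t) *
    ((1 + ln (cos (pi * (Num.sqrt 2 * s / (1 - t))) / (pi * ((1 + t) / (1 - t))))) * ((1 + t) / (1 - t)))) =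
   (Num.sqrt 2 * ((1 + t) / 2 * (1 + ln (amp (s, t) / (pi * ((1 + t) / 2)))))).
  have -> : amp (s, t) / (pi * ((1 + t) / 2)) =
    cos (pi * (Num.sqrt 2 * s / (1 - t))) / (pi * ((1 + t) / (1 - t))).
    rewrite /amp/=; set C := cos _; field.
    by apply/and3P; split; apply/eqP => h; lra.
  by set L := ln _; field; apply/eqP => h; lra.
exact: EntFin.
Qed.

(** ln x <= x - 1 at x = amp z / (l * q). *)
Lemma ent_tilde_le z l : slopes z -> 0 < l -> (ent_tilde z <= (ent_upper l z)%:E)%E.
Proof.
move=> Kz l0; have a0 := amp_ge0 Kz; have p0 := pi_gt0 R; have s20 := sqrt2_gt0.
case: ent_tildeP => //.
- move=> tE; rewrite lee_fin /ent_upper tE addrN mul0r mul0r add0r.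
  by apply: mulr_ge0; [exact: ltW|apply: divr_ge0 => //; exact: ltW].
- by move=> _ _; rewrite leNye.
move=> t1 t2 ap; rewrite lee_fin /ent_upper ler_pM2l//.
have q0 : 0 < (1 + z.2) / 2 by lra.
set q := (1 + z.2) / 2 in q0 *; set a := amp z in a0 ap *.
have e : ln (a / (pi * q)) = ln (l / pi) + ln (a / (l * q)).
  have lp0 : 0 < l / pi by rewrite divr_gt0.
  have alq0 : 0 < a / (l * q) by rewrite divr_gt0// mulr_gt0.
  rewrite -lnM ?posrE//; congr ln; field.
  by do ?[apply/andP; split]; apply/eqP => h; lra.
have h := @ln_le_sub1 (a / (l * q)) (divr_gt0 ap (mulr_gt0 l0 q0)).
rewrite e mulrDr mulr1.
have := ler_wpM2l (ltW q0) h.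
have -> : q * (a / (l * q) - 1) = a / l - q.
  by field; apply/andP; split; apply/eqP => h'; lra.
lra.
Qed.

(** The converse half of the statement that the entropy is the infimum of the
    bounds [ent_upper l].  When amp z = 0 the infimum is approached as l tends to 0,
    when z.2 = -1 as l tends to +oo, and otherwise it is attained at
    l = amp z / q. *)
Lemma ent_upper_lt z (y : R) : slopes z -> (ent_tilde z < y%:E)%E ->
  exists2 l, 0 < l & ent_upper l z < y.
Proof.
move=> Kz; have a0 := amp_ge0 Kz; have p0 := pi_gt0 R; have s20 := sqrt2_gt0.
case: ent_tildeP => //.
- move=> tE; rewrite lte_fin => y0; exists ((Num.sqrt 2 * amp z + 1) / y).
    by rewrite divr_gt0// ltr_pwDr// mulr_ge0// ltW.
  have h : 0 < Num.sqrt 2 * amp z + 1 by rewrite ltr_pwDr// mulr_ge0// ltW.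
  rewrite /ent_upper tE addrN mul0r mul0r add0r.
  have -> : Num.sqrt 2 * (amp z / ((Num.sqrt 2 * amp z + 1) / y)) =
      Num.sqrt 2 * amp z * y / (Num.sqrt 2 * amp z + 1).
    by field; do ?[apply/andP; split]; apply/eqP => h'; lra.
  by rewrite ltr_pdivrMr//; nra.
- move=> t1 aE _; have q0 : 0 < (1 + z.2) / 2 by lra.
  exists (pi * expR ((y - 1) / (Num.sqrt 2 * ((1 + z.2) / 2)))).
    by rewrite mulr_gt0// expR_gt0.
  rewrite /ent_upper aE mul0r addr0 (mulrC pi) mulfK ?gt_eqF// expRK.
  set q := (1 + z.2) / 2 in q0 *.
  have -> : Num.sqrt 2 * (q * ((y - 1) / (Num.sqrt 2 * q))) = y - 1.
    by field; apply/andP; split; apply/eqP => h'; lra.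
  lra.
move=> t1 t2 ap; rewrite lte_fin => yP.
have q0 : 0 < (1 + z.2) / 2 by lra.
exists (amp z / ((1 + z.2) / 2)); first by rewrite divr_gt0.
apply: le_lt_trans yP; rewrite /ent_upper.
set q := (1 + z.2) / 2 in q0 *; set a := amp z in ap *.
have -> : a / (a / q) = q by field; apply/andP; split; apply/eqP => h'; lra.
have -> : a / q / pi = a / (pi * q) by field; apply/andP; split; apply/eqP => h'; lra.
by rewrite le_eqVlt; apply/orP; left; apply/eqP; ring.
Qed.

Lemma ent_tilde_lt z l : slopes z -> 0 < l -> amp z != l * ((1 + z.2) / 2) ->
  (ent_tilde z < (ent_upper l z)%:E)%E.
Proof.
move=> Kz l0; have a0 := amp_ge0 Kz; have p0 := pi_gt0 R; have s20 := sqrt2_gt0.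
case: ent_tildeP => //.
- move=> tE; rewrite tE addrN mul0r mulr0 => ane0.
  rewrite lte_fin /ent_upper tE addrN mul0r mul0r add0r.
  by rewrite mulr_gt0// divr_gt0// lt_neqAle a0 eq_sym ane0.
- by move=> _ _ _; rewrite ltNyr.
move=> t1 t2 ap ne; rewrite lte_fin /ent_upper ltr_pM2l//.
have q0 : 0 < (1 + z.2) / 2 by lra.
set q := (1 + z.2) / 2 in q0 ne *; set a := amp z in a0 ap ne *.
have e : ln (a / (pi * q)) = ln (l / pi) + ln (a / (l * q)).
  have lp0 : 0 < l / pi by rewrite divr_gt0.
  have alq0 : 0 < a / (l * q) by rewrite divr_gt0// mulr_gt0.
  rewrite -lnM ?posrE//; congr ln; field.
  by do ?[apply/andP; split]; apply/eqP => h; lra.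
have ne1 : a / (l * q) != 1.
  apply/eqP => h; move/eqP : ne; apply.
  by rewrite -[RHS]mul1r -h divfK// gt_eqF// mulr_gt0.
have h := @ln_lt_sub1 (a / (l * q)) (divr_gt0 ap (mulr_gt0 l0 q0)) ne1.
have {}h : q * ln (a / (l * q)) < q * (a / (l * q) - 1) by rewrite ltr_pM2l.
rewrite e mulrDr mulr1.
have h2 : q * (a / (l * q) - 1) = a / l - q.
  by field; apply/andP; split; apply/eqP => h'; lra.
rewrite h2 in h; lra.
Qed.

Lemma ent_upper_midpoint l z1 z2 : slopes z1 -> slopes z2 -> 0 < l ->
  ent_upper l z1 + ent_upper l z2 <= 2 * ent_upper l (midpoint z1 z2).
Proof.
move=> K1 K2 l0; rewrite /ent_upper -mulrDr mulrCA ler_pM2l ?sqrt2_gt0//.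
have h := amp_midpoint K1 K2.
have : amp z1 / l + amp z2 / l <= 2 * (amp (midpoint z1 z2) / l).
  by rewrite -mulrDl mulrA ler_pM2r// invr_gt0.
by rewrite /midpoint/=; lra.
Qed.

(** The bound [ent_upper l] at l = pi is sqrt 2 / pi * amp z, and amp is at most
    1. *)
Lemma ent_tilde_le1 z : slopes z -> (ent_tilde z <= 1%:E)%E.
Proof.
move=> Kz; apply: le_trans (ent_tilde_le Kz (pi_gt0 R)) _.
rewrite lee_fin /ent_upper divff ?gt_eqF ?pi_gt0// ln1 mulr0 add0r.
have p2 := pi_ge2 R; have a0 := amp_ge0 Kz.
have s2 : Num.sqrt 2 <= 2 :> R.
  by have := sqrt2_sqr; have := sqrt2_gt0; nra.
have a1 : amp z <= 1.
  rewrite /amp; have := cos_le1 (angle z); case: Kz => /andP[h1 h2] _ h3; nra.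
have : Num.sqrt 2 * amp z <= 2 by have := sqrt2_gt0; nra.
by move=> h; rewrite mulrA ler_pdivrMr ?pi_gt0// mul1r (le_trans h).
Qed.

Definition cost z : \bar R := (1%:E - ent_tilde z)%E.

Variant cost_spec z : \bar R -> \bar R -> Type :=
  | CostPinfty of ent_tilde z = -oo%E : cost_spec z -oo%E +oo%E
  | CostFin e of e <= 1 & ent_tilde z = e%:E : cost_spec z e%:E (1 - e)%:E.

Lemma costP z : slopes z -> cost_spec z (ent_tilde z) (cost z).
Proof.
move=> /ent_tilde_le1; rewrite /cost; case E : (ent_tilde z) => [e||] // e1.
- exact: CostFin.
- exact: CostPinfty.
Qed.

Lemma cost_ge0 z : slopes z -> (0 <= cost z)%E.
Proof. by move=> /costP[//|e e1 _]; rewrite lee_fin subr_ge0. Qed.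

Lemma cost_midpoint z1 z2 : slopes z1 -> slopes z2 ->
  (cost (midpoint z1 z2) + cost (midpoint z1 z2) <= cost z1 + cost z2)%E.
Proof.
move=> K1 K2; have Km := slopes_midpoint K1 K2.
have cm := cost_ge0 Km.
case: (costP K1) => [_|e1 _ E1].
  by rewrite addye ?leey// gt_eqF// (lt_le_trans _ (cost_ge0 K2))// ltNyr.
case: (costP K2) => [_|e2 _ E2]; first by rewrite addey ?leey.
have h : (((e1 + e2) / 2)%:E <= ent_tilde (midpoint z1 z2))%E.
  rewrite leNgt; apply/negP => /(ent_upper_lt Km)[l l0 lm].
  have := ent_upper_midpoint K1 K2 l0.
  have := ent_tilde_le K1 l0; have := ent_tilde_le K2 l0; rewrite E1 E2 !lee_fin; lra.
move: h; case: (costP Km) => // e _ _; rewrite lee_fin => h.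
by rewrite -!EFinD lee_fin; lra.
Qed.

(** Choose l optimal at the midpoint.  Equality would force the two angles to be
    equal, by strict concavity of the cosine, and both points to be in the
    contact set amp z = l * q; the slopes with a given angle form a ray, which
    meets this set in one point. *)
Lemma cost_midpoint_lt z1 z2 : slopes z1 -> slopes z2 ->
  (cost z1 < +oo)%E -> (cost z2 < +oo)%E -> z1.2 != z2.2 ->
  (cost (midpoint z1 z2) + cost (midpoint z1 z2) < cost z1 + cost z2)%E.
Proof.
move=> K1 K2 f1 f2 tne; have Km := slopes_midpoint K1 K2.
have a1 := amp_ge0 K1; have a2 := amp_ge0 K2; have p0 := pi_gt0 R; have s20 := sqrt2_gt0.
have Ny z : slopes z -> (cost z < +oo)%E -> z.2 < 1 /\ (-1 < z.2 -> 0 < amp z).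
  move=> Kz; rewrite /cost; case: (ent_tildeP Kz) => //.
  by move=> -> _; split; lra.
have [t1 p1] := Ny _ K1 f1; have [t2 p2] := Ny _ K2 f2.
have [/andP[tm1 _] _] := K1; have [/andP[tm2 _] _] := K2.
case: (costP K1) f1 => [//|e1 _ E1] _; case: (costP K2) f2 => [//|e2 _ E2] _.
have tmE : (midpoint z1 z2).2 = (z1.2 + z2.2) / 2 by [].
have am := amp_midpoint K1 K2.
rewrite /cost; case: (ent_tildeP Km).
- by rewrite tmE => h; exfalso; move/eqP : tne; apply; lra.
- rewrite tmE => h1 h2; exfalso; rewrite h2 mulr0 in am.
  have /orP[] : (-1 < z1.2) || (-1 < z2.2) by rewrite -implyNb -leNgt; apply/implyP; lra.
    by move=> /p1; lra.
  by move=> /p2; lra.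
move=> tm tm' ap.
set q := (1 + (midpoint z1 z2).2) / 2.
have q0 : 0 < q by rewrite /q; lra.
pose l := amp (midpoint z1 z2) / q.
have l0 : 0 < l by rewrite divr_gt0.
have -> : Num.sqrt 2 * (q * (1 + ln (amp (midpoint z1 z2) / (pi * q)))) =
   ent_upper l (midpoint z1 z2).
  rewrite /ent_upper -/q /l.
  set a := amp (midpoint z1 z2) in ap *.
  have -> : a / (a / q) = q by field; apply/andP; split; apply/eqP => h'; lra.
  have -> : a / q / pi = a / (pi * q) by field; apply/andP; split; apply/eqP => h'; lra.
  by ring.
have h1 := ent_tilde_le K1 l0; have h2 := ent_tilde_le K2 l0.
rewrite E1 E2 !lee_fin in h1 h2.
have hm := ent_upper_midpoint K1 K2 l0.
rewrite -!EFinB -!EFinD lte_fin.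
suff : e1 + e2 < 2 * ent_upper l (midpoint z1 z2) by lra.
have [ang|ang] := eqVneq (angle z1) (angle z2); last first.
  have h := amp_midpoint_lt K1 K2 t1 t2 ang.
  suff : ent_upper l z1 + ent_upper l z2 < 2 * ent_upper l (midpoint z1 z2) by lra.
  rewrite /ent_upper -mulrDr mulrCA ltr_pM2l ?sqrt2_gt0//.
  have : amp z1 / l + amp z2 / l < 2 * (amp (midpoint z1 z2) / l).
    by rewrite -mulrDl mulrA ltr_pM2r// invr_gt0.
  by rewrite /midpoint/=; lra.
have [d1|d1] := eqVneq (amp z1) (l * ((1 + z1.2) / 2)); last first.
  by have := ent_tilde_lt K1 l0 d1; rewrite E1 lte_fin; lra.
have [d2|d2] := eqVneq (amp z2) (l * ((1 + z2.2) / 2)); last first.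
  by have := ent_tilde_lt K2 l0 d2; rewrite E2 lte_fin; lra.
exfalso; move/eqP : tne; apply.
have c0 : 0 <= cos (angle z1) by apply: cos_ge0_pihalf; exact: slopes_angle.
move: d1 d2; rewrite /amp -ang; set C := cos _ in c0 *; move=> d1 d2.
have : (C + l) * (z1.2 - z2.2) = 0 by lra.
move/eqP; rewrite mulf_eq0 => /orP[/eqP|/eqP]; lra.
Qed.

(** Continuity at the vertex z.2 = 1, where the angle has no limit, holds because
    the factor (1 - z.2) / 2 tends to 0. *)
Lemma cvg_amp (z_ : nat -> R * R) z : (forall n, slopes (z_ n)) -> slopes z ->
  (z_ n).1 @[n --> \oo] --> z.1 -> (z_ n).2 @[n --> \oo] --> z.2 ->
  amp (z_ n) @[n --> \oo] --> amp z.
Proof.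
move=> K_ Kz z1 z2; have [t1|t1] := eqVneq z.2 1.
  have -> : amp z = 0 by rewrite /amp t1 subrr !mul0r.
  have h : (1 - (z_ n).2) / 2 @[n --> \oo] --> (0 : R).
    have -> : 0 = (1 - z.2) / 2 :> R by rewrite t1 subrr mul0r.
    by apply: cvgMl; apply: cvgB => //; exact: cvg_cst.
  have hn : \forall n \near \oo, (cst 0 : nat -> R) n <= amp (z_ n) <= (1 - (z_ n).2) / 2.
    near=> n; rewrite amp_ge0//= /amp.
    have [/andP[_ h1] _] := K_ n.
    by rewrite ler_piMr// ?cos_le1// divr_ge0// subr_ge0.
  by apply: (squeeze_cvgr hn _ h); exact: cvg_cst.
have t0 : 1 - z.2 != 0 by rewrite subr_eq0 eq_sym.
rewrite /amp; apply: cvgM.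
  by apply: cvgMl; apply: cvgB => //; exact: cvg_cst.
apply: continuous_cvg; first exact: continuous_cos.
apply: cvgMr; apply: cvgM; first by exact: cvgMr.
by apply: cvgV => //; apply: cvgB => //; exact: cvg_cst.
Unshelve. all: by end_near. Qed.

Lemma measurable_inv : measurable_fun setT (fun x : R => x^-1).
Proof.
rewrite (_ : (fun x : R => x^-1) = (fun x => if x == 0 then 0 else x^-1)); last first.
  by apply/funext => x; case: eqVneq => // ->; rewrite invr0.
apply: measurable_fun_if => //.
  by apply: measurable_fun_eqr.
have -> : [set: R] `&` (fun x : R => x == 0) @^-1` [set false] = [set x | x != 0].
  by apply/seteqP; split => [x [_ /= ->]|x /= /negbTE ->].
apply: open_continuous_measurable_fun; first exact: open_neq.
by move=> x; rewrite inE/= => x0; exact: inv_continuous.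
Qed.

Lemma measurable_ent_tilde : measurable_fun setT
  (@ent_tilde R : (measurableTypeR R * measurableTypeR R)%type -> \bar R).
Proof.
have m1 : measurable_fun setT (fun z : plane => z.1) by exact: measurable_fst.
have m2 : measurable_fun setT (fun z : plane => z.2) by exact: measurable_snd.
have mr : measurable_fun setT (fun z : plane => 1 - z.2 : R).
  exact: measurable_funB.
have mi : measurable_fun setT (fun z : plane => (1 - z.2)^-1 : R).
  exact: (measurableT_comp measurable_inv mr).
pose sg (z : plane) : R := Num.sqrt 2 * z.1 / (1 - z.2).
pose tau (z : plane) : R := (1 + z.2) / (1 - z.2).
have msg : measurable_fun setT sg.
  by apply: measurable_funM => //; exact: measurable_funM.
have mtau : measurable_fun setT tau.
  by apply: measurable_funM => //; exact: measurable_funD.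
rewrite (_ : @ent_tilde R = fun z : plane => if (z.2 < 1)%R then
   ((Num.sqrt 2 / 2 * (1 - z.2))%:E * (if (tau z == 0)%R then 0 else if
     ((sg z == 2^-1) || (sg z == - 2^-1))%R then -oo else
     ((1 + ln (cos (pi * sg z) / (pi * tau z))) * tau z)%R%:E))%E else -oo%E); last first.
  by apply/funext => -[s t]; rewrite /ent_tilde /ent eqe.
apply: measurable_fun_ifT => //; first exact: measurable_fun_ltr.
apply: emeasurable_funM; first by apply/measurable_EFinP; exact: measurable_funM.
apply: measurable_fun_ifT => //; first exact: measurable_fun_eqr.
apply: measurable_fun_ifT => //.
  by apply: measurable_or; exact: measurable_fun_eqr.
apply/measurable_EFinP; apply: measurable_funM => //; apply: measurable_funD => //.
apply: (measurableT_comp (@measurable_ln R)); apply: measurable_funM.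
  apply: (measurableT_comp (continuous_measurable_fun (@continuous_cos R))).
  exact: measurable_funM.
apply: (measurableT_comp measurable_inv); exact: measurable_funM.
Qed.

Lemma limn_einf_ge (u : nat -> \bar R) (b : \bar R) :
  (\forall n \near \oo, (b <= u n)%E) -> (b <= limn_einf u)%E.
Proof.
move=> [N _ NP]; rewrite limn_einf_lim; apply: lime_ge; first exact: is_cvg_einfs.
exists N => // n /= Nn; apply: le_ereal_inf_tmp => _ [m /= nm <-].
by apply: NP => /=; exact: leq_trans nm.
Qed.

(** The cost is a supremum of the continuous functions 1 - ent_upper l. *)
Lemma cost_lsc (z_ : nat -> R * R) z : (forall n, slopes (z_ n)) -> slopes z ->
  (z_ n).1 @[n --> \oo] --> z.1 -> (z_ n).2 @[n --> \oo] --> z.2 ->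
  (cost z <= limn_einf (fun n => cost (z_ n)))%E.
Proof.
move=> K_ Kz z1 z2; have ac := cvg_amp K_ Kz z1 z2.
have main (y : R) : (ent_tilde z < y%:E)%E ->
    ((1 - y)%:E <= limn_einf (fun n => cost (z_ n)))%E.
  move=> /(ent_upper_lt Kz)[l l0 ly]; apply: limn_einf_ge.
  have uc : ent_upper l (z_ n) @[n --> \oo] --> ent_upper l z.
    apply: cvgMr; apply: cvgD; last by apply: cvgMl.
    by apply: cvgMl; apply: cvgMl; apply: cvgD => //; exact: cvg_cst.
  have : \forall n \near \oo, ent_upper l (z_ n) < y by exact: cvgr_lt uc y ly.
  apply: filterS => n ny; have := ent_tilde_le (K_ n) l0.
  case: (costP (K_ n)) => [_ _|e _ _]; first by rewrite leey.
  by rewrite !lee_fin; lra.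
move: main; case: (costP Kz) => [_ main|e _ _ main].
  rewrite (_ : limn_einf _ = +oo%E)//; apply: eq_infty => t.
  by have := main (1 - t); rewrite subKr; apply; rewrite ltNyr.
apply/lee_subgt0Pr => d d0; rewrite -EFinB.
have := main (e + d); rewrite lte_fin ltrDl d0 => /(_ isT).
by rewrite opprD addrA.
Qed.

End Entropy.

(** * Functions tilted like a rotated height function *)
Section Tilted.
Variable R : realType.
Notation mu := (@lebesgue_measure R).
Notation mu2 := (@lebesgue_measure R \x @lebesgue_measure R)%E.
Notation plane := (measurableTypeR R * measurableTypeR R)%type.
Implicit Types f g : R -> R -> R.

(** Slopes between -1 and 1 in v are the rotations of the slopes between 0 and +oo
    in y; the second condition is the rotated 1/2-Lipschitz bound in x. *)
Definition tilted f :=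
  (forall x v w, v <= w -> `|f x v - f x w| <= w - v) /\
  (forall x x' v, f x' (v + Num.sqrt 2 / 4 * `|x' - x|) <=
     f x v + Num.sqrt 2 / 4 * `|x' - x|).

Lemma tilted_v f x v w : tilted f -> `|f x v - f x w| <= `|v - w|.
Proof.
move=> [f1 _]; have [vw|wv] := leP v w.
  by rewrite (distrC v w) (ger0_norm (_ : 0 <= w - v)) ?subr_ge0//; exact: f1.
rewrite (distrC (f x v)) (ger0_norm (_ : 0 <= v - w)) ?subr_ge0; last exact: ltW.
by apply: f1; exact: ltW.
Qed.

Lemma tilted_lipschitz2 f : tilted f -> lipschitz2 f.
Proof.
move=> tf; have [_ f2] := tf.
have key x x' v : f x' v - f x v <= `|x - x'|.
  have := f2 x x' v; have := tilted_v x' v (v + Num.sqrt 2 / 4 * `|x' - x|) tf.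
  rewrite opprD addrA subrr add0r normrN.
  have s2 := sqrt2_gt0 R; have s22 := sqrt2_sqr R.
  have cx0 : 0 <= Num.sqrt 2 / 4 * `|x' - x|.
    by apply: mulr_ge0 => //; apply: divr_ge0 => //; exact: ltW.
  rewrite (ger0_norm cx0).
  move=> /ler_normlP[h1 h2]; have n0 := normr_ge0 (x' - x); rewrite (distrC x x').
  have : Num.sqrt 2 / 2 * `|x' - x| <= `|x' - x| by nra.
  lra.
move=> x v x' v'; have h1 := key x x' v; have h2 := key x' x v.
have /ler_normlP[h3 h4] := tilted_v x' v v' tf.
rewrite (distrC x' x) in h2.
by apply/ler_normlP; split; lra.
Qed.

(** The two inequalities of [tilted], divided by the increments, pass to the
    partial derivatives: applied from (x, v - c * h) to (x + h, v), the cone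
    inequality compares two points that differ from (x, v) in one coordinate
    each, so the two partial derivatives suffice. *)
Lemma has_grad_slopes f p z : tilted f -> has_grad f p z -> slopes z.
Proof.
case: p z => x v [s t] tf [/= /is_derive_epsP ds /is_derive_epsP dt].
have [_ f2] := tf; have c0 : 0 < Num.sqrt 2 / 4 :> R.
  by rewrite divr_gt0// sqrt2_gt0.
set c := Num.sqrt 2 / 4 in f2 c0 *.
have key (e : R) : 0 < e ->
   [/\ `|t| <= 1 + e, s <= c * (1 - t) + e * (1 + c) & - s <= c * (1 - t) + e * (1 + c)].
  move=> e0; have [r1 r10 P1] := ds e e0; have [r2 r20 P2] := dt e e0.
  pose h := Num.min r1 (Num.min r2 (r2 / c)) / 2.
  have m0 : 0 < Num.min r1 (Num.min r2 (r2 / c)).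
    by rewrite !lt_min r10 r20 divr_gt0.
  have h0 : 0 < h by rewrite divr_gt0.
  have hm : h < Num.min r1 (Num.min r2 (r2 / c)) by rewrite /h; lra.
  move: hm; rewrite !lt_min => /and3P[hr1 hr2 hr3].
  rewrite ltr_pdivlMr// mulrC in hr3.
  have nh : `|h| = h by rewrite gtr0_norm.
  have ch0 : 0 < c * h by rewrite mulr_gt0.
  have A1 := P1 h; rewrite nh in A1; have {A1} /ler_normlP[A1 A1'] := A1 hr1.
  have A2 := P1 (- h); rewrite normrN nh in A2; have {A2} /ler_normlP[A2 A2'] := A2 hr1.
  have A3 := P2 (- (c * h)); rewrite normrN (gtr0_norm ch0) in A3; have {A3} /ler_normlP[A3 A3'] := A3 hr3.
  have A4 := P2 h; rewrite nh in A4; have {A4} /ler_normlP[A4 A4'] := A4 hr2.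
  have /ler_normlP[B1 B2] := tilted_v x (v + h) v tf.
  have e1 : `|v + h - v| = h by rewrite (addrC v) addrK.
  rewrite e1 in B1 B2.
  have C1 := f2 x (x + h) (v - c * h).
  have e2 : `|x + h - x| = h by rewrite (addrC x) addrK.
  rewrite e2 subrK in C1.
  have C2 := f2 x (x - h) (v - c * h).
  have e3 : `|x - h - x| = h by rewrite addrAC subrr add0r normrN.
  rewrite e3 subrK in C2.
  split.
  - by apply/ler_normlP; split; rewrite -(ler_pM2r h0); lra.
  - by rewrite -(ler_pM2r h0); lra.
  - by rewrite -(ler_pM2r h0); lra.
have lim (a b d : R) : 0 < d -> (forall e, 0 < e -> a <= b + e * d) -> a <= b.
  move=> d0 H; apply/ler_addgt0Pr => e e0.
  by have := H (e / d) (divr_gt0 e0 d0); rewrite divfK ?gt_eqF.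
have t1 : `|t| <= 1.
  by apply: (lim _ _ 1) => // e /key[+ _ _]; rewrite mulr1.
have c10 : 0 < 1 + c by rewrite addr_gt0.
split; first by move: t1 => /ler_normlP[]; rewrite /=; lra.
apply/ler_normlP; split; first by apply: (lim _ _ (1 + c)) => // e /key[].
by apply: (lim _ _ (1 + c)) => // e /key[].
Qed.

(** A version of the gradient that is measurable and takes values in [slopes] at
    every point; (0, -1) is a slope of entropy 0. *)
Definition gradm f (p : plane) : R * R :=
  if p \in differentiable_set f then (slope1 f p, slope2 f p) else (0, -1).

Lemma has_gradm f : tilted f -> {ae mu2, forall p, has_grad f p (gradm f p)}.
Proof.
move=> /tilted_lipschitz2 fL; apply: ae_imp (ae_differentiable fL) => p pf.
by rewrite /gradm mem_set.
Qed.

Lemma gradmE f p z : has_grad f p z -> gradm f p = z.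
Proof.
move=> pz; rewrite /gradm mem_set ?(has_grad_slope pz)//.
by rewrite /differentiable_set/= (has_grad_slope pz).
Qed.

Lemma gradm_slopes f p : tilted f -> slopes (gradm f p).
Proof.
move=> tf; rewrite /gradm; case: ifPn => [|_]; first by rewrite inE; exact: has_grad_slopes.
split=> /=; first by lra.
rewrite normr0; apply: mulr_ge0; last by lra.
by apply: divr_ge0 => //; exact: ltW (sqrt2_gt0 R).
Qed.

Lemma measurable_gradm f : lipschitz2 f ->
  measurable_fun setT (fun p => (gradm f p).1) /\
  measurable_fun setT (fun p => (gradm f p).2).
Proof.
move=> fL; have mA := measurable_differentiable_set fL.
have mb : measurable_fun setT (fun p : plane => p \in differentiable_set f).
  rewrite (_ : (fun _ => _) = (fun p : plane => \1_(differentiable_set f) p == (1 : R))).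
    by apply: measurable_fun_eqr => //; exact: measurable_indic.
  by apply/funext => p; rewrite indicE; case: (_ \in _); rewrite ?eqxx// eq_sym oner_eq0.
split.
- rewrite (_ : (fun _ => _) = (fun p => if p \in differentiable_set f then slope1 f p else 0)).
    apply: measurable_fun_ifT => //.
    have := @measurable_swap _ _ (measurableTypeR R) (measurableTypeR R).
    exact: (measurableT_comp (measurable_slope2 (lipschitz2_flip fL))).
  by apply/funext => p; rewrite /gradm; case: ifP.
- rewrite (_ : (fun _ => _) = (fun p => if p \in differentiable_set f then slope2 f p else -1)).
    by apply: measurable_fun_ifT => //; exact: measurable_slope2.
  by apply/funext => p; rewrite /gradm; case: ifP.
Qed.

Lemma slopes_le1 (z : R * R) : slopes z -> `|z.1| <= 1 /\ `|z.2| <= 1.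
Proof.
move=> [/andP[h1 h2] h3]; split; last by apply/ler_normlP; split; lra.
apply: le_trans h3 _; have s2 := sqrt2_gt0 R; have s22 := sqrt2_sqr R; nra.
Qed.

Definition mid f g x v := (f x v + g x v) / 2.

Lemma tilted_mid f g : tilted f -> tilted g -> tilted (mid f g).
Proof.
move=> [f1 f2] [g1 g2]; split=> [x v w vw|x x' v]; rewrite /mid.
  have /ler_normlP[a1 a2] := f1 x v w vw; have /ler_normlP[b1 b2] := g1 x v w vw.
  by apply/ler_normlP; split; lra.
by have := f2 x x' v; have := g2 x x' v; lra.
Qed.

Lemma has_grad_mid f g p z1 z2 : has_grad f p z1 -> has_grad g p z2 ->
  has_grad (mid f g) p (midpoint z1 z2).
Proof.
move=> [a1 a2] [b1 b2]; split; rewrite /midpoint/=.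
  rewrite (_ : (mid f g)^~ p.2 = 2^-1 *: (f^~ p.2 + g^~ p.2)); last first.
    by apply/funext => x; rewrite /mid mulrC.
  by rewrite mulrC; apply: is_deriveZ; exact: is_deriveD.
rewrite (_ : (mid f g) p.1 = 2^-1 *: (f p.1 + g p.1)); last first.
  by apply/funext => x; rewrite /mid mulrC.
by rewrite mulrC; apply: is_deriveZ; exact: is_deriveD.
Qed.

Lemma ae_gradm_mid f g : tilted f -> tilted g ->
  {ae mu2, forall p, gradm (mid f g) p = midpoint (gradm f p) (gradm g p)}.
Proof.
move=> tf tg; apply: ae_imp2 (has_gradm tf) (has_gradm tg) => p pf pg.
exact/gradmE/has_grad_mid.
Qed.

End Tilted.

(** * Minimizing sequences with strongly converging gradients *)
Section FastCauchy.
Variable R : realType.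

Lemma limn_einf_le (u : nat -> \bar R) (b : \bar R) :
  (\forall n \near \oo, (u n <= b)%E) -> (limn_einf u <= b)%E.
Proof.
move=> [N _ NP]; rewrite limn_einf_lim; apply: lime_le; first exact: is_cvg_einfs.
exists N => // n /= Nn; apply: le_trans (NP n Nn).
by apply: ereal_inf_lbound; exists n => /=.
Qed.

Lemma cvg_geometric_increments (u : nat -> R) (S : R) : 0 <= S ->
  (forall n, `|u n - u n.+1| <= S * 2^-1 ^+ n) -> cvgn u.
Proof.
move=> S0 uS.
have -> : u = (fun n => u 0%N + series (telescope u) n).
  apply/funext => n; rewrite /series/= telescope_sumr//.
  by rewrite addrC subrK.
apply: is_cvgD; first exact: is_cvg_cst.
apply: normed_cvg.
apply: (@series_le_cvg _ _ (geometric S 2^-1)) => [n|n|n|].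
- by rewrite normr_ge0.
- by rewrite /geometric/= mulr_ge0// exprn_ge0.
- by rewrite /telescope/= distrC; exact: uS.
- by apply: is_cvg_geometric_series; rewrite ger0_norm// invf_lt1// ltr1n.
Qed.

(** The squared increments multiplied by 4 ^+ n still have a summable sequence of
    integrals, so their sum is finite almost everywhere, and the increments are
    there of order 2^-1 ^+ n. *)
Lemma ae_cvg_fast d (T : measurableType d) (m : {measure set T -> \bar R})
    (D : set T) (g_ : nat -> T -> R) (C : R) : measurable D ->
  (forall n, measurable_fun D (g_ n)) ->
  (forall n, (\int[m]_(x in D) ((g_ n x - g_ n.+1 x) ^+ 2)%:E <= (C * 8^-1 ^+ n)%:E)%E) ->
  {ae m, forall x, D x -> cvgn (g_ ^~ x)}.
Proof.
move=> mD mg gC.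
pose d_ n x := (4 ^+ n * (g_ n x - g_ n.+1 x) ^+ 2)%:E : \bar R.
have d0 n x : (0 <= d_ n x)%E.
  by rewrite lee_fin; apply: mulr_ge0; [exact: exprn_ge0|exact: sqr_ge0].
have md n : measurable_fun D (d_ n).
  apply/measurable_EFinP; apply: measurable_funM => //.
  by apply: measurable_funX; exact: measurable_funB.
have msq n : measurable_fun D (fun x => ((g_ n x - g_ n.+1 x) ^+ 2)%:E).
  by apply/measurable_EFinP; apply: measurable_funX; exact: measurable_funB.
have sq0 n x : D x -> (0 <= ((g_ n x - g_ n.+1 x) ^+ 2)%:E)%E.
  by move=> _; rewrite lee_fin sqr_ge0.
have C0 : 0 <= C.
  have := gC 0%N; rewrite expr0 mulr1 => /(le_trans _).
  by rewrite -lee_fin; apply; apply: integral_ge0 => x _; rewrite lee_fin sqr_ge0.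
have intd : (\int[m]_(x in D) (\sum_(n <oo) d_ n x) < +oo)%E.
  rewrite integral_nneseries//.
  apply: (@le_lt_trans _ _ (\sum_(n <oo) (C * 2^-1 ^+ n)%:E)%E).
    apply: lee_nneseries => [n _ _|n _]; first by apply: integral_ge0 => x _; exact: d0.
    rewrite /d_; under eq_integral do rewrite EFinM.
    rewrite ge0_integralZl//; last exact: sq0.
    apply: (@le_trans _ _ ((4 ^+ n)%:E * (C * 8^-1 ^+ n)%:E)%E).
      by apply: lee_pmul => //; rewrite ?lee_fin ?exprn_ge0//;
         apply: integral_ge0 => x _; rewrite lee_fin sqr_ge0.
    rewrite -EFinM lee_fin mulrCA -exprMn.
    by rewrite (_ : 4 * 8^-1 = 2^-1 :> R)//; lra.
  rewrite (_ : (fun n => _) = eseries (fun k => (2 * C / (2 ^ (k + 1))%:R)%:E)); last first.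
    apply/funext => n; rewrite /eseries/=; apply: eq_bigr => k _; congr EFin.
    by rewrite addn1 natrX exprS exprVn invfM; set X := (2 ^+ k)^-1; lra.
  by rewrite (cvg_lim _ (@cvg_geometric_eseries_half R (2 * C) 0))// ltry.
have msum : measurable_fun D (fun x => \sum_(n <oo) d_ n x)%E.
  by apply: ge0_emeasurable_sum.
have isum : m.-integrable D (fun x => \sum_(n <oo) d_ n x)%E.
  apply/integrableP; split => //.
  under eq_integral => x _ do rewrite gee0_abs ?nneseries_ge0//.
  exact: intd.
apply: ae_imp (integrable_ae mD isum) => x xfin Dx.
have := xfin Dx; set S := (\sum_(n <oo) d_ n x)%E => Sfin.
have S0 : (0 <= S)%E by apply: nneseries_ge0.
apply: (@cvg_geometric_increments _ (Num.sqrt (fine S))) => [|n].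
  exact: sqrtr_ge0.
have dS : (d_ n x <= S)%E.
  apply: le_trans (nneseries_lim_ge n.+1 _); last by [].
  by rewrite big_nat_recr//= leeDr// sume_ge0.
have dS' : 4 ^+ n * (g_ n x - g_ n.+1 x) ^+ 2 <= fine S by rewrite -lee_fin fineK.
have p2 : 0 < 2^-1 ^+ n :> R by rewrite exprn_gt0.
rewrite -(@ler_pXn2r _ 2)// ?nnegrE; last by rewrite mulr_ge0 ?sqrtr_ge0// (ltW p2).
rewrite real_normK ?num_real// exprMn sqr_sqrtr ?fine_ge0//.
rewrite exprAC (_ : 2^-1 ^+ 2 = 4^-1 :> R); last by lra.
by rewrite exprVn ler_pdivlMr ?exprn_gt0// mulrC.
Qed.

End FastCauchy.

(** Let i e be the infimum of I among the f with J f within e of the infimum.  It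
    increases to a finite S as e decreases to 0.  Choose u n within e_n of the
    infimum of J and with I (u n) within 8^-1 ^+ n of S: the midpoint of
    two consecutive terms is again a near-minimizer, so its I is not much below
    S, and the parallelogram inequality leaves a distance of order
    8^-1 ^+ n. *)
Lemma minimizing_sequence (R : realType) (T : Type) (P : T -> Prop)
    (mid : T -> T -> T) (J : T -> \bar R) (I : T -> R) (D : T -> T -> R) (C : R) :
  (forall f g, P f -> P g -> P (mid f g)) ->
  (forall f, P f -> (0 <= J f)%E) ->
  (forall f, P f -> 0 <= I f <= C) ->
  (forall f g, P f -> P g -> (J (mid f g) + J (mid f g) <= J f + J g)%E) ->
  (forall f g, P f -> P g -> D f g + 4 * I (mid f g) <= 2 * (I f + I g)) ->
  (exists2 f, P f & (J f < +oo)%E) ->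
  exists u : nat -> T,
  [/\ forall n, P (u n), forall n, D (u n) (u n.+1) <= 8 * 8^-1 ^+ n &
      forall g, P g -> (limn_einf (J \o u) <= J g)%E].
Proof.
have half (a b : R) : a + a <= b + b -> a <= b by lra.
have parallelogram_le (q q' S If Ig Im i d : R) : If <= S + q -> Ig <= S + q' ->
  q' <= q -> S - q <= i -> i <= Im -> d + 4 * Im <= 2 * (If + Ig) -> d <= 8 * q by lra.
move=> midP J0 IC Jmid Imid Jfin.
pose m := ereal_inf [set J f | f in P].
have m0 : (0 <= m)%E by apply: le_ereal_inf_tmp => _ [f Pf <-]; exact: J0.
have mle f : P f -> (m <= J f)%E by move=> Pf; apply: ereal_inf_lbound; exists f.
have mfin : m \is a fin_num.
  rewrite ge0_fin_numE//; have [f Pf fJ] := Jfin; exact: le_lt_trans (mle _ Pf) fJ.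
pose K (e : R) := [set f | P f /\ (J f <= m + e%:E)%E].
have K0 e : 0 < e -> K e !=set0.
  move=> e0; have [_ [f Pf <-] fe] := lb_ereal_inf_adherent e0 mfin.
  by exists f; split => //; exact: ltW.
have Ksub e e' : e <= e' -> K e `<=` K e'.
  by move=> ee f [Pf fe]; split => //; apply: le_trans fe _; rewrite leeD2l// lee_fin.
pose i e := inf [set I f | f in K e].
have Kinf e : 0 < e -> has_inf [set I f | f in K e].
  move=> /K0[f Kf]; split; first by exists (I f), f.
  by exists 0 => _ [g [Pg _] <-]; case/andP: (IC g Pg).
have ile e f : 0 < e -> K e f -> i e <= I f.
  by move=> e0 Kf; apply: ge_inf; [exact: (Kinf e e0).2|exists f].
have iC e : 0 < e -> i e <= C.
  move=> e0; have [f Kf] := K0 e e0; apply: le_trans (ile _ _ e0 Kf) _.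
  by case/andP: (IC f Kf.1).
pose S := sup [set i e | e in [set e | 0 < e]].
have hS : has_sup [set i e | e in [set e | 0 < e]].
  split; first by exists (i 1); exists 1 => //=; exact: ltr01.
  by exists C => _ [e e0 <-]; exact: iC.
have iS e : 0 < e -> i e <= S.
  by move=> e0; apply: ub_le_sup; [exact: hS.2|exists e].
have p8 n : 0 < 8^-1 ^+ n :> R by rewrite exprn_gt0.
have step n : exists fe : T * R, [/\ 0 < fe.2, fe.2 <= n.+1%:R^-1, K fe.2 fe.1,
    S - 8^-1 ^+ n <= i fe.2 & I fe.1 <= S + 8^-1 ^+ n].
  have [_ [e' e'0 <-] Se'] := sup_adherent (p8 n) hS.
  pose e := Num.min e' n.+1%:R^-1.
  have e0 : 0 < e by rewrite lt_min e'0 invr_gt0 ltr0n.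
  have [_ [f Kf <-] fi] := inf_adherent (p8 n) (Kinf e e0).
  exists (f, e); split => //=.
  - by rewrite ge_min lexx orbT.
  - apply: le_trans (ltW Se') _; apply: lb_le_inf.
      by have [g Kg] := K0 e e0; exists (I g), g.
    move=> _ [g Kg <-]; apply: ile => //; apply: Ksub Kg.
    by rewrite /e ge_min lexx.
  - by have := iS e e0; move: fi; rewrite -/(i e); lra.
have [u uP] := choice step.
exists (fst \o u); split => [n|n|g Pg].
- by have [_ _ []] := uP n.
- have [e0 _ K1 i1 I1] := uP n; have [e0' _ K2 i2 I2] := uP n.+1.
  set f := (u n).1 in K1 I1 *; set g := (u n.+1).1 in K2 I2 *.
  set e := (u n).2 in e0 K1 i1; set e' := (u n.+1).2 in e0' K2 i2.
  pose em := Num.max e e'.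
  have Km : K em (mid f g).
    have [Pf Jf] := K1; have [Pg Jg] := K2.
    split; first exact: midP.
    have := Jmid _ _ Pf Pg; have := J0 _ (midP _ _ Pf Pg).
    have h1 : (J f + J g <= (m + em%:E) + (m + em%:E))%E.
      apply: leeD; first by apply: le_trans Jf _; rewrite leeD2l// lee_fin le_max lexx.
      by apply: le_trans Jg _; rewrite leeD2l// lee_fin le_max lexx orbT.
    move=> _ /le_trans/(_ h1); rewrite -(fineK mfin) -!EFinD.
    case: (J (mid f g)) => [r||].
    - by rewrite -EFinD !lee_fin; exact: half.
    - by rewrite addye// leye_eq.
    - by move=> _; rewrite leNye.
  have iem : S - 8^-1 ^+ n <= i em.
    have h : 8^-1 ^+ n.+1 <= 8^-1 ^+ n :> R.
      by rewrite exprS ler_piMl// ?exprn_ge0// invf_le1// ler1n.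
    have i2' : S - 8^-1 ^+ n <= i e' by apply: le_trans i2; rewrite lerD2l lerN2.
    by rewrite /em maxEle; case: ifP.
  have em0 : 0 < em by rewrite lt_max e0.
  have h : 8^-1 ^+ n.+1 <= 8^-1 ^+ n :> R.
    by rewrite exprS ler_piMl// ?exprn_ge0// invf_le1// ler1n.
  exact: parallelogram_le I1 I2 h iem (ile _ _ em0 Km) (Imid _ _ K1.1 K2.1).
- apply/lee_addgt0Pr => e e0; apply: limn_einf_le.
  have [N Ne] := invS_lt e0.
  exists N => // n /= Nn; have [_ en [_ Kn] _ _] := uP n.
  apply: le_trans Kn _; apply: leeD; first exact: mle.
  rewrite lee_fin (le_trans en)// (le_trans _ (ltW Ne))//.
  by rewrite lef_pV2 ?posrE ?ltr0n// ler_nat ltnS.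
Qed.

(** * Existence and uniqueness of the minimizer of the cost *)
Section Minimizer.
Variable R : realType.
Notation mu := (@lebesgue_measure R).
Notation mu2 := (@lebesgue_measure R \x @lebesgue_measure R)%E.
Notation plane := (measurableTypeR R * measurableTypeR R)%type.
Implicit Types f g : R -> R -> R.

Lemma ae_dense (P : R -> Prop) (a b : R) : a < b -> {ae mu, forall x, P x} ->
  exists2 x, a < x < b & P x.
Proof.
move=> ab [N [mN N0 PN]]; apply: contrapT => nP.
have sub : `]a, b[%classic `<=` N.
  by move=> x /=; rewrite in_itv/= => axb; apply: PN => /= Px; apply: nP; exists x.
have : (mu `]a, b[%classic <= mu N)%E by apply: le_measure; rewrite ?inE//.
rewrite N0 lebesgue_measure_itv/= lte_fin ab -EFinD lee_fin; lra.
Qed.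

Lemma limn_sup_leD (u w : nat -> R) (c B : R) : (forall n, `|u n| <= B) ->
  (forall n, `|w n| <= B) -> (forall n, u n <= w n + c) ->
  limn_sup u <= limn_sup w + c.
Proof.
move=> uB wB uw.
have hu (v : nat -> R) : (forall n, `|v n| <= B) ->
    has_ubound (range v) /\ has_lbound (range v).
  move=> vB; split; [exists B|exists (- B)] => _ [n _ <-]; have /ler_normlP[] := vB n; lra.
have cv v : (forall n, `|v n| <= B) -> sups v n @[n --> \oo] --> limn_sup v.
  move=> /hu[h1 h2]; have c1 := cvg_sups_inf h1 h2.
  by rewrite /limn_sup (cvg_lim _ c1).
have cw : sups w n + c @[n --> \oo] --> limn_sup w + c.
  by apply: cvgD; [exact: cv|exact: cvg_cst].
apply: ler_cvg_to (cv _ uB) cw _; near=> n.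
apply: ge_sup; first by exists (u n); exists n => /=.
move=> _ [k /= nk <-]; apply: le_trans (uw k) _; rewrite lerD2r.
apply: ub_le_sup; last by exists k.
by exists B => _ [m _ <-]; have /ler_normlP[] := wB m.
Unshelve. all: by end_near. Qed.

Variables (lo hi : R -> R) (M : R).
Hypothesis M0 : 0 < M.
Hypothesis loM : forall x : R, 0 <= x <= 1 -> `|lo x| < M.
Hypothesis hiM : forall x : R, 0 <= x <= 1 -> `|hi x| < M.

(** Outside the rotated domain lo x <= v <= hi x the surface is continued by
    z constant in y, that is, with slope -1, which costs the constant 1.
    The cost can thus be integrated over a fixed rectangle. *)
Definition heights f := [/\ tilted f,
  forall x v : R, 0 <= x <= 1 -> v <= lo x -> f x v = 2 * lo x - v &
  forall x v : R, 0 <= x <= 1 -> hi x <= v -> f x v = 2 * hi x - Num.sqrt 2 - v].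

Lemma heights_mid f g : heights f -> heights g -> heights (mid f g).
Proof.
move=> [tf f1 f2] [tg g1 g2]; split; first exact: tilted_mid.
  by move=> x v x01 h; rewrite /mid f1// g1//; lra.
by move=> x v x01 h; rewrite /mid f2// g2//; lra.
Qed.

Lemma heights_bound f x v : heights f -> `|f x v| <= M + `|v| + M + `|x|.
Proof.
move=> [tf f1 _]; have fL := tilted_lipschitz2 tf.
have x0 : 0 <= (0 : R) <= 1 by lra.
have h1 := fL x v 0 (lo 0); rewrite subr0 (f1 0 (lo 0))// in h1.
have := loM x0 => h2.
have h3 := ler_normD v (- lo 0); rewrite normrN in h3.
have h4 : `|f x v| <= `|f x v - (2 * lo 0 - lo 0)| + `|2 * lo 0 - lo 0|.
  by rewrite -[X in `|X| <= _](subrK (2 * lo 0 - lo 0)) ler_normD.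
have e : 2 * lo 0 - lo 0 = lo 0 by lra.
rewrite e in h4 h1; lra.
Qed.

Definition Q : set plane := `]0, 1[%classic `*` `]-M, M[%classic.

Lemma measurable_Q : measurable Q.
Proof. exact: measurableX. Qed.

Lemma mu2_Q : mu2 Q = (2 * M)%:E.
Proof.
have m1 : mu `]0, 1[%classic = 1%:E.
  by rewrite lebesgue_measure_itv/= lte_fin ltr01 -EFinD subr0.
have m2 : mu `]-M, M[%classic = (2 * M)%:E.
  by rewrite lebesgue_measure_itv/= lte_fin gtrN// -EFinD; congr EFin; lra.
rewrite product_measure1E//.
by transitivity (1%:E * (2 * M)%:E)%E; [congr (_ * _)%E|rewrite mul1e].
Qed.

Lemma mu2_Q_lty : (mu2 Q < +oo)%E.
Proof. by rewrite mu2_Q ltry. Qed.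

(** Taking superior limits at every point keeps the inequalities of [tilted], so
    that convergence need not be known beforehand. *)
Lemma heights_limsup (u : nat -> R -> R -> R) : (forall n, heights (u n)) ->
  heights (fun x v => limn_sup (fun n => u n x v)).
Proof.
move=> hu; have ub x v n := heights_bound x v (hu n).
have key x v x' v' c : (forall n, u n x v <= u n x' v' + c) ->
    limn_sup (fun n => u n x v) <= limn_sup (fun n => u n x' v') + c.
  apply: (@limn_sup_leD _ _ _ (Num.max (M + `|v| + M + `|x|) (M + `|v'| + M + `|x'|))) => n.
    by rewrite (le_trans (ub _ _ _))// le_max lexx.
  by rewrite (le_trans (ub _ _ _))// le_max lexx orbT.
have cst_lim (w : nat -> R) c : (forall n, w n = c) -> limn_sup w = c.
  move=> wc; have -> : w = (fun=> c) by apply/funext.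
  by have [_ ->] := cvg_limn_inf_sup (cvg_cst c).
split; first split.
- move=> x v w vw; apply/ler_normlP; split.
    rewrite opprB lerBlDr addrC; apply: key => n.
    by have [[h _] _ _] := hu n; have /ler_normlP[] := h x v w vw; lra.
  rewrite lerBlDr addrC; apply: key => n.
  by have [[h _] _ _] := hu n; have /ler_normlP[] := h x v w vw; lra.
- by move=> x x' v; apply: key => n; have [[_ h] _ _] := hu n; exact: h.
- by move=> x v x01 vlo; apply: cst_lim => n; have [_ h _] := hu n; exact: h.
- by move=> x v x01 vhi; apply: cst_lim => n; have [_ _ h] := hu n; exact: h.
Qed.

Definition sqn (z : R * R) : R := z.1 ^+ 2 + z.2 ^+ 2.
Lemma sqn_midpoint z1 z2 :
  sqn (z1.1 - z2.1, z1.2 - z2.2) + 4 * sqn (midpoint z1 z2) = 2 * (sqn z1 + sqn z2).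
Proof. by rewrite /sqn /midpoint/=; field. Qed.

Definition energy f : R := \int[mu2]_(p in Q) sqn (gradm f p).
Definition distance f g : R :=
  \int[mu2]_(p in Q) sqn ((gradm f p).1 - (gradm g p).1, (gradm f p).2 - (gradm g p).2).
Definition total_cost f : \bar R := (\int[mu2]_(p in Q) cost (gradm f p))%E.

Lemma gradm_le1 f p : tilted f -> `|(gradm f p).1| <= 1 /\ `|(gradm f p).2| <= 1.
Proof. by move=> tf; apply: slopes_le1; exact: gradm_slopes. Qed.

Lemma measurable_gradm1 f : tilted f -> measurable_fun setT (fun p : plane => (gradm f p).1).
Proof. by move=> /tilted_lipschitz2/measurable_gradm[]. Qed.

Lemma measurable_gradm2 f : tilted f -> measurable_fun setT (fun p : plane => (gradm f p).2).
Proof. by move=> /tilted_lipschitz2/measurable_gradm[]. Qed.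

Lemma measurable_ent_tilde_gradm f : tilted f ->
  measurable_fun setT (fun p : plane => ent_tilde (gradm f p)).
Proof.
move=> tf; have mg : measurable_fun setT (gradm f : plane -> plane).
  apply/measurable_fun_pairP; split.
    exact: measurable_gradm1.
  exact: measurable_gradm2.
exact: (measurableT_comp (@measurable_ent_tilde R) mg).
Qed.

Lemma measurable_cost_gradm f : tilted f ->
  measurable_fun setT (fun p : plane => cost (gradm f p)).
Proof.
by move=> tf; apply: emeasurable_funB => //; exact: measurable_ent_tilde_gradm.
Qed.

Lemma integrable_sqn (z : plane -> R * R) : measurable_fun setT (fun p => (z p).1) ->
  measurable_fun setT (fun p => (z p).2) ->
  (forall p, `|(z p).1| <= 2 /\ `|(z p).2| <= 2) ->
  mu2.-integrable Q (EFin \o (fun p => sqn (z p))).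
Proof.
move=> m1 m2 zb; apply: (@integrable_bounded _ _ _ _ _ _ 8).
- exact: measurable_Q.
- exact: mu2_Q_lty.
- by apply: measurable_funTS; apply: measurable_funD; exact: measurable_funX.
move=> p _; have [z1 z2] := zb p; rewrite ger0_norm ?addr_ge0 ?sqr_ge0//.
have h (x : R) : `|x| <= 2 -> x ^+ 2 <= 4.
  by move=> /ler_normlP[? ?]; rewrite expr2; nra.
by have := h _ z1; have := h _ z2; rewrite /sqn; lra.
Qed.

Lemma integrable_energy f : tilted f ->
  mu2.-integrable Q (EFin \o (fun p => sqn (gradm f p))).
Proof.
move=> tf; apply: integrable_sqn; [exact: measurable_gradm1|exact: measurable_gradm2|].
by move=> p; have [h1 h2] := gradm_le1 p tf; split; lra.
Qed.

Lemma integrable_distance f g : tilted f -> tilted g ->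
  mu2.-integrable Q (EFin \o (fun p =>
    sqn ((gradm f p).1 - (gradm g p).1, (gradm f p).2 - (gradm g p).2))).
Proof.
move=> tf tg; apply: integrable_sqn => /=.
- by apply: measurable_funB; exact: measurable_gradm1.
- by apply: measurable_funB; exact: measurable_gradm2.
move=> p; have [h1 h2] := gradm_le1 p tf; have [h3 h4] := gradm_le1 p tg.
by split; apply: le_trans (ler_normB _ _) _; lra.
Qed.

(** The parallelogram identity, integrated. *)
Lemma energy_mid f g : tilted f -> tilted g ->
  distance f g + 4 * energy (mid f g) <= 2 * (energy f + energy g).
Proof.
move=> tf tg; have tm := tilted_mid tf tg.
have if_ := integrable_energy tf; have ig := integrable_energy tg.
have im := integrable_energy tm; have id := integrable_distance tf tg.
have mQ := measurable_Q.
have i4 : mu2.-integrable Q (EFin \o (fun p => 4 * sqn (gradm (mid f g) p))).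
  exact: (integrableZl mQ 4 im).
have ifg : mu2.-integrable Q (EFin \o (fun p => sqn (gradm f p) + sqn (gradm g p))).
  exact: (integrableD mQ if_ ig).
have e1 : 4 * energy (mid f g) = \int[mu2]_(p in Q) (4 * sqn (gradm (mid f g) p)).
  by rewrite (RintegralZl 4 mQ im).
have e2 : energy f + energy g = \int[mu2]_(p in Q) (sqn (gradm f p) + sqn (gradm g p)).
  by rewrite (RintegralD mQ if_ ig).
rewrite e1 e2 /distance -(RintegralD mQ id i4) -(RintegralZl 2 mQ ifg).
have mea (h : plane -> R) : mu2.-integrable Q (EFin \o h) -> measurable_fun Q (EFin \o h).
  by move=> /integrableP[].
have eqI : (\int[mu2]_(p in Q) (sqn ((gradm f p).1 - (gradm g p).1, (gradm f p).2 - (gradm g p).2)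
     + 4 * sqn (gradm (mid f g) p))%:E =
   \int[mu2]_(p in Q) (2 * (sqn (gradm f p) + sqn (gradm g p)))%:E)%E.
  apply: ae_eq_integral => //.
  - exact: mea (integrableD mQ id i4).
  - exact: mea (integrableZl mQ 2 ifg).
  by apply: ae_imp (ae_gradm_mid tf tg) => p -> _; rewrite sqn_midpoint.
by rewrite /Rintegral eqI.
Qed.

Lemma energy_bound f : tilted f -> 0 <= energy f <= 2 * (2 * M).
Proof.
move=> tf; apply/andP; split.
  by apply: Rintegral_ge0 => p _; rewrite addr_ge0 ?sqr_ge0.
have mQ := measurable_Q.
have -> : 2 * (2 * M) = \int[mu2]_(p in Q) 2.
  rewrite Rintegral_cst//; congr (_ * _).
  by transitivity (fine (2 * M)%:E) => //; congr fine; exact/esym/mu2_Q.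
apply: le_Rintegral => //; first exact: integrable_energy.
  apply: (@integrable_bounded _ _ _ _ _ (cst 2) 2) => //; first exact: mu2_Q_lty.
  by move=> p _; rewrite ger0_norm.
move=> p _; have [h1 h2] := gradm_le1 p tf.
have h (x : R) : `|x| <= 1 -> x ^+ 2 <= 1.
  by move=> /ler_normlP[? ?]; rewrite expr2; nra.
by have := h _ h1; have := h _ h2; rewrite /sqn; lra.
Qed.

Lemma total_cost_ge0 f : tilted f -> (0 <= total_cost f)%E.
Proof. by move=> tf; apply: integral_ge0 => p _; apply: cost_ge0; exact: gradm_slopes. Qed.

Lemma total_costD f g : tilted f -> tilted g ->
  (total_cost f + total_cost g =
   \int[mu2]_(p in Q) (cost (gradm f p) + cost (gradm g p)))%E.
Proof.
move=> tf tg; rewrite -ge0_integralD//; first exact: measurable_Q.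
- by move=> p _; apply: cost_ge0; exact: gradm_slopes.
- by apply: measurable_funTS; exact: measurable_cost_gradm.
- by move=> p _; apply: cost_ge0; exact: gradm_slopes.
- by apply: measurable_funTS; exact: measurable_cost_gradm.
Qed.

Lemma total_cost_mid f g : tilted f -> tilted g ->
  (total_cost (mid f g) + total_cost (mid f g) <= total_cost f + total_cost g)%E.
Proof.
move=> tf tg; have tm := tilted_mid tf tg; rewrite [leLHS](total_costD tm tm) [leRHS](total_costD tf tg).
have c0 f' p : tilted f' -> (0 <= cost (gradm f' p))%E.
  by move=> tf'; apply: cost_ge0; exact: gradm_slopes.
apply: ae_ge0_le_integral; first exact: measurable_Q.
- by move=> p _; rewrite adde_ge0 ?c0.
- by apply: measurable_funTS; apply: emeasurable_funD; exact: measurable_cost_gradm.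
- by move=> p _; rewrite adde_ge0 ?c0.
- by apply: measurable_funTS; apply: emeasurable_funD; exact: measurable_cost_gradm.
apply: ae_imp (ae_gradm_mid tf tg) => p -> _.
by apply: cost_midpoint; exact: gradm_slopes.
Qed.

Lemma measurable_section2 (k : plane -> R) (x : R) : measurable_fun setT k ->
  measurable_fun setT (fun v : R => k (x, v)).
Proof. by move=> mk; apply: (measurableT_comp mk); exact: pair1_measurable. Qed.

Lemma measurable_section1 (k : plane -> R) (v : R) : measurable_fun setT k ->
  measurable_fun setT (fun x : R => k (x, v)).
Proof. by move=> mk; apply: (measurableT_comp mk); exact: pair2_measurable. Qed.

Lemma sqn_ge z : 0 <= z.1 ^+ 2 <= sqn z /\ 0 <= z.2 ^+ 2 <= sqn z.
Proof. by rewrite /sqn !sqr_ge0 lerDl lerDr !sqr_ge0. Qed.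

Section Limit.
Variable u : nat -> R -> R -> R.
Hypothesis hu : forall n, heights (u n).
Hypothesis du : forall n, distance (u n) (u n.+1) <= 8 * 8^-1 ^+ n.

Let tu n : tilted (u n). Proof. by have [] := hu n. Qed.

Lemma ae_cvg_gradm : {ae mu2, forall p, Q p ->
  cvgn (fun n => (gradm (u n) p).1) /\ cvgn (fun n => (gradm (u n) p).2)}.
Proof.
have mQ := measurable_Q.
have intle n (k : plane -> R) :
    (forall p, k p ^+ 2 <= sqn ((gradm (u n) p).1 - (gradm (u n.+1) p).1,
                 (gradm (u n) p).2 - (gradm (u n.+1) p).2)) ->
    measurable_fun Q k ->
    (\int[mu2]_(p in Q) (k p ^+ 2)%:E <= (8 * 8^-1 ^+ n)%:E)%E.
  move=> kle mk; have id := integrable_distance (tu n) (tu n.+1).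
  apply: (@le_trans _ _ (distance (u n) (u n.+1))%:E); last by rewrite lee_fin.
  rewrite /distance /Rintegral fineK; last exact: integrable_fin_num.
  apply: ge0_le_integral => //.
  - by move=> p _; rewrite lee_fin sqr_ge0.
  - by apply/measurable_EFinP; exact: measurable_funX.
  - by have /integrableP[] := id.
  - by move=> p _; rewrite lee_fin.
have c1 : {ae mu2, forall p, Q p -> cvgn (fun n => (gradm (u n) p).1)}.
  apply: (@ae_cvg_fast _ _ _ mu2 Q (fun n p => (gradm (u n) p).1) 8 mQ) => n.
    by apply: measurable_funTS; exact: measurable_gradm1.
  apply: intle => [p|]; first by have [/andP[]] := sqn_ge ((gradm (u n) p).1 - (gradm (u n.+1) p).1, (gradm (u n) p).2 - (gradm (u n.+1) p).2).
  by apply: measurable_funTS; apply: measurable_funB; exact: measurable_gradm1.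
have c2 : {ae mu2, forall p, Q p -> cvgn (fun n => (gradm (u n) p).2)}.
  apply: (@ae_cvg_fast _ _ _ mu2 Q (fun n p => (gradm (u n) p).2) 8 mQ) => n.
    by apply: measurable_funTS; exact: measurable_gradm2.
  apply: intle => [p|]; first by have [_ /andP[]] := sqn_ge ((gradm (u n) p).1 - (gradm (u n.+1) p).1, (gradm (u n) p).2 - (gradm (u n.+1) p).2).
  by apply: measurable_funTS; apply: measurable_funB; exact: measurable_gradm2.
by apply: ae_imp2 c1 c2 => p h1 h2 Qp; split; [exact: h1|exact: h2].
Qed.

Let f x v := limn_sup (fun n => u n x v).
Let g1 (p : plane) := limn_sup (fun n => (gradm (u n) p).1).
Let g2 (p : plane) := limn_sup (fun n => (gradm (u n) p).2).

Let bounded_limn_sup (w : nat -> plane -> R) :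
  (forall n p, `|w n p| <= 1) -> (forall n, measurable_fun setT (w n)) ->
  measurable_fun setT (fun p => limn_sup (w ^~ p)) /\
  forall p, `|limn_sup (w ^~ p)| <= 1.
Proof.
move=> w1 mw; split.
  apply: measurable_fun_limn_sup => // p _.
    by exists 1 => _ [n _ <-]; have /ler_normlP[] := w1 n p.
  by exists (-1) => _ [n _ <-]; have /ler_normlP[] := w1 n p; lra.
move=> p; have cst_sup (c : R) : limn_sup (fun _ : nat => c) = c.
  by have [_ ->] := cvg_limn_inf_sup (cvg_cst c).
have n1 : `|1 : R| <= 1 by rewrite normr1.
have nN1 : `|-1 : R| <= 1 by rewrite normrN1.
apply/ler_normlP; split.
  have h := @limn_sup_leD (fun=> -1) (w ^~ p) 0 1 (fun=> nN1) (w1 ^~ p).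
  rewrite cst_sup addr0 in h; rewrite lerNl; apply: h => n.
  by have /ler_normlP[] := w1 n p; lra.
have h := @limn_sup_leD (w ^~ p) (fun=> 1) 0 1 (w1 ^~ p) (fun=> n1).
rewrite cst_sup addr0 in h; apply: h => n.
by have /ler_normlP[] := w1 n p; lra.
Qed.

Let g1P := bounded_limn_sup (fun n p => (gradm_le1 p (tu n)).1)
  (fun n => measurable_gradm1 (tu n)).
Let g2P := bounded_limn_sup (fun n p => (gradm_le1 p (tu n)).2)
  (fun n => measurable_gradm2 (tu n)).

Let good : {ae mu2, forall p : plane,
  (forall n, has_grad (u n) p (gradm (u n) p)) /\
  (Q p -> (gradm (u n) p).1 @[n --> \oo] --> g1 p /\
          (gradm (u n) p).2 @[n --> \oo] --> g2 p)}.
Proof.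
apply: ae_and; first by apply: ae_forall_nat => n; exact: has_gradm.
apply: ae_imp ae_cvg_gradm => p c Qp; have [c1 c2] := c Qp.
by split; [rewrite /g1 (cvg_limn_supE c1)|rewrite /g2 (cvg_limn_supE c2)].
Qed.

Let lip2 n x v w : `|u n x v - u n x w| <= 1 * `|v - w|.
Proof. by apply: lipschitz2_r; exact: tilted_lipschitz2. Qed.

Let lip1 n x y v : `|u n x v - u n y v| <= 1 * `|x - y|.
Proof. exact: (lipschitz2_r v (lipschitz2_flip (tilted_lipschitz2 (tu n)))). Qed.

Let NMM : - M < M. Proof. by rewrite gtrN. Qed.

(* On almost every vertical line the functions converge, since they have a
   common value at v = -M and their derivatives converge. *)
Let vertical : {ae mu, forall x : R, 0 < x < 1 ->
  (forall v, - M <= v <= M -> u n x v @[n --> \oo] --> f x v) /\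
  {ae mu, forall v, - M < v < M -> is_derive v 1 (f x) (g2 (x, v))}}.
Proof.
apply: ae_imp (ae_prod2 good) => x gx x01.
have x01' : 0 <= x <= 1 by case/andP: x01 => h1 h2; rewrite !ltW.
have dn n : {ae mu, forall v, - M < v < M -> is_derive v 1 (u n x) (gradm (u n) (x, v)).2}.
  by apply: ae_imp gx => v [h _] _; have [] := h n.
have cn : {ae mu, forall v, - M < v < M ->
    (gradm (u n) (x, v)).2 @[n --> \oo] --> g2 (x, v)}.
  apply: ae_imp gx => v [_ h] vM; apply: (h _).2.
  by split; rewrite /= in_itv/=.
have mg n := measurable_section2 x (measurable_gradm2 (tu n)).
have cu v : - M <= v <= M -> u n x v @[n --> \oo] --> f x v.
  move=> vM.
  have h := cvg_lipschitz_integral ltr01 NMM (fun n => lip2 n x) mg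
    (fun n v => (gradm_le1 (x, v) (tu n)).2) (measurable_section2 x g2P.1) dn cn vM.
  have : cvgn (fun n => u n x v).
    rewrite (_ : (fun n => u n x v) = fun n => (u n x v - u n x (- M)) + (2 * lo x + M)); last first.
      apply/funext => n; have [_ hlo _] := hu n.
      rewrite (hlo x (- M) x01'); first by lra.
      by have /ltr_normlP[] := loM x01'; lra.
    by apply: is_cvgD; [apply/cvg_ex; eexists; exact: h|exact: is_cvg_cst].
  by move=> c; rewrite /f (cvg_limn_supE c).
split => //.
exact: (is_derive_cvg ltr01 NMM (fun n => lip2 n x) mg
    (fun n v => (gradm_le1 (x, v) (tu n)).2) (measurable_section2 x g2P.1)
    (fun v => g2P.2 (x, v)) dn cn cu).
Qed.

(* Convergence on a dense set of vertical lines extends to all points by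
   equicontinuity. *)
Let cvg_everywhere (x v : R) : 0 <= x <= 1 -> - M <= v <= M ->
  u n x v @[n --> \oo] --> f x v.
Proof.
move=> x01 vM; apply/cvgrPdist_le => e e0.
have e30 : 0 < e / 3 by rewrite divr_gt0.
have [y [xy cy]] : exists y, `|x - y| <= e / 3 /\
    (forall v, - M <= v <= M -> u n y v @[n --> \oo] --> f y v).
  have ab : Num.max 0 (x - e / 3) < Num.min 1 (x + e / 3).
    by rewrite gt_max !lt_min; apply/andP; split; apply/andP; split; lra.
  have [y /andP[]] := ae_dense ab vertical.
  rewrite gt_max lt_min => /andP[y0 yx] /andP[y1 yx'] h.
  have y01 : 0 < y < 1 by rewrite y0.
  exists y; split; last by case: (h y01).
  by apply/ler_normlP; split; lra.
have flip : `|f x v - f y v| <= `|x - y|.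
  have [tf _ _] := heights_limsup hu.
  by have := tilted_lipschitz2 tf x v y v; rewrite subrr normr0 addr0.
have /cvgrPdist_le/(_ _ e30) := cy v vM.
apply: filterS => n h.
have ul := lip1 n x y v; rewrite mul1r in ul.
have := ler_normD (f x v - f y v) (f y v - u n y v).
have := ler_normD (f x v - f y v + (f y v - u n y v)) (u n y v - u n x v).
rewrite (distrC (u n y v)).
have -> : f x v - f y v + (f y v - u n y v) + (u n y v - u n x v) = f x v - u n x v by ring.
lra.
Qed.

(* On horizontal lines no common value is prescribed, so the convergence of the
   functions comes from the previous step. *)
Let horizontal : {ae mu, forall v : R, - M < v < M ->
  {ae mu, forall x : R, 0 < x < 1 -> is_derive x 1 (f ^~ v) (g1 (x, v))}}.
Proof.
apply: ae_imp (ae_prod1 good) => v gv vM.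
have vM' : - M <= v <= M by case/andP: vM => h1 h2; rewrite !ltW.
have dn n : {ae mu, forall x : R, 0 < x < 1 -> is_derive x 1 ((u n)^~ v) (gradm (u n) (x, v)).1}.
  by apply: ae_imp gv => x [h _] _; have [] := h n.
have cn : {ae mu, forall x : R, 0 < x < 1 ->
    (gradm (u n) (x, v)).1 @[n --> \oo] --> g1 (x, v)}.
  apply: ae_imp gv => x [_ h] x01; apply: (h _).1.
  by split; rewrite /= in_itv/=.
have mg n := measurable_section1 v (measurable_gradm1 (tu n)).
exact: (is_derive_cvg ltr01 ltr01 (fun n x y => lip1 n x y v) mg
    (fun n x => (gradm_le1 (x, v) (tu n)).1) (measurable_section1 v g1P.1)
    (fun x => g1P.2 (x, v)) dn cn (fun x x01 => cvg_everywhere x01 vM')).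
Qed.

(** Along lines in both directions the derivative of the limit is the limit of
    the derivatives. *)
Lemma heights_limit : exists2 f', heights f' & {ae mu2, forall p, Q p ->
  (gradm (u n) p).1 @[n --> \oo] --> (gradm f' p).1 /\
  (gradm (u n) p).2 @[n --> \oo] --> (gradm f' p).2}.
Proof.
have hf := heights_limsup hu; have [tf _ _] := hf.
exists f => //.
have eq_set (k l : plane -> R) : measurable_fun setT k -> measurable_fun setT l ->
    measurable [set p | Q p -> k p = l p].
  move=> mk ml; rewrite (_ : [set p | _] = ~` Q `|` [set p | k p - l p <= 0] `&` [set p | 0 <= k p - l p]).
    apply: measurableU; first by apply: measurableC; exact: measurable_Q.
    by apply: measurableI; apply: measurable_set_le => //; exact: measurable_funB.
  apply/seteqP; split => p /=.
    have [Qp /(_ Qp) ->|nQp _] := pselect (Q p); last by left.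
    by right; rewrite subrr.
  move=> [nQp /nQp//|[h1 h2] _]; apply/eqP; rewrite -subr_eq0 eq_le h1 h2//.
have e2 : {ae mu2, forall p, Q p -> (gradm f p).2 = g2 p}.
  apply: (@prod_ae2 _ [set p | Q p -> (gradm f p).2 = g2 p]).
    by apply: eq_set; [exact: measurable_gradm2|exact: g2P.1].
  apply: ae_imp2 vertical (ae_prod2 (has_gradm tf)) => x vx fx.
  have [x01|x01] := pselect (0 < x < 1); last first.
    by apply: aeW => v [/=]; rewrite in_itv/= => /x01.
  have [_ vx'] := vx x01.
  apply: ae_imp2 vx' fx => v h1 [_ h2] [/= _]; rewrite in_itv/= => vM.
  by rewrite -(@derive_val _ _ _ _ _ _ _ (h1 vM)) -(@derive_val _ _ _ _ _ _ _ h2).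
have e1 : {ae mu2, forall p, Q p -> (gradm f p).1 = g1 p}.
  apply: (@prod_ae1 _ [set p | Q p -> (gradm f p).1 = g1 p]).
    by apply: eq_set; [exact: measurable_gradm1|exact: g1P.1].
  apply: ae_imp2 horizontal (ae_prod1 (has_gradm tf)) => v vx fv.
  have [vM|vM] := pselect (- M < v < M); last first.
    by apply: aeW => x [/= _]; rewrite in_itv/= => /vM.
  apply: ae_imp2 (vx vM) fv => x h1 [h2 _] [/=]; rewrite in_itv/= => x01 _.
  by rewrite -(@derive_val _ _ _ _ _ _ _ (h1 x01)) -(@derive_val _ _ _ _ _ _ _ h2).
apply: ae_imp2 good (ae_and e1 e2) => p [_ h] [h1 h2] Qp.
by rewrite (h1 Qp) (h2 Qp); exact: h.
Qed.

End Limit.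

Lemma exists_minimizer : (exists2 f, heights f & (total_cost f < +oo)%E) ->
  exists2 f, heights f & forall g, heights g -> (total_cost f <= total_cost g)%E.
Proof.
have tl f : heights f -> tilted f by case.
move=> fin; have [u [hu du uinf]] := @minimizing_sequence R _ heights (@mid R)
  total_cost energy distance (2 * (2 * M)) heights_mid
  (fun f hf => total_cost_ge0 (tl f hf)) (fun f hf => energy_bound (tl f hf))
  (fun f g hf hg => total_cost_mid (tl f hf) (tl g hg))
  (fun f g hf hg => energy_mid (tl f hf) (tl g hg)) fin.
have [f hf fu] := heights_limit hu du; exists f; first exact: hf.
move=> g hg.
apply: le_trans (uinf g hg).
have mc n : measurable_fun Q (fun p => cost (gradm (u n) p)).
  by apply: measurable_funTS; apply: measurable_cost_gradm; exact: tl.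
have c0 n p : Q p -> (0 <= cost (gradm (u n) p))%E.
  by move=> _; apply: cost_ge0; apply: gradm_slopes; exact: tl.
apply: le_trans (fatou mu2 measurable_Q mc c0).
apply: ae_ge0_le_integral; first exact: measurable_Q.
- by move=> p _; apply: cost_ge0; apply: gradm_slopes; exact: tl.
- by apply: measurable_funTS; apply: measurable_cost_gradm; exact: tl.
- by move=> p Qp; apply: limn_einf_ge; apply: nearW => n; exact: c0.
- apply: (@measurableT_comp _ _ _ _ _ _ (@oppe R)); first exact: oppe_measurable.
  apply: measurable_fun_limn_esup => n.
  by apply: (@measurableT_comp _ _ _ _ _ _ (@oppe R)); [exact: oppe_measurable|exact: mc].
apply: ae_imp fu => p h Qp; have [h1 h2] := h Qp.
by apply: cost_lsc => [n||//|//]; apply: gradm_slopes; exact: tl.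
Qed.

(** Equality of the v-derivatives gives equality on almost every vertical line by
    integration from v = -M, and on all of them by continuity. *)
Lemma heights_eq_ae f g : heights f -> heights g ->
  {ae mu2, forall p, Q p -> (gradm f p).2 = (gradm g p).2} ->
  forall x v : R, 0 <= x <= 1 -> f x v = g x v.
Proof.
move=> hf hg fg; have [tf flo fhi] := hf; have [tg glo ghi] := hg.
have NMM : - M < M by rewrite gtrN.
have step : {ae mu, forall x : R, 0 < x < 1 -> forall v, f x v = g x v}.
  apply: ae_imp (ae_prod2 (ae_and fg (ae_and (has_gradm tf) (has_gradm tg)))) => x hx x01 v.
  have x01' : 0 <= x <= 1 by case/andP: x01 => h1 h2; rewrite !ltW.
  have [vM|vM] := leP v (- M).
    by rewrite flo ?glo//; have /ltr_normlP[] := loM x01'; lra.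
  have [Mv|Mv] := leP M v.
    by rewrite fhi ?ghi//; have /ltr_normlP[] := hiM x01'; lra.
  have vM' : - M <= v <= M by rewrite !ltW.
  have dfx : {ae mu, forall w : R, - M < w < M -> is_derive w 1 (f x) (gradm f (x, w)).2}.
    by apply: ae_imp hx => w [_ [[_ h] _]] _.
  have dgx : {ae mu, forall w : R, - M < w < M -> is_derive w 1 (g x) (gradm f (x, w)).2}.
    apply: ae_imp hx => w [e [_ [_ h]]] wM; rewrite e//.
  have fE := @lipschitz_integral _ (f x) (fun w => (gradm f (x, w)).2) 1 1 (- M) M
    ltr01 NMM (lipschitz2_r x (tilted_lipschitz2 tf))
    (measurable_section2 x (measurable_gradm2 tf)) (fun w => (gradm_le1 (x, w) tf).2) dfx v vM'.
  have gE := @lipschitz_integral _ (g x) (fun w => (gradm f (x, w)).2) 1 1 (- M) M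
    ltr01 NMM (lipschitz2_r x (tilted_lipschitz2 tg))
    (measurable_section2 x (measurable_gradm2 tf)) (fun w => (gradm_le1 (x, w) tf).2) dgx v vM'.
  have e0 : f x (- M) = g x (- M).
    by rewrite flo ?glo//; have /ltr_normlP[] := loM x01'; lra.
  have : f x v - f x (- M) = g x v - g x (- M) by rewrite fE gE.
  rewrite e0; lra.
move=> x v x01; apply/eqP; rewrite -subr_eq0 -normr_le0; apply/ler_addgt0Pr => e e0.
have e20 : 0 < e / 2 by rewrite divr_gt0.
have ab : Num.max 0 (x - e / 2) < Num.min 1 (x + e / 2).
  by rewrite gt_max !lt_min; apply/andP; split; apply/andP; split; lra.
have [y /andP[]] := ae_dense ab step.
rewrite gt_max lt_min => /andP[y0 yx] /andP[y1 yx'] h.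
have {}h : f y v = g y v by apply: h; rewrite y0.
have h1 := tilted_lipschitz2 tf x v y v; have h2 := tilted_lipschitz2 tg x v y v.
rewrite subrr normr0 addr0 in h1 h2.
have xy : `|x - y| <= e / 2 by apply/ler_normlP; split; lra.
have := ler_normB (f x v - f y v) (g x v - g y v).
have -> : f x v - f y v - (g x v - g y v) = f x v - g x v by rewrite h; ring.
lra.
Qed.

(** The midpoint of two minimizers is a minimizer, so the midpoint inequality for
    the cost is an equality almost everywhere; [cost_midpoint_lt] then forces
    equal v-derivatives. *)
Lemma unique_minimizer f g : heights f -> heights g -> (total_cost f < +oo)%E ->
  (forall k, heights k -> (total_cost f <= total_cost k)%E) ->
  (forall k, heights k -> (total_cost g <= total_cost k)%E) ->
  forall x v : R, 0 <= x <= 1 -> f x v = g x v.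
Proof.
move=> hf hg ffin fmin gmin; apply: heights_eq_ae => //.
have [tf _ _] := hf; have [tg _ _] := hg.
have hm := heights_mid hf hg; have tm := tilted_mid tf tg.
have gf : total_cost g = total_cost f.
  by apply/eqP; rewrite eq_le; apply/andP; split; [exact: gmin hf|exact: fmin hg].
pose A p := (cost (gradm f p) + cost (gradm g p))%E.
pose B p := (cost (gradm (mid f g) p) + cost (gradm (mid f g) p))%E.
have c0 (k : R -> R -> R) p : tilted k -> (0 <= cost (gradm k p))%E.
  by move=> tk; apply: cost_ge0; exact: gradm_slopes.
have A0 p : (0 <= A p)%E by rewrite adde_ge0 ?c0.
have B0 p : (0 <= B p)%E by rewrite adde_ge0 ?c0.
have mA : measurable_fun Q A.
  by apply: measurable_funTS; apply: emeasurable_funD; exact: measurable_cost_gradm.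
have mB : measurable_fun Q B.
  by apply: measurable_funTS; apply: emeasurable_funD; exact: measurable_cost_gradm.
have mQ := measurable_Q.
have BA : {ae mu2, forall p, Q p -> (B p <= A p)%E}.
  apply: ae_imp (ae_gradm_mid tf tg) => p; rewrite /A /B => -> _.
  by apply: cost_midpoint; exact: gradm_slopes.
have IA : (\int[mu2]_(p in Q) A p = total_cost f + total_cost f)%E.
  by rewrite -{2}gf (total_costD tf tg).
have IB : (total_cost f + total_cost f <= \int[mu2]_(p in Q) B p)%E.
  by apply: le_trans (leeD (fmin _ hm) (fmin _ hm)) _; rewrite (total_costD tm tm).
have IAfin : (\int[mu2]_(p in Q) A p < +oo)%E by rewrite IA lte_add_pinfty.
have BA' : (\int[mu2]_(p in Q) B p <= \int[mu2]_(p in Q) A p)%E.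
  by apply: ae_ge0_le_integral BA; [exact: mQ|move=> p _; exact: B0|exact: mB|move=> p _; exact: A0|exact: mA].
have IBfin : (\int[mu2]_(p in Q) B p < +oo)%E by exact: le_lt_trans BA' IAfin.
have iA : mu2.-integrable Q A.
  apply/integrableP; split; first exact: mA.
  rewrite (_ : (\int[mu2]_(p in Q) `|A p|)%E = (\int[mu2]_(p in Q) A p)%E); first exact: IAfin.
  by apply: eq_integral => p _; rewrite gee0_abs; [|exact: A0].
have iB : mu2.-integrable Q B.
  apply/integrableP; split; first exact: mB.
  rewrite (_ : (\int[mu2]_(p in Q) `|B p|)%E = (\int[mu2]_(p in Q) B p)%E); first exact: IBfin.
  by apply: eq_integral => p _; rewrite gee0_abs; [|exact: B0].
have mAB : measurable_fun Q (fun p => A p - B p)%E by exact: emeasurable_funB.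
have AB0 : (\int[mu2]_(p in Q) `|A p - B p|)%E = 0%E.
  transitivity (\int[mu2]_(p in Q) (A p - B p))%E.
    apply: ae_eq_integral; [exact: mQ| |exact: mAB|].
      by apply: measurableT_comp; [exact: abse_measurable|exact: mAB].
    apply: ae_imp2 BA (ae_and (integrable_ae mQ iA) (integrable_ae mQ iB)) => p ba [fa fb] Qp.
    apply: gee0_abs; move: (ba Qp); rewrite -sube_ge0; [exact|by rewrite (fb Qp)].
  rewrite (integralB mQ iA iB).
  have -> : (\int[mu2]_(p in Q) B p = \int[mu2]_(p in Q) A p)%E.
    apply/eqP; rewrite eq_le; apply/andP; split; first exact: BA'.
    by apply: (@le_trans _ _ (total_cost f + total_cost f)%E) IB; rewrite -IA lexx.
  by rewrite subee; last exact: integrable_fin_num.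
have := (ae_eq_integral_abs mu2 mQ (emeasurable_funB mA mB)).1 AB0.
move=> h; have := ae_and h (ae_and (ae_gradm_mid tf tg) (ae_and (integrable_ae mQ iA) (integrable_ae mQ iB))).
apply: ae_imp => p [ab [mE [fa fb]]] Qp; apply: contrapT => /eqP ne.
have := ab Qp; have {}fa := fa Qp; have {}fb := fb Qp.
have [f1 f2] : (cost (gradm f p) < +oo)%E /\ (cost (gradm g p) < +oo)%E.
  move: fa; rewrite /A fin_numD => /andP[h1 h2].
  by split; rewrite ltey_eq ?h1 ?h2.
have := cost_midpoint_lt (gradm_slopes p tf) (gradm_slopes p tg) f1 f2 ne.
rewrite -mE -/(A p) -/(B p) => BltA AB.
have AE : A p = B p by rewrite -[LHS](@subeK _ _ _ fb) AB add0e.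
by rewrite AE ltxx in BltA.
Qed.

End Minimizer.

(** * Inverting a vertical section of the surface *)
Section Profile.
Variable R : realType.
Implicit Types (g : R -> R) (u y z : R).

Definition clamp (x : R) : R := Num.max 0 (Num.min 1 x).

Lemma clamp01 x : 0 <= clamp x <= 1.
Proof. by rewrite /clamp le_max lexx ge_max ler01 ge_min lexx. Qed.

Lemma clampE x : 0 <= x <= 1 -> clamp x = x.
Proof. by move=> /andP[x0 x1]; rewrite /clamp (min_idPr x1) (max_idPr x0). Qed.

Lemma clamp_le0 x : x <= 0 -> clamp x = 0.
Proof.
move=> x0; rewrite /clamp (min_idPr _); last by rewrite (le_trans x0).
exact/max_idPl.
Qed.

Lemma clamp_ge1 x : 1 <= x -> clamp x = 1.
Proof. by move=> x1; rewrite /clamp (min_idPl x1); apply/max_idPr. Qed.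

Lemma clamp_homo x y : x <= y -> clamp x <= clamp y.
Proof. by move=> xy; apply: le_max2 => //; apply: le_min2. Qed.

Lemma clamp_lipschitz x y : `|clamp x - clamp y| <= `|x - y|.
Proof.
wlog xy : x y / x <= y => [th|].
  have [/th//|/ltW/th] := leP x y.
  by rewrite distrC (distrC y).
have [x0|x0] := leP x 0.
  rewrite (clamp_le0 x0); have [y0|y0] := leP y 0.
    by rewrite (clamp_le0 y0) subrr normr0.
  have [y1|y1] := leP 1 y.
    rewrite (clamp_ge1 y1) sub0r normrN1.
    by rewrite distrC ger0_norm ?subr_ge0//; lra.
  have -> : clamp y = y by rewrite clampE// !ltW.
  by rewrite sub0r normrN distrC (ger0_norm (ltW y0)) ger0_norm ?subr_ge0//; lra.
have [x1|x1] := leP 1 x.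
  by rewrite (clamp_ge1 x1) (clamp_ge1 (le_trans x1 xy)) subrr normr0.
have -> : clamp x = x by rewrite clampE// !ltW.
have [y1|y1] := leP 1 y.
  rewrite (clamp_ge1 y1) distrC [leRHS]distrC !ger0_norm ?subr_ge0//; lra.
by rewrite clampE// (ltW (lt_le_trans x0 xy)) ltW.
Qed.

Definition profile g := [/\ forall y y', y <= y' -> g y <= g y',
  forall y, y <= 0 -> g y = g 0 & forall y, 1 <= y -> g y = g 1].

(** The generalized inverse of the increasing function y + g y. *)
Definition crossing g u := sup [set y | y + g y <= u].

Lemma crossing_lt g u y : profile g -> y < crossing g u -> y + g y <= u.
Proof.
move=> [gm g0 g1] /sup_gt[|y' /= y'u yy'].
  exists (Num.min 0 (u - g 0)) => /=; have [u0|u0] := leP 0 (u - g 0).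
    by rewrite add0r; lra.
  by rewrite (g0 _ (ltW u0)); lra.
by apply: le_trans y'u; apply: lerD; [exact: ltW|exact/gm/ltW].
Qed.

Lemma crossing_gt g u y : profile g -> crossing g u < y -> u < y + g y.
Proof.
move=> [gm g0 g1] yc; rewrite ltNge; apply: contraTN yc => yu.
rewrite -leNgt; apply: ub_le_sup => //; exists (Num.max 1 (u - g 1)) => y' /= y'u.
have [h|h] := leP y' 1; first by rewrite le_max h.
by rewrite le_max; apply/orP; right; move: y'u; rewrite (g1 _ (ltW h)); lra.
Qed.

(** The crossing is characterized by the two sides on which y + g y lies below
    and above u; every other property of it follows from this. *)
Lemma crossingE g u a : profile g -> (forall y, y < a -> y + g y <= u) ->
  (forall y, a < y -> u <= y + g y) -> crossing g u = a.
Proof.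
move=> pg au ua; have [gm _ _] := pg.
have [ca|ac|//] := ltgtP (crossing g u) a.
  pose y := (crossing g u + a) / 2.
  have h1 : crossing g u < y by rewrite /y; lra.
  have h2 : y < a by rewrite /y; lra.
  by have := crossing_gt pg h1; have := au _ h2; lra.
pose y := (crossing g u + a) / 2; pose y' := (y + a) / 2.
have h1 : y < crossing g u by rewrite /y; lra.
have h2 : a < y' by rewrite /y' /y; lra.
have h3 : y' < y by rewrite /y' /y; lra.
by have := crossing_lt pg h1; have := ua _ h2; have := gm _ _ (ltW h3); lra.
Qed.

Lemma crossing_low g u : profile g -> u <= g 0 -> crossing g u = u - g 0.
Proof.
move=> pg ug; have [gm g0 _] := pg; apply: crossingE => // y h; last first.
  have [y0|y0] := leP y 0; first by rewrite g0//; lra.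
  by have := gm _ _ (ltW y0); lra.
by rewrite g0; lra.
Qed.

Lemma crossing_high g u : profile g -> 1 + g 1 <= u -> crossing g u = u - g 1.
Proof.
move=> pg ug; have [gm _ g1] := pg; apply: crossingE => // y h; last first.
  by rewrite g1; lra.
have [y0|y0] := leP 1 y; first by rewrite g1//; lra.
by have := gm _ _ (ltW y0); lra.
Qed.

Lemma crossing_homo g u u' : profile g -> u <= u' -> crossing g u <= crossing g u'.
Proof.
move=> pg uu'; rewrite leNgt; apply/negP => h.
pose y := (crossing g u + crossing g u') / 2.
have h1 : y < crossing g u by rewrite /y; lra.
have h2 : crossing g u' < y by rewrite /y; lra.
by have := crossing_lt pg h1; have := crossing_gt pg h2; lra.
Qed.

Lemma crossing_lipschitz g u u' : profile g -> u <= u' ->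
  crossing g u' <= crossing g u + (u' - u).
Proof.
move=> pg uu'; rewrite leNgt; apply/negP => h; have [gm _ _] := pg.
pose y := (crossing g u + (u' - u) + crossing g u') / 2.
have h1 : y < crossing g u' by rewrite /y; lra.
have h2 : crossing g u < y - (u' - u) by rewrite /y; lra.
have h3 : y - (u' - u) <= y by lra.
by have := crossing_lt pg h1; have := crossing_gt pg h2; have := gm _ _ h3; lra.
Qed.

Lemma crossing_shift g g' u e : profile g -> profile g' ->
  (forall y, g' y <= g y + e) -> crossing g u <= crossing g' (u + e).
Proof.
move=> pg pg' gg'; rewrite leNgt; apply/negP => h.
pose y := (crossing g u + crossing g' (u + e)) / 2.
have h1 : y < crossing g u by rewrite /y; lra.
have h2 : crossing g' (u + e) < y by rewrite /y; lra.
by have := crossing_lt pg h1; have := crossing_gt pg' h2; have := gg' y; lra.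
Qed.

Lemma crossing_graph g y : profile g -> crossing g (y + g y) = y.
Proof.
move=> pg; have [gm _ _] := pg; apply: crossingE => // y' h.
  by have := gm _ _ (ltW h); lra.
by have := gm _ _ (ltW h); lra.
Qed.

Lemma lim_left_le g y z : (forall y y', y <= y' -> g y <= g y') ->
  lim (g (y + eta) @[eta --> 0^'-]) <= z <-> forall y', y' < y -> g y' <= z.
Proof.
move=> gm; have cv : cvg (g (y + eta) @[eta --> 0^'-]).
  apply: (@nondecreasing_at_left_is_cvgr _ (fun eta => g (y + eta)) 0).
    near=> e => a b _ _ ab; apply: gm; rewrite lerD2l//.
  near=> e; exists (g y) => _ [a /= a0 <-]; apply: gm.
  by move: a0; rewrite in_itv/= => /andP[_ a0]; lra.
split=> [h y' yy'|h].
  apply: le_trans h; apply: limr_ge => //; near=> e; apply: gm.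
  have : y' - y < e by near: e; apply: nbhs_left_gt; lra.
  lra.
apply: limr_le => //; near=> e; apply: h.
have : e < 0 by near: e; exact: nbhs_left_lt.
lra.
Unshelve. all: by end_near. Qed.

Lemma lim_right_ge g y z : (forall y y', y <= y' -> g y <= g y') ->
  z <= lim (g (y + eta) @[eta --> 0^'+]) <-> forall y', y < y' -> z <= g y'.
Proof.
move=> gm; have cv : cvg (g (y + eta) @[eta --> 0^'+]).
  apply: (@nondecreasing_at_right_is_cvgr _ (fun eta => g (y + eta)) 0).
    near=> e => a b _ _ ab; apply: gm; rewrite lerD2l//.
  near=> e; exists (g y) => _ [a /= a0 <-]; apply: gm.
  by move: a0; rewrite in_itv/= => /andP[a0 _]; lra.
split=> [h y' yy'|h].
  apply: (le_trans h); apply: limr_le => //; near=> e; apply: gm.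
  have : e < y' - y by near: e; apply: nbhs_right_lt; lra.
  lra.
apply: limr_ge => //; near=> e; apply: h.
have : 0 < e by near: e; exact: nbhs_right_gt.
lra.
Unshelve. all: by end_near. Qed.

End Profile.

(** * From height functions to tilted functions *)
Section Tilt.
Variable R : realType.
Implicit Types (f g h hb : R -> R -> R) (u v x y z : R).

Lemma sqrt2_half u : Num.sqrt 2 / 2 * (Num.sqrt 2 * u) = u.
Proof.
have s := sqrt2_sqr R; transitivity (Num.sqrt 2 * Num.sqrt 2 * u / 2); first by ring.
by rewrite s; lra.
Qed.

Lemma sqrt2_halfK u : Num.sqrt 2 * (Num.sqrt 2 / 2 * u) = u.
Proof. by have s := sqrt2_sqr R; rewrite !mulrA s divff// mul1r. Qed.

(** Clamping x makes this a function on the whole plane; for y outside [0, 1] the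
    function h(x, .) is extended by constants, as in the description of the
    surface. *)
Definition tilt h x v : R :=
  v - Num.sqrt 2 * crossing (extend_y h (clamp x)) (Num.sqrt 2 * v).

Lemma surfaceP h x y z : (forall y y', y <= y' -> extend_y h x y <= extend_y h x y') ->
  surface h (x, y, z) <-> [/\ D (x, y),
    forall y', y' < y -> extend_y h x y' <= z & forall y', y < y' -> z <= extend_y h x y'].
Proof.
move=> gm; rewrite /surface/=; split=> -[Dxy h1 h2]; split => //.
- exact/lim_left_le.
- exact/lim_right_ge.
- exact/lim_left_le.
- exact/lim_right_ge.
Qed.

(** A point (x, y, z) of the surface with y + z = u satisfies y = Y(x, u), by the
    characterization of the crossing, and z - y = u - 2 * y.  Conversely the point
    with y = Y(x, u) is on the surface. *)
Lemma h_tildeE h x v : 0 <= x <= 1 -> profile (extend_y h x) ->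
  Num.sqrt 2 / 2 * extend_y h x 0 <= v <= Num.sqrt 2 / 2 * (1 + extend_y h x 1) ->
  h_tilde h x v = tilt h x v.
Proof.
move=> x01 pg /andP[vlo vhi]; have [gm _ _] := pg.
rewrite /tilt clampE//; have s0 := sqrt2_gt0 R; have s2 := sqrt2_sqr R.
set u := Num.sqrt 2 * v; set g := extend_y h x in pg gm vlo vhi *.
have vE : v = Num.sqrt 2 / 2 * u by rewrite sqrt2_half.
have ulo : g 0 <= u.
  by rewrite -[g 0]sqrt2_halfK /u ler_pM2l.
have uhi : u <= 1 + g 1.
  by rewrite -[leRHS]sqrt2_halfK /u ler_pM2l.
pose y := crossing g u.
have y0 : 0 <= y.
  by rewrite -(subrr (g 0)) -(crossing_low pg (lexx _)); exact: crossing_homo.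
have y1 : y <= 1.
  by rewrite -[leRHS](addrK (g 1)) -(crossing_high pg (lexx _)); exact: crossing_homo.
have vy z : Num.sqrt 2 / 2 * (y + z) = v -> Num.sqrt 2 / 2 * (z - y) = v - Num.sqrt 2 * y.
  by lra.
apply: xget_unique => [|w /= [[[x' y'] z] surf]].
  exists (x, y, u - y); last first.
    have yz : Num.sqrt 2 / 2 * (y + (u - y)) = v by rewrite addrC subrK -vE.
    by rewrite /rotate/= (vy _ yz) yz.
  apply/(surfaceP _ _ gm); split.
  - by rewrite /D/= !in_itv/= y0.
  - move=> y' y'y; rewrite leNgt; apply/negP => h1.
    pose m := Num.max y' (u - g y').
    have my : m < y by rewrite /m gt_max y'y/=; move: h1; rewrite -/g; lra.
    pose t := (m + y) / 2.
    have ty : t < y by rewrite /t; lra.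
    have mt : m < t by rewrite /t; lra.
    move: mt; rewrite gt_max => /andP[t1 t2].
    by have := crossing_lt pg ty; have := gm _ _ (ltW t1); lra.
  - move=> y' y'y; rewrite leNgt; apply/negP => h1.
    pose m := Num.min y' (u - g y').
    have my : y < m by rewrite /m lt_min y'y/=; move: h1; rewrite -/g; lra.
    pose t := (m + y) / 2.
    have ty : y < t by rewrite /t; lra.
    have mt : t < m by rewrite /t; lra.
    move: mt; rewrite lt_min => /andP[t1 t2].
    by have := crossing_gt pg ty; have := gm _ _ (ltW t1); lra.
move: surf => /[swap] -[x'x vE' <-]; subst x' => surf.
have /(surfaceP _ _ gm) [_ h1 h2] := surf.
suff yE : y = y' by rewrite -/y -(vy z) ?yE.
have uE : u = y' + z by rewrite /u -vE' sqrt2_halfK.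
apply: (crossingE pg) => t ty.
  by rewrite uE; apply: lerD; [exact: ltW|exact: h1].
by rewrite uE; apply: lerD; [exact: ltW|exact: h2].
Qed.

Lemma has_grad_local f g x v (r : R) (z : R * R) : 0 < r ->
  (forall x', `|x' - x| < r -> f x' v = g x' v) ->
  (forall v', `|v' - v| < r -> f x v' = g x v') ->
  has_grad f (x, v) z -> has_grad g (x, v) z.
Proof.
move=> r0 fg1 fg2 [/= d1 d2]; split => /=.
  apply: near_eq_is_derive d1; apply/nbhs_ballP; exists r => //= x'.
  by rewrite /ball/= distrC; exact: fg1.
apply: near_eq_is_derive d2; apply/nbhs_ballP; exists r => //= v'.
by rewrite /ball/= distrC; exact: fg2.
Qed.

Variable hb : R -> R -> R.
Hypothesis hb_height : boundary_height hb.
Hypothesis hb_const0 : exists c0 : R, forall y, 0 <= y <= 1 -> hb 0 y = c0.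
Hypothesis hb_const1 : exists c1 : R, forall y, 0 <= y <= 1 -> hb 1 y = c1.

Definition lower x : R := Num.sqrt 2 / 2 * hb (clamp x) 0.
Definition upper x : R := Num.sqrt 2 / 2 * (1 + hb (clamp x) 1).

Lemma D_col x y : 0 <= x <= 1 -> 0 <= y <= 1 -> D (x, y).
Proof. by move=> h1 h2; split; rewrite /= in_itv. Qed.

Lemma boundary_lipschitz (y : R) x x' : y = 0 \/ y = 1 ->
  hb (clamp x) y <= hb (clamp x') y + `|x - x'| / 2.
Proof.
move=> y01; have [_ hL] := hb_height.
have y01' : 0 <= y <= 1 by case: y01 => ->; rewrite ?lexx ?ler01.
have bd t : bdD (clamp t, y).
  by split; [apply: D_col => //; exact: clamp01|case: y01 => h; [apply: Or43|apply: Or44]].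
have := hL y (clamp x, clamp x') (conj (bd x) (bd x')).
rewrite /= => /ler_normlP[_]; have := clamp_lipschitz x x'; lra.
Qed.

Lemma boundary_sides x y : x = 0 \/ x = 1 -> 0 <= y <= 1 ->
  hb x y = hb x 0.
Proof.
have h : 0 <= (0 : R) <= 1 by rewrite lexx ler01.
case=> ->; first by have [c hc] := hb_const0 => y01; rewrite !hc.
by have [c hc] := hb_const1 => y01; rewrite !hc.
Qed.

Lemma boundary_le x : hb (clamp x) 0 <= hb (clamp x) 1.
Proof.
have [hm _] := hb_height.
have bd t : t = 0 \/ t = 1 -> bdD (clamp x, t).
  move=> t01; split; last by case: t01 => h; [apply: Or43|apply: Or44].
  by apply: D_col; [exact: clamp01|case: t01 => ->; rewrite ?lexx ?ler01].
by apply: hm => //; apply: bd; [left|right].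
Qed.

Lemma lower_lipschitz x x' : lower x <= lower x' + Num.sqrt 2 / 4 * `|x - x'|.
Proof.
have s0 := sqrt2_gt0 R; rewrite /lower.
have h0 : (0 : R) = 0 \/ (0 : R) = 1 by left.
have := boundary_lipschitz x x' h0.
set a := hb _ _; set b := hb _ _; set d := `|_|; nra.
Qed.

Lemma upper_lipschitz x x' : upper x <= upper x' + Num.sqrt 2 / 4 * `|x - x'|.
Proof.
have s0 := sqrt2_gt0 R; rewrite /upper.
have h0 : (1 : R) = 0 \/ (1 : R) = 1 by right.
have := boundary_lipschitz x x' h0.
set a := hb _ _; set b := hb _ _; set d := `|_|; nra.
Qed.

Lemma extend_y0 h x : extend_y h x 0 = h x 0.
Proof. by rewrite /extend_y -/(clamp 0) clamp_le0. Qed.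

Lemma extend_y1 h x : extend_y h x 1 = h x 1.
Proof. by rewrite /extend_y -/(clamp 1) clamp_ge1. Qed.

Lemma admissible_profile h x : admissible hb h -> profile (extend_y h (clamp x)).
Proof.
move=> [_ hm _]; split=> [y y' yy'|y y0|y y1]; rewrite /extend_y -!/(clamp _).
- by apply: hm; [apply: D_col; exact: clamp01|apply: D_col; exact: clamp01|exact: clamp_homo].
- by rewrite (clamp_le0 y0) (@clamp_le0 _ 0).
- by rewrite (clamp_ge1 y1) (@clamp_ge1 _ 1).
Qed.

Lemma admissible0 h x : admissible hb h -> extend_y h (clamp x) 0 = hb (clamp x) 0.
Proof.
move=> [_ _ hbd]; rewrite extend_y0; apply: hbd.
by split; [apply: D_col; [exact: clamp01|rewrite lexx ler01]|exact: Or43].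
Qed.

Lemma admissible1 h x : admissible hb h -> extend_y h (clamp x) 1 = hb (clamp x) 1.
Proof.
move=> [_ _ hbd]; rewrite extend_y1; apply: hbd.
by split; [apply: D_col; [exact: clamp01|rewrite lexx ler01]|exact: Or44].
Qed.

Lemma admissible_lipschitz h x x' y : admissible hb h ->
  extend_y h (clamp x) y <= extend_y h (clamp x') y + `|x - x'| / 2.
Proof.
move=> [hL _ _]; rewrite /extend_y -!/(clamp _).
have DD t : D (clamp t, clamp y) by apply: D_col; exact: clamp01.
have := hL (clamp y) (clamp x, clamp x') (conj (DD x) (DD x')).
rewrite /= => /ler_normlP[_]; have := clamp_lipschitz x x'; lra.
Qed.

(** The crossing is nondecreasing and 1-Lipschitz in u, and a shift of the profile
    by e shifts the crossing by e in u. *)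
Lemma tilt_heights h : admissible hb h -> heights lower upper (tilt h).
Proof.
move=> ah; have pg x := admissible_profile x ah.
have s0 := sqrt2_gt0 R; have s2 := sqrt2_sqr R.
split; first split.
- move=> x v w vw; rewrite /tilt; set g := extend_y _ _.
  have vw' : Num.sqrt 2 * v <= Num.sqrt 2 * w by rewrite ler_pM2l.
  have := crossing_homo (pg x) vw'; have := crossing_lipschitz (pg x) vw'.
  rewrite -/g; set b := crossing _ (_ * w); set a := crossing _ (_ * v) => h1 h2.
  have h3 : Num.sqrt 2 * a <= Num.sqrt 2 * b by rewrite ler_pM2l.
  have h4 : Num.sqrt 2 * b <= Num.sqrt 2 * (a + (Num.sqrt 2 * w - Num.sqrt 2 * v)).
    by rewrite ler_pM2l.
  have e : Num.sqrt 2 * (a + (Num.sqrt 2 * w - Num.sqrt 2 * v)) =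
    Num.sqrt 2 * a + Num.sqrt 2 * Num.sqrt 2 * (w - v) by ring.
  rewrite e s2 in h4.
  by apply/ler_normlP; split; lra.
- move=> x x' v; rewrite /tilt; set d := `|_|.
  have e : Num.sqrt 2 * (v + Num.sqrt 2 / 4 * d) = Num.sqrt 2 * v + d / 2.
    rewrite mulrDr; congr (_ + _).
    transitivity (Num.sqrt 2 * Num.sqrt 2 * d / 4); first by ring.
    by rewrite s2; lra.
  rewrite e; have := @crossing_shift _ _ _ (Num.sqrt 2 * v) (d / 2) (pg x) (pg x').
  move=> /(_ (fun y => admissible_lipschitz x' x y ah)).
  set a := crossing _ _; set b := crossing _ _ => h1.
  have h3 : Num.sqrt 2 * a <= Num.sqrt 2 * b by rewrite ler_pM2l.
  lra.
- move=> x v x01; rewrite /lower /tilt => vlo.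
  have ulo : Num.sqrt 2 * v <= extend_y h (clamp x) 0.
    by rewrite admissible0// -[leRHS]sqrt2_halfK ler_pM2l.
  rewrite (crossing_low (pg x) ulo) admissible0//.
  have -> : Num.sqrt 2 * (Num.sqrt 2 * v - hb (clamp x) 0) =
    Num.sqrt 2 * Num.sqrt 2 * v - Num.sqrt 2 * hb (clamp x) 0 by ring.
  rewrite s2; lra.
- move=> x v x01; rewrite /upper /tilt => vhi.
  have uhi : 1 + extend_y h (clamp x) 1 <= Num.sqrt 2 * v.
    by rewrite admissible1// -[leLHS]sqrt2_halfK ler_pM2l.
  rewrite (crossing_high (pg x) uhi) admissible1//.
  have -> : Num.sqrt 2 * (Num.sqrt 2 * v - hb (clamp x) 1) =
    Num.sqrt 2 * Num.sqrt 2 * v - Num.sqrt 2 * hb (clamp x) 1 by ring.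
  rewrite s2; lra.
Qed.

Lemma h_tilde_tilt h x v : admissible hb h -> 0 <= x <= 1 ->
  lower x <= v <= upper x -> h_tilde h x v = tilt h x v.
Proof.
move=> ah x01; rewrite /lower /upper -(admissible0 _ ah) -(admissible1 _ ah).
move=> hv; have pg := admissible_profile x ah.
by apply: h_tildeE => //; rewrite clampE// in hv pg.
Qed.

End Tilt.

(** * From tilted functions back to height functions *)
Section Untilt.
Variable R : realType.
Implicit Types (f g h : R -> R -> R) (u v x y z : R).
Variable hb : R -> R -> R.
Hypothesis hb_height : boundary_height hb.
Hypothesis hb_const0 : exists c0 : R, forall y, 0 <= y <= 1 -> hb 0 y = c0.
Hypothesis hb_const1 : exists c1 : R, forall y, 0 <= y <= 1 -> hb 1 y = c1.
Variable f : R -> R -> R.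
Hypothesis hf : heights (lower hb) (upper hb) f.

Let c : R := Num.sqrt 2 / 2.

Let c0 : 0 < c. Proof. by rewrite divr_gt0// sqrt2_gt0. Qed.

Let c2 : c * c = 2^-1.
Proof. by have s := sqrt2_sqr R; rewrite /c; lra. Qed.

(** The height y at which the surface meets the line y + z = u. *)
Definition level x u : R :=
  Num.sqrt 2 / 2 * (Num.sqrt 2 / 2 * u - f x (Num.sqrt 2 / 2 * u)).

Lemma levelE x v : f x v = v - Num.sqrt 2 * level x (Num.sqrt 2 * v).
Proof. by rewrite /level sqrt2_halfK sqrt2_half; lra. Qed.

Lemma level_homo x u u' : u <= u' -> level x u <= level x u'.
Proof.
move=> uu'; have [[f1 _] _ _] := hf; rewrite /level ler_pM2l//.
have vw : c * u <= c * u' by rewrite ler_pM2l.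
by have /ler_normlP[] := f1 x _ _ vw; rewrite /c; lra.
Qed.

Lemma level_lipschitz x u u' : u <= u' -> level x u' <= level x u + (u' - u).
Proof.
move=> uu'; have [[f1 _] _ _] := hf.
have vw : c * u <= c * u' by rewrite ler_pM2l.
have -> : u' - u = c * (2 * (c * u' - c * u)).
  by transitivity (c * c * (2 * (u' - u))); [rewrite c2; lra|ring].
rewrite /level -mulrDr ler_pM2l//.
by have /ler_normlP[] := f1 x _ _ vw; rewrite /c; lra.
Qed.

Lemma level_shift x x' u : level x u <= level x' (u + `|x' - x| / 2).
Proof.
have [[_ f2] _ _] := hf; rewrite /level ler_pM2l//.
have -> : Num.sqrt 2 / 2 * (u + `|x' - x| / 2) = Num.sqrt 2 / 2 * u + Num.sqrt 2 / 4 * `|x' - x|.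
  by lra.
by have := f2 x x' (Num.sqrt 2 / 2 * u); lra.
Qed.

Lemma level_low x u : 0 <= x <= 1 -> u <= hb x 0 -> level x u = u - hb x 0.
Proof.
move=> x01 ulo; have [_ flo _] := hf; rewrite /level flo//; last first.
  by rewrite /lower clampE// ler_pM2l.
rewrite /lower clampE// -!/c.
transitivity (c * c * (2 * u - 2 * hb x 0)); first by ring.
by rewrite c2; lra.
Qed.

Lemma level_high x u : 0 <= x <= 1 -> 1 + hb x 1 <= u -> level x u = u - hb x 1.
Proof.
move=> x01 uhi; have [_ _ fhi] := hf; rewrite /level fhi//; last first.
  by rewrite /upper clampE// ler_pM2l.
rewrite /upper clampE//.
have -> : Num.sqrt 2 = 2 * c by rewrite /c; lra.
have -> : 2 * c / 2 = c by lra.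
transitivity (c * c * (2 * u - 2 * (1 + hb x 1) + 2)); first by ring.
by rewrite c2; lra.
Qed.

(** The largest z with Y(x, y + z) <= y.  At y = 0 this would be the upper end
    of a possible vertical segment of the surface instead of the boundary
    value. *)
Definition untilt x y : R :=
  if y <= 0 then hb x 0 else sup [set u | level x u <= y] - y.

Lemma sublevel_has_sup x y : 0 <= x <= 1 -> 0 <= y <= 1 ->
  has_sup [set u | level x u <= y] /\ sup [set u | level x u <= y] <= 1 + hb x 1.
Proof.
move=> x01 /andP[y0 y1].
have ub : ubound [set u | level x u <= y] (1 + hb x 1).
  move=> u /= uy; rewrite leNgt; apply/negP => h.
  by move: uy; rewrite (level_high x01 (ltW h)); lra.
have ne : [set u | level x u <= y] !=set0.
  by exists (hb x 0) => /=; rewrite level_low// subrr.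
by split; [split => //; exists (1 + hb x 1)|exact: ge_sup].
Qed.

Lemma untilt_homo x y y' : 0 <= x <= 1 -> 0 <= y -> y <= y' -> y' <= 1 ->
  untilt x y <= untilt x y'.
Proof.
move=> x01 y0 yy' y1; rewrite /untilt; have [yle|ygt] := leP y 0.
  have [//|y'0] := leP y' 0; rewrite lerBrDr; apply: ub_le_sup.
    by apply: (sublevel_has_sup x01 _).1.2; rewrite (ltW y'0).
  rewrite /=; have h : hb x 0 <= hb x 0 + y' by lra.
  apply: le_trans (level_lipschitz x h) _.
  by rewrite level_low//; lra.
rewrite ifF; last by apply/negbTE; rewrite -ltNge; exact: lt_le_trans ygt yy'.
rewrite lerBlDr; apply: ge_sup.
  by apply: (sublevel_has_sup x01 _).1.1; rewrite y0 (le_trans yy').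
move=> u /= uy; have h : u <= u + (y' - y) by lra.
have : u + (y' - y) <= sup [set u | level x u <= y'].
  apply: ub_le_sup; first by apply: (sublevel_has_sup x01 _).1.2; rewrite (le_trans y0 yy').
  by rewrite /=; have := level_lipschitz x h; lra.
lra.
Qed.

Lemma untilt0 x : untilt x 0 = hb x 0.
Proof. by rewrite /untilt lexx. Qed.

Lemma untilt1 x : 0 <= x <= 1 -> untilt x 1 = hb x 1.
Proof.
move=> x01; rewrite /untilt ifF; last by rewrite ler10.
have h : 0 <= (1 : R) <= 1 by rewrite ler01 lexx.
have [[_ ub] le] := sublevel_has_sup x01 h.
suff : 1 + hb x 1 <= sup [set u | level x u <= 1] by lra.
by apply: ub_le_sup => //=; rewrite level_high//; lra.
Qed.

Lemma untilt_shift x x' y : 0 <= x <= 1 -> 0 <= x' <= 1 -> 0 <= y <= 1 ->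
  untilt x y <= untilt x' y + `|x - x'| / 2.
Proof.
move=> x01 x01' y01; rewrite /untilt; have [_|y0] := leP y 0.
  have h0 : (0 : R) = 0 \/ (0 : R) = 1 by left.
  by have := boundary_lipschitz hb_height x x' h0; rewrite !clampE.
rewrite lerBlDr; apply: ge_sup; first exact: (sublevel_has_sup x01 y01).1.1.
move=> u /= uy; have : u - `|x - x'| / 2 <= sup [set u | level x' u <= y].
  apply: ub_le_sup; first exact: (sublevel_has_sup x01' y01).1.2.
  rewrite /=; apply: le_trans uy.
  by have := level_shift x' x (u - `|x - x'| / 2); rewrite subrK.
lra.
Qed.

(** On the sides x = 0 and x = 1 the boundary values at y = 0 and y = 1 are equal,
    which leaves only one choice in between for a nondecreasing function. *)
Lemma untilt_admissible : admissible hb untilt.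
Proof.
have x01D x y : D (x, y) -> 0 <= x <= 1 /\ 0 <= y <= 1.
  by rewrite /D/= !in_itv/=.
split.
- move=> y [x x'] /= [/x01D[x01 y01] /x01D[x01' _]].
  have h1 := untilt_shift x01 x01' y01; have h2 := untilt_shift x01' x01 y01.
  by rewrite (distrC x') in h2; apply/ler_normlP; split; lra.
- move=> x y y' /x01D[x01 /andP[y0 _]] /x01D[_ /andP[_ y1]] yy'.
  exact: untilt_homo.
move=> x y [/x01D[x01 /andP[y0 y1]]] /=.
have side : x = 0 \/ x = 1 -> untilt x y = hb x y.
  move=> hx; have e1 := boundary_sides hb_const0 hb_const1 hx.
  have h1 : 0 <= (1 : R) <= 1 by rewrite ler01 lexx.
  have := untilt_homo x01 y0 y1 (lexx _).
  have := untilt_homo x01 (lexx _) y0 y1.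
  rewrite untilt0 untilt1// (e1 1 h1) (e1 y) ?y0//; lra.
case=> h; [by apply: side; left|by apply: side; right| |].
  by rewrite h untilt0.
by rewrite h untilt1.
Qed.

Lemma tilt_untilt x v : 0 <= x <= 1 -> tilt untilt x v = f x v.
Proof.
move=> x01; rewrite levelE /tilt clampE//; congr (_ - _ * _).
set u := Num.sqrt 2 * v.
have pg := admissible_profile x untilt_admissible; rewrite clampE// in pg.
have col_lo y : y <= 0 -> extend_y untilt x y = hb x 0.
  by move=> y0; rewrite /extend_y -/(clamp y) clamp_le0// untilt0.
have col_hi y : 1 <= y -> extend_y untilt x y = hb x 1.
  by move=> y1; rewrite /extend_y -/(clamp y) clamp_ge1// untilt1.
have col y : 0 < y < 1 -> y + extend_y untilt x y = sup [set u | level x u <= y].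
  move=> /andP[y0 y1]; rewrite /extend_y -/(clamp y) clampE; last by rewrite !ltW.
  by rewrite /untilt leNgt y0/= addrC subrK.
have has y : 0 < y < 1 -> has_sup [set u | level x u <= y].
  by move=> /andP[y0 y1]; apply: (sublevel_has_sup x01 _).1; rewrite !ltW.
apply: (crossingE pg) => y.
  have [y0|y0] := leP y 0.
    rewrite col_lo// => h; rewrite leNgt; apply/negP => uy.
    have u0 : u <= hb x 0 by lra.
    by move: h; rewrite level_low//; lra.
  have [y1|y1] := leP 1 y.
    rewrite col_hi// => h; rewrite leNgt; apply/negP => uy.
    have := level_homo x (ltW uy).
    by rewrite (@level_high x (y + hb x 1))//; lra.
  have y01 : 0 < y < 1 by rewrite y0.
  rewrite col// => h; apply: ge_sup; first exact: (has _ y01).1.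
  move=> u' /= u'y; rewrite leNgt; apply/negP => uu'.
  by have := level_homo x (ltW uu'); lra.
have [y0|y0] := leP y 0.
  rewrite col_lo// => h; rewrite leNgt; apply/negP => uy.
  have [u0|u0] := leP u (hb x 0); first by move: h; rewrite level_low//; lra.
  have := level_homo x (ltW u0).
  by rewrite (@level_low x (hb x 0))//; lra.
have [y1|y1] := leP 1 y.
  rewrite col_hi// => h; rewrite leNgt; apply/negP => uy.
  have := level_homo x (ltW uy).
  by rewrite (@level_high x (y + hb x 1))//; lra.
have y01 : 0 < y < 1 by rewrite y0.
by rewrite col// => h; apply: ub_le_sup; [exact: (has _ y01).2|exact: ltW].
Qed.

End Untilt.

(** * The entropy of a height function as an integral of the cost *)
Section LowerIntegral.
Context d (T : measurableType d) (R : realType) (m : {measure set T -> \bar R}).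
Local Open Scope ereal_scope.
Import HBNNSimple.

Lemma sintegral_ae (A : set T) (h : {nnsfun T >-> R}) (mA : measurable A) :
  m (~` A) = 0 -> sintegral m (proj_nnsfun h mA) = sintegral m h.
Proof.
move=> A0; transitivity (sintegral m (h \_ A)); first by rewrite mrestrict.
rewrite -integral_nnsfun//; have -> : sintegral m h = \int[m]_x (h x)%:E.
  by rewrite integral_nnsfun// patch_setT.
rewrite [RHS](@ge0_negligible_integral _ _ _ m setT (~` A))//.
- by rewrite setDE setCK setTI.
- exact: measurableC.
- exact/measurable_EFinP.
- by move=> x _; rewrite lee_fin.
Qed.

(** The integral of a nonnegative function is by definition a supremum over
    simple functions below it, and a simple function may be set to 0 on a null
    set.  The lemma therefore applies to the integrand of the entropy, which is
    arbitrary where the gradient does not exist. *)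
Lemma ae_eq_lower_integral (D E : set T) (F G : T -> \bar R) :
  {ae m, forall x, (F \_ D) x = (G \_ E) x} ->
  \int[m]_(x in D) F x = \int[m]_(x in E) G x.
Proof.
move=> [N [mN N0 FG]].
have mC : measurable (~` N) by exact: measurableC.
have key (f g : T -> \bar R) : (forall x, 0 <= g x) ->
    (forall x, ~ N x -> f x = g x) ->
    ereal_sup [set sintegral m h | h in [set h : {nnsfun T >-> R} | forall x, (h x)%:E <= f x]] <=
    ereal_sup [set sintegral m h | h in [set h : {nnsfun T >-> R} | forall x, (h x)%:E <= g x]].
  move=> g0 fg; apply: ge_ereal_sup => _ [h /= hf <-].
  apply: ereal_sup_ubound; exists (proj_nnsfun h mC) => /=.
    move=> x; have /(congr1 (fun k => k x)) /= <- := mrestrict h mC; rewrite patchE; case: ifPn => [|_]; last exact: g0.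
    by rewrite inE => /= xN; rewrite -(fg x xN).
  by apply: sintegral_ae; rewrite setCK.
have FG' x : ~ N x -> (F \_ D) x = (G \_ E) x.
  by move=> xN; apply: contrapT => h; apply: xN; exact: FG.
rewrite /integral; congr (_ - _); apply/eqP; rewrite eq_le; apply/andP; split;
  apply: key => x; rewrite ?funepos_ge0 ?funeneg_ge0//;
  by move=> /FG' e; rewrite ?funeposE ?funenegE e.
Qed.

(** From 1 - f + f^+ = 1 + f^-, where the integral of f^+ is finite; both sides
    are -oo when f^- has infinite integral. *)
Lemma integral_complement (D : set T) (f : T -> \bar R) : measurable D -> m D < +oo ->
  measurable_fun D f -> (forall x, D x -> f x <= 1) ->
  \int[m]_(x in D) f x = m D - \int[m]_(x in D) (1 - f x).
Proof.
move=> mD Dfin mf f1.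
have mp : measurable_fun D f^\+ by exact: measurable_funepos.
have mn : measurable_fun D f^\- by exact: measurable_funeneg.
have mc : measurable_fun D (fun x => 1 - f x).
  by apply: emeasurable_funB => //; exact: measurable_cst.
have c0 x : D x -> 0 <= 1 - f x.
  move=> Dx; have := f1 x Dx; case: (f x) => [r||]//=.
    by rewrite lee_fin -EFinB lee_fin subr_ge0.
  by rewrite leey.
have ID : \int[m]_(x in D) 1 = m D by rewrite integral_cst// mul1e.
have e : \int[m]_(x in D) (1 - f x) + \int[m]_(x in D) f^\+ x =
    m D + \int[m]_(x in D) f^\- x.
  rewrite -ID.
  transitivity (\int[m]_(x in D) ((1 - f x) + f^\+ x)).
    by rewrite (ge0_integralD m mD c0 mc (fun x _ => funepos_ge0 f x) mp).
  transitivity (\int[m]_(x in D) (1 + f^\- x)); last first.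
    by rewrite ge0_integralD// => x _; exact: lee01.
  apply: eq_integral => x; rewrite inE => Dx.
  have := f1 x Dx; rewrite funeposE funenegE; case: (f x) => [r||]//= _.
  - rewrite -!EFin_max -!EFinD; congr EFin.
    by case: (leP r 0%R) => r0; case: (leP (- r)%R 0%R) => r0'; lra.
  - by rewrite maxye maxNye.
have pfin : \int[m]_(x in D) f^\+ x < +oo.
  apply: le_lt_trans Dfin; rewrite -ID; apply: ge0_le_integral => //.
  by move=> x Dx; rewrite funeposE ge_max f1//= lee01.
have p0 : 0 <= \int[m]_(x in D) f^\+ x by apply: integral_ge0.
have n0 : 0 <= \int[m]_(x in D) f^\- x by apply: integral_ge0.
have C0 : 0 <= \int[m]_(x in D) (1 - f x) by apply: integral_ge0.
have D0 : 0 <= m D by exact: measure_ge0.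
rewrite integralE; move: e pfin p0 n0 C0 D0 Dfin.
case: (\int[m]_(x in D) f^\+ x) => [p||]//; case: (m D) => [q||]//.
case: (\int[m]_(x in D) f^\- x) => [n||]//; case: (\int[m]_(x in D) (1 - f x)) => [c||]//.
by rewrite -!EFinD => -[e] *; congr EFin; lra.
Qed.

End LowerIntegral.

Section Gradients.
Variable R : realType.
Notation mu := (@lebesgue_measure R).
Notation mu2 := (@lebesgue_measure R \x @lebesgue_measure R)%E.
Notation plane := (measurableTypeR R * measurableTypeR R)%type.
Implicit Types f g : R -> R -> R.

Lemma affine_slope f (x v r k b : R) (z : R * R) : 0 < r ->
  (forall v', `|v' - v| < r -> f x v' = k * v' + b) -> has_grad f (x, v) z -> z.2 = k.
Proof.
move=> r0 fE [_ /= d]; have dk : is_derive v 1 (fun w : R => k * w + b) k.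
  apply/is_derive_epsP => e e0; exists 1 => // t _.
  have -> : k * (v + t) + b - (k * v + b) - t * k = 0 by ring.
  by rewrite normr0 mulr_ge0// ltW.
have : is_derive v 1 (fun w : R => k * w + b) z.2.
  apply: near_eq_is_derive d; apply/nbhs_ballP; exists r => //= w.
  by rewrite /ball/= distrC; exact: fE.
by move=> [_ <-]; rewrite (@derive_val _ _ _ _ _ _ _ dk).
Qed.

Lemma constant_slope f (x v r b : R) (z : R * R) : 0 < r ->
  (forall x', `|x' - x| < r -> f x' v = b) -> has_grad f (x, v) z -> z.1 = 0.
Proof.
move=> r0 fE [/= d _]; have : is_derive x 1 (fun _ : R => b) z.1.
  apply: near_eq_is_derive d; apply/nbhs_ballP; exists r => //= w.
  by rewrite /ball/= distrC; exact: fE.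
by move=> [_ <-]; rewrite derive_cst.
Qed.

Lemma ent_tilde_flat (z : R * R) : slopes z -> z.2 = -1 -> ent_tilde z = 0%E.
Proof. by move=> Kz z2; case: (ent_tildeP Kz) => // h; exfalso; lra. Qed.

Lemma cost_steep (z : R * R) : z.2 = 1 -> cost z = +oo%E.
Proof. by case: z => s t /= ->; rewrite /cost /ent_tilde ltxx. Qed.

Lemma measurable_cone_lipschitz (a : R -> R) :
  (forall x x', a x <= a x' + Num.sqrt 2 / 4 * `|x - x'|) -> measurable_fun setT a.
Proof.
move=> aL; apply: continuous_measurable_fun.
have c0 : 0 < Num.sqrt 2 / 4 :> R by rewrite divr_gt0// sqrt2_gt0.
apply: (lipschitz_continuous c0) => x y.
have h1 := aL x y; have h2 := aL y x; rewrite (distrC y) in h2.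
by apply/ler_normlP; split; lra.
Qed.

Lemma ae_graph_neq (phi : R -> R) : measurable_fun setT phi ->
  {ae mu2, forall p, p.2 != phi p.1}.
Proof.
move=> mphi; have mA : measurable [set p : plane | p.2 != phi p.1].
  have := @measurable_fun_eqr _ plane R setT (fun p => p.2) (fun p => phi p.1).
  move=> /(_ (measurable_snd) (measurableT_comp mphi measurable_fst)) h.
  have := h measurableT [set false] I; rewrite setTI.
  congr (measurable _); apply/seteqP; split=> [p /= ->//|p /= /negbTE //].
by apply: (prod_ae2 mA); apply: aeW => x; exact: (ae_imp _ (ae_neq (phi x))).
Qed.

Lemma ae_fst_neq (a : R) : {ae mu2, forall p, p.1 != a}.
Proof.
have mA : measurable [set p : plane | p.1 != a].
  have := @measurable_fun_eqr _ plane R setT (fun p => p.1) (fun p => a).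
  move=> /(_ measurable_fst (measurable_cst _)) h.
  have := h measurableT [set false] I; rewrite setTI.
  congr (measurable _); apply/seteqP; split=> [p /= ->//|p /= /negbTE //].
by apply: (prod_ae1 mA); apply: aeW => v; exact: ae_neq.
Qed.

Lemma total_cost_eq M f g : tilted f ->
  (forall x v : R, 0 <= x <= 1 -> f x v = g x v) ->
  tilted g -> total_cost M f = total_cost M g.
Proof.
move=> tf fg tg; apply: ae_eq_integral.
- exact: measurable_Q.
- by apply: measurable_funTS; exact: measurable_cost_gradm.
- by apply: measurable_funTS; exact: measurable_cost_gradm.
apply: ae_imp (has_gradm tf) => -[x v] h [/= + _]; rewrite in_itv/= => /andP[x0 x1].
suff -> : gradm g (x, v) = gradm f (x, v) by [].
have r0 : 0 < Num.min x (1 - x) by rewrite lt_min x0 subr_gt0.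
apply: gradmE; apply: has_grad_local r0 _ _ h => [x'|v' _].
  by rewrite lt_min => /andP[/ltr_normlP[h1 h2] /ltr_normlP[h3 h4]]; apply: fg; lra.
by apply: fg; rewrite !ltW.
Qed.

End Gradients.

(** * A competitor of finite cost *)
Section FiniteCost.
Variable R : realType.
Notation mu := (@lebesgue_measure R).
Notation mu2 := (@lebesgue_measure R \x @lebesgue_measure R)%E.
Notation plane := (measurableTypeR R * measurableTypeR R)%type.
Implicit Types f g : R -> R -> R.

Lemma tilted_max f g : tilted f -> tilted g -> tilted (fun x v => Num.max (f x v) (g x v)).
Proof.
move=> [f1 f2] [g1 g2]; split=> [x v w vw|x x' v].
  have /ler_normlP[a1 a2] := f1 x v w vw; have /ler_normlP[b1 b2] := g1 x v w vw.
  by apply/ler_normlP; rewrite !maxEle; do 2!case: ifP => ?; split; lra.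
by have := f2 x x' v; have := g2 x x' v; rewrite !maxEle; do 2!case: ifP => ?; lra.
Qed.

Lemma tilted_min f g : tilted f -> tilted g -> tilted (fun x v => Num.min (f x v) (g x v)).
Proof.
move=> [f1 f2] [g1 g2]; split=> [x v w vw|x x' v].
  have /ler_normlP[a1 a2] := f1 x v w vw; have /ler_normlP[b1 b2] := g1 x v w vw.
  by apply/ler_normlP; rewrite !minEle; do 2!case: ifP => ?; split; lra.
by have := f2 x x' v; have := g2 x x' v; rewrite !minEle; do 2!case: ifP => ?; lra.
Qed.

Lemma tilted_slope (a : R -> R) (b : R) :
  (forall x x', a x <= a x' + Num.sqrt 2 / 4 * `|x - x'|) ->
  tilted (fun x v => 2 * a x - v + b).
Proof.
move=> aL; split=> [x v w vw|x x' v]; first by apply/ler_normlP; split; lra.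
by have := aL x' x; lra.
Qed.

Lemma tilted_affine (k b : R) : -1 <= k <= 1 -> tilted (fun _ v => k * v + b).
Proof.
move=> k1; split=> [x v w vw|x x' v].
  by apply/ler_normlP; split; nra.
have c0 : 0 <= Num.sqrt 2 / 4 * `|x' - x|.
  by apply: mulr_ge0 => //; rewrite divr_ge0// ltW// sqrt2_gt0.
nra.
Qed.

Variables (lo hi : R -> R) (M : R).
Hypothesis M1 : 1 <= M.
Hypothesis loM : forall x : R, 0 <= x <= 1 -> `|lo x| < M.
Hypothesis hiM : forall x : R, 0 <= x <= 1 -> `|hi x| < M.
Hypothesis lohi : forall x, lo x + Num.sqrt 2 / 2 <= hi x.
Hypothesis loL : forall x x', lo x <= lo x' + Num.sqrt 2 / 4 * `|x - x'|.
Hypothesis hiL : forall x x', hi x <= hi x' + Num.sqrt 2 / 4 * `|x - x'|.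

(* The line of slope 1 - delta in the definition of the competitor passes
   through (-M, -M) and (M, M - sqrt 2), so its value at v in [-M, M] is between
   v - sqrt 2 and v.  The two outer pieces have the value lo x at v = lo x and
   hi x - sqrt 2 at v = hi x, and therefore prevail beyond these points. *)
Let delta : R := Num.sqrt 2 / (2 * M).

Let k : R := 1 - delta.

Let s0 : 0 < Num.sqrt (2 : R).
Proof. exact: sqrt2_gt0. Qed.

Let s2 : Num.sqrt (2 : R) < 2.
Proof. by have := sqrt2_sqr R; have := s0; nra. Qed.

Let delta0 : 0 < delta.
Proof. by rewrite /delta divr_gt0// mulr_gt0// (lt_le_trans ltr01). Qed.

Let delta1 : delta < 1.
Proof. by have := s2; rewrite /delta ltr_pdivrMr; have := M1; lra. Qed.

Let deltaM : delta * (2 * M) = Num.sqrt 2.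
Proof. by rewrite /delta divfK// mulf_neq0// gt_eqF// (lt_le_trans ltr01). Qed.

Let line v : R := k * v + - (delta * M).
Let below x v : R := 2 * lo x - v + 0.
Let above x v : R := 2 * hi x - v + - Num.sqrt 2.
(** In the original coordinates: y + z has constant speed in y where neither
    boundary value is reached. *)
Definition ramp x v : R := Num.min (above x v) (Num.max (below x v) (line v)).

Lemma ramp_tilted : tilted ramp.
Proof.
apply: tilted_min; first exact: tilted_slope.
apply: tilted_max; first exact: tilted_slope.
by apply: tilted_affine; have := delta0; have := delta1; rewrite /k; lra.
Qed.

Let below_above x v : below x v <= above x v.
Proof. by have := lohi x; rewrite /below /above; lra. Qed.

Lemma ramp_heights : heights lo hi ramp.
Proof.
have d0 := delta0; have d1 := delta1; have dM := deltaM.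
split; first exact: ramp_tilted.
- move=> x v x01 vlo; have /ltr_normlP[h1 h2] := loM x01.
  have lb : line v <= below x v by rewrite /line /below /k; nra.
  by rewrite /ramp (max_idPl lb) (min_idPr (below_above x v)) /below addr0.
- move=> x v x01 vhi; have /ltr_normlP[h1 h2] := hiM x01.
  have al : above x v <= line v by rewrite /line /above /k; nra.
  by rewrite /ramp (min_idPl _) ?le_max ?al ?orbT// /above; lra.
Qed.

(** Away from the graphs where the pieces meet, the competitor coincides with
    one piece nearby on the vertical line, and in the case of the middle piece
    also on the horizontal line.  The two outer pieces have slope -1 in v, where
    the cost does not depend on the x-slope. *)
Lemma ramp_cases x v z : has_grad ramp (x, v) z -> line v != below x v ->
  line v != above x v -> z.2 = -1 \/ z = (0, k).
Proof.
move=> h nb na; have c0 : 0 < Num.sqrt 2 / 4 :> R by have := s0; lra.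
have d0 := delta0; have d1 := delta1.
have [lb|bl|/eqP] := ltgtP (line v) (below x v); last by rewrite (negbTE nb).
  left; apply: (@affine_slope _ ramp x v ((below x v - line v) / 2) (-1) (2 * lo x)) h.
    by rewrite divr_gt0// subr_gt0.
  move=> w /ltr_normlP[h1 h2].
  have lbw : line w <= below x w by move: h1 h2 lb; rewrite /line /below /k; nra.
  rewrite /ramp (max_idPl lbw) (min_idPr (below_above x w)) /below; lra.
have [la|al|/eqP] := ltgtP (line v) (above x v); last by rewrite (negbTE na).
  right; have z2 : z.2 = k.
    pose r := Num.min (line v - below x v) (above x v - line v) / 2.
    have r0 : 0 < r by rewrite divr_gt0// lt_min !subr_gt0 bl.
    apply: (@affine_slope _ ramp x v r k (- (delta * M)) _ r0) h.
    move=> w; rewrite /r ltr_pdivlMr// mulrC lt_min => /andP[h1 h2].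
    have {}h1 : 2 * `|w - v| < line v - below x v by lra.
    have {}h2 : 2 * `|w - v| < above x v - line v by lra.
    have h3 := ler_norm (w - v); have h4 := ler_norm (- (w - v)); rewrite normrN in h4.
    have bw : below x w <= line w.
      by move: h1; rewrite /line /below /k; set n := `|_| in h3 h4 *; nra.
    have aw : line w <= above x w.
      by move: h2; rewrite /line /above /k; set n := `|_| in h3 h4 *; nra.
    by rewrite /ramp (max_idPr bw) (min_idPr aw).
  have z1 : z.1 = 0.
    pose r := Num.min (line v - below x v) (above x v - line v).
    have r0 : 0 < r by rewrite lt_min !subr_gt0 bl.
    apply: (@constant_slope _ ramp x v r (line v) _ r0) h.
    move=> w; rewrite /r lt_min => /andP[h1 h2].
    have s2' := s2; have n0 := normr_ge0 (w - x).
    have h3 := loL w x; have h4 := hiL x w; rewrite distrC in h4.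
    have bw : below w v <= line v by move: h1; rewrite /below; nra.
    have aw : line v <= above w v by move: h2; rewrite /above; nra.
    by rewrite /ramp (max_idPr bw) (min_idPr aw).
  by rewrite -z1 -z2; case: (z).
left; apply: (@affine_slope _ ramp x v ((line v - above x v) / 2) (-1) (2 * hi x - Num.sqrt 2)) h.
  by rewrite divr_gt0// subr_gt0.
move=> w /ltr_normlP[h1 h2].
have alw : above x w <= line w by move: h1 h2 al; rewrite /line /above /k; nra.
by rewrite /ramp (min_idPl _) ?le_max ?alw ?orbT// /above; lra.
Qed.

Lemma ramp_cost : (total_cost M ramp < +oo)%E.
Proof.
have d0 := delta0; have d1 := delta1.
have M0 : 0 < M by apply: lt_le_trans M1.
pose kz : R * R := (0, k).
have Kk : slopes kz.
  split => /=; first by rewrite /k; lra.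
  by rewrite normr0 mulr_ge0// ?divr_ge0 ?ltW// /k; lra.
have kfin : (cost kz < +oo)%E.
  rewrite /cost; case: (ent_tildeP Kk) => [_|_|_ _ _]; rewrite -?EFinB ?ltry//.
  rewrite /amp/kz/= mulr0 mul0r mulr0 cos0 mulr1 /k => h; exfalso; lra.
have [C C1 Ck] : exists2 C : R, 1 <= C & (cost kz <= C%:E)%E.
  case: (cost kz) (cost_ge0 Kk) kfin => [c||]// c0 _.
  exists (Num.max 1 c); first by rewrite le_max lexx.
  by rewrite lee_fin le_max lexx orbT.
have mlo := measurable_cone_lipschitz loL; have mhi := measurable_cone_lipschitz hiL.
have ne1 : {ae mu2, forall p : plane, p.2 != (2 * lo p.1 + delta * M) / (1 + k)}.
  apply: (@ae_graph_neq _ (fun x => (2 * lo x + delta * M) / (1 + k))).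
  by apply: measurable_funM => //; apply: measurable_funD => //; exact: measurable_funM.
have ne2 : {ae mu2, forall p : plane, p.2 != (2 * hi p.1 - Num.sqrt 2 + delta * M) / (1 + k)}.
  apply: (@ae_graph_neq _ (fun x => (2 * hi x - Num.sqrt 2 + delta * M) / (1 + k))).
  apply: measurable_funM => //; apply: measurable_funD => //.
  by apply: measurable_funB => //; exact: measurable_funM.
have k10 : 1 + k != 0 by rewrite gt_eqF// /k; lra.
have bd : {ae mu2, forall p, Q M p -> (cost (gradm ramp p) <= C%:E)%E}.
  apply: ae_imp2 (ae_and ne1 ne2) (has_gradm ramp_tilted) => -[x v] /= [n1 n2] h _.
  have e1 : line v != below x v.
    apply: contra n1 => /eqP e; apply/eqP; apply: (mulIf k10); rewrite divfK//.
    by move: e; rewrite /line /below; lra.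
  have e2 : line v != above x v.
    apply: contra n2 => /eqP e; apply/eqP; apply: (mulIf k10); rewrite divfK//.
    by move: e; rewrite /line /above; lra.
  have [t1|->] := ramp_cases h e1 e2; last exact: Ck.
  rewrite /cost ent_tilde_flat//; last exact: gradm_slopes ramp_tilted.
  by rewrite sube0 lee_fin.
apply: (@le_lt_trans _ _ (\int[mu2]_(p in Q M) (cst C%:E p))%E).
  apply: ae_ge0_le_integral bd.
  - exact: measurable_Q.
  - by move=> p _; apply: cost_ge0; apply: gradm_slopes; exact: ramp_tilted.
  - by apply: measurable_funTS; apply: measurable_cost_gradm; exact: ramp_tilted.
  - by move=> p _; rewrite lee_fin (le_trans ler01).
  - exact: measurable_cst.
rewrite integral_cst; last exact: measurable_Q.
by apply: lte_mul_pinfty; [rewrite lee_fin (le_trans ler01)| |exact: mu2_Q_lty M0].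
Qed.

End FiniteCost.

Lemma lee_cancel_sub (R : realType) (a : R) (b c : \bar R) : (0 <= b < +oo)%E ->
  (a%:E - b <= a%:E - c)%E -> (c <= b)%E.
Proof.
move=> /andP[]; case: b => [b||]// _ _; case: c => [c||]//; last by rewrite leNye.
by rewrite -!EFinB !lee_fin; lra.
Qed.

(** * The entropy in terms of the cost, and injectivity of the tilt *)
Section EntropyOfTilt.
Variable R : realType.
Notation mu := (@lebesgue_measure R).
Notation mu2 := (@lebesgue_measure R \x @lebesgue_measure R)%E.
Notation plane := (measurableTypeR R * measurableTypeR R)%type.
Implicit Types f g h : R -> R -> R.
Variable hb : R -> R -> R.
Hypothesis hb_height : boundary_height hb.
Variable M : R.
Hypothesis M0 : 0 < M.
Hypothesis loM : forall x : R, 0 <= x <= 1 -> `|lower hb x| < M.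
Hypothesis hiM : forall x : R, 0 <= x <= 1 -> `|upper hb x| < M.

Let s0 : 0 < Num.sqrt (2 : R).
Proof. exact: sqrt2_gt0. Qed.

Let s2 : Num.sqrt (2 : R) < 2.
Proof. by have := sqrt2_sqr R; have := s0; nra. Qed.

(** On the open rotated domain [h_tilde h] and [tilt h] coincide near each point,
    hence have the same gradient; on the rest of [Q M] the tilt has slope -1 in
    v and its entropy vanishes.  The lines and graphs that bound these regions
    are null sets. *)
Lemma ae_ent_tilde h : admissible hb h -> {ae mu2, forall p,
  ((fun p => ent_tilde (grad (h_tilde h) p)) \_ (D_tilde hb)) p =
  ((fun p => ent_tilde (gradm (tilt h) p)) \_ (Q M)) p}.
Proof.
move=> ah; have hh := tilt_heights ah; have [th hlo hhi] := hh.
have loL := lower_lipschitz hb_height; have hiL := upper_lipschitz hb_height.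
apply: ae_imp2 (has_gradm th) (ae_and (ae_fst_neq 0) (ae_and (ae_fst_neq 1)
  (ae_and (ae_graph_neq (measurable_cone_lipschitz loL))
          (ae_graph_neq (measurable_cone_lipschitz hiL))))) => -[x v] hg [x0 [x1 [vlo vhi]]].
rewrite /= in x0 x1 vlo vhi.
have [x01|nx] := boolP (0 < x < 1); last first.
  rewrite /patch !memNset//; first by move=> [/=]; rewrite in_itv/= (negbTE nx).
  rewrite /D_tilde/= => -[/andP[h1 h2] _ _]; move/negP : nx; apply.
  by rewrite !lt_neqAle h1 h2 x1 eq_sym x0.
have x01' : 0 <= x <= 1 by case/andP: x01 => h1 h2; rewrite !ltW.
have /ltr_normlP[lo1 lo2] := loM x01'; have /ltr_normlP[hi1 hi2] := hiM x01'.
have DE : D_tilde hb (x, v) <-> lower hb x <= v <= upper hb x.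
  rewrite /D_tilde/= /lower /upper clampE//; split=> [[_ -> ->]//|/andP[h1 h2]].
  by split.
have Kz := gradm_slopes (x, v) th.
have [vl|lv|/eqP] := ltgtP v (lower hb x); last by rewrite (negbTE vlo).
  have z2 : (gradm (tilt h) (x, v)).2 = -1.
    apply: (@affine_slope _ _ x v (lower hb x - v) (-1) (2 * lower hb x) _ _ _ hg).
      by rewrite subr_gt0.
    move=> w /ltr_normlP[h1 h2]; rewrite hlo//; lra.
  rewrite /patch memNset; last by move=> /DE/andP[h1 _]; move: h1; rewrite leNgt vl.
  by case: ifP => // _; rewrite ent_tilde_flat.
have [vu|uv|/eqP] := ltgtP v (upper hb x); last by rewrite (negbTE vhi).
  rewrite /patch !mem_set; last 2 first.
  - by split; rewrite /= in_itv/= ?x01//; apply/andP; split; lra.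
  - by apply/DE; rewrite !ltW.
  congr ent_tilde; apply: has_grad_grad.
  pose r := Num.min (Num.min x (1 - x)) (Num.min (v - lower hb x) (upper hb x - v)).
  have r0 : 0 < r by rewrite !lt_min !subr_gt0 x01 lv vu.
  apply: has_grad_local r0 _ _ hg => [w|w]; rewrite /r !lt_min => /andP[/andP[h1 h2] /andP[h3 h4]].
    have w01 : 0 <= w <= 1 by move: h1 h2 => /ltr_normlP[a1 a2] /ltr_normlP[b1 b2]; lra.
    apply/esym/(h_tilde_tilt ah w01).
    have := loL w x; have := hiL x w; rewrite (distrC x).
    have := normr_ge0 (w - x); move: h3 h4; have := s2; set n := `|_|.
    by move=> *; apply/andP; split; nra.
  apply/esym/(h_tilde_tilt ah x01').
  by move: h3 h4 => /ltr_normlP[a1 a2] /ltr_normlP[b1 b2]; lra.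
have z2 : (gradm (tilt h) (x, v)).2 = -1.
  apply: (@affine_slope _ _ x v (v - upper hb x) (-1) (2 * upper hb x - Num.sqrt 2) _ _ _ hg).
    by rewrite subr_gt0.
  move=> w /ltr_normlP[h1 h2]; rewrite hhi//; lra.
rewrite /patch memNset; last by move=> /DE/andP[_ h1]; move: h1; rewrite leNgt uv.
by case: ifP => // _; rewrite ent_tilde_flat.
Qed.

Lemma Ent_total_cost h : admissible hb h ->
  Ent hb h = ((2 * M)%:E - total_cost M (tilt h))%E.
Proof.
move=> ah; have [th _ _] := tilt_heights ah.
transitivity (\int[mu2]_(p in Q M) ent_tilde (gradm (tilt h) p))%E.
  exact: ae_eq_lower_integral (ae_ent_tilde ah).
transitivity (mu2 (Q M) - total_cost M (tilt h))%E; last by congr (_ - _)%E; exact: mu2_Q.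
apply: integral_complement; [exact: measurable_Q|exact: mu2_Q_lty M0| |].
  by apply: measurable_funTS; exact: measurable_ent_tilde_gradm.
by move=> p _; apply: ent_tilde_le1; exact: gradm_slopes.
Qed.

(** The crossing for h takes the value y at u = y + h x y, and the crossing for h'
    takes it at u = y + h' x y.  If h x y < h' x y, the common crossing is constant
    on the segment between them.  By the cone inequality it is also constant on
    shorter segments over nearby x, so that f has slope 1 in v on an open
    rectangle, at infinite cost. *)
Lemma tilt_inj_le f h h' : tilted f -> (total_cost M f < +oo)%E ->
  admissible hb h -> admissible hb h' ->
  (forall x v : R, 0 <= x <= 1 -> tilt h x v = f x v) ->
  (forall x v : R, 0 <= x <= 1 -> tilt h' x v = f x v) ->
  forall x y, D (x, y) -> h' x y <= h x y.
Proof.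
move=> tf ffin ah ah' hf hf' x y Dxy; rewrite leNgt; apply/negP => hh'.
have [x01 y01] : 0 <= x <= 1 /\ 0 <= y <= 1 by move: Dxy; rewrite /D/= !in_itv.
have [f1 f2] := tf; have s0' := s0; have s2' := s2.
have col k : admissible hb k -> (forall x v : R, 0 <= x <= 1 -> tilt k x v = f x v) ->
    let v := Num.sqrt 2 / 2 * (y + k x y) in
    [/\ f x v = v - Num.sqrt 2 * y, lower hb x <= v & v <= upper hb x].
  move=> ak kf; have pg := admissible_profile x ak; rewrite clampE// in pg.
  have ek : extend_y k x y = k x y by rewrite /extend_y -/(clamp y) clampE.
  have e0 := admissible0 x ak; have e1 := admissible1 x ak; rewrite clampE// in e0 e1.
  have [km _ _] := pg; have /andP[y0 y1] := y01.
  split; first by rewrite -kf// /tilt clampE// sqrt2_halfK -ek crossing_graph.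
    rewrite /lower clampE// ler_pM2l ?divr_gt0//.
    by have := km _ _ y0; rewrite ek e0; lra.
  rewrite /upper clampE// ler_pM2l ?divr_gt0//.
  by have := km _ _ y1; rewrite ek e1; lra.
have [fv1 v1lo _] := col h ah hf; have [fv2 _ v2hi] := col h' ah' hf'.
have /ltr_normlP[lo1 lo2] := loM x01; have /ltr_normlP[hi1 hi2] := hiM x01.
set v1 := Num.sqrt 2 / 2 * (y + h x y) in fv1 v1lo.
set v2 := Num.sqrt 2 / 2 * (y + h' x y) in fv2 v2hi.
have v12 : v1 < v2 by rewrite ltr_pM2l ?divr_gt0// ltrD2l.
have flat w : v1 <= w <= v2 -> f x w = w - Num.sqrt 2 * y.
  move=> /andP[h1 h2]; have /ler_normlP[a1 a2] := f1 x _ _ h1.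
  by have /ler_normlP[b1 b2] := f1 x _ _ h2; lra.
pose r := (v2 - v1) / 4; have r0 : 0 < r by rewrite divr_gt0// subr_gt0.
have flat' x' w : `|x' - x| < r -> v1 + r < w < v2 - r -> f x' w = w - Num.sqrt 2 * y.
  move=> x'r /andP[h1 h2]; have n0 := normr_ge0 (x' - x).
  have c1 : 0 <= Num.sqrt 2 / 4 * `|x' - x| by rewrite mulr_ge0// divr_ge0// ltW.
  have c2 : Num.sqrt 2 / 4 * `|x' - x| <= r by nra.
  have := f2 x x' (w - Num.sqrt 2 / 4 * `|x' - x|); rewrite subrK flat; last by apply/andP; split; lra.
  have := f2 x' x w; rewrite (distrC x x') flat; last by apply/andP; split; lra.
  lra.
have cfin : {ae mu2, forall p, Q M p -> cost (gradm f p) \is a fin_num}.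
  apply: integrable_ae; first exact: measurable_Q.
  apply/integrableP; split; first by apply: measurable_funTS; exact: measurable_cost_gradm.
  rewrite (_ : (\int[mu2]_(p in Q M) `|cost (gradm f p)|)%E = total_cost M f); first exact: ffin.
  by apply: eq_integral => p _; rewrite gee0_abs; [|apply: cost_ge0; exact: gradm_slopes].
have [x' /andP[]] : exists2 x', Num.max 0 (x - r) < x' < Num.min 1 (x + r) &
    {ae mu, forall w, (Q M (x', w) -> cost (gradm f (x', w)) \is a fin_num) /\
      has_grad f (x', w) (gradm f (x', w))}.
  apply: ae_dense; last exact: (ae_prod2 (ae_and cfin (has_gradm tf))).
  by rewrite gt_max !lt_min; apply/andP; split; apply/andP; split; lra.
rewrite gt_max lt_min => /andP[x'0 xr] /andP[x'1 rx] hw.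
have x'r : `|x' - x| < r by apply/ltr_normlP; split; lra.
have vr : v1 + r < v2 - r by rewrite /r; lra.
have [w /andP[w1 w2] [fin hg]] := ae_dense vr hw.
have z2 : (gradm f (x', w)).2 = 1.
  pose e := Num.min (w - (v1 + r)) (v2 - r - w).
  have e0 : 0 < e by rewrite lt_min !subr_gt0 w1.
  apply: (@affine_slope _ _ x' w e 1 (- (Num.sqrt 2 * y)) _ e0 _ hg) => t.
  rewrite lt_min => /andP[/ltr_normlP[a1 a2] /ltr_normlP[b1 b2]].
  by rewrite mul1r flat'//; apply/andP; split; lra.
suff : cost (gradm f (x', w)) \is a fin_num by rewrite cost_steep.
apply: fin; split; rewrite /= in_itv/=; first by rewrite x'0.
by apply/andP; split; lra.
Qed.

End EntropyOfTilt.

Unset Implicit Arguments.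

Theorem theorem1p1 (R : realType) (hb : R -> R -> R)
    (hb_height : boundary_height hb)
    (hb_const0 : exists c0 : R, forall y : R, 0 <= y <= 1 -> hb 0 y = c0)
    (hb_const1 : exists c1 : R, forall y : R, 0 <= y <= 1 -> hb 1 y = c1) :
  exists h0 : R -> R -> R,
    maximizes_Ent hb h0 /\
    (forall h : R -> R -> R, maximizes_Ent hb h ->
       forall x y : R, D (x, y) -> h x y = h0 x y).
Proof.
pose M : R := `|hb 0 0| + `|hb 0 1| + 3.
have n0 := normr_ge0 (hb 0 0); have n1 := normr_ge0 (hb 0 1).
have M1 : 1 <= M by rewrite /M; lra.
have M0 : 0 < M by apply: lt_le_trans M1.
have s0 := sqrt2_gt0 R; have s2 := sqrt2_sqr R.
have s1 : Num.sqrt 2 / 2 <= 1 :> R by nra.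
have q0 : 0 <= Num.sqrt 2 / 2 :> R by rewrite divr_ge0// ltW.
have bound (y x : R) : y = 0 \/ y = 1 -> 0 <= x <= 1 -> `|hb x y| <= `|hb 0 y| + 2^-1.
  move=> y01 x01; have z01 : 0 <= (0 : R) <= 1 by rewrite lexx ler01.
  have := boundary_lipschitz hb_height x 0 y01; have := boundary_lipschitz hb_height 0 x y01.
  rewrite !clampE// distrC subr0; have /andP[x0 x1] := x01; rewrite (ger0_norm x0).
  have := ler_norm (hb 0 y); have := ler_norm (- hb 0 y); rewrite normrN => *.
  by apply/ler_normlP; split; lra.
have loM (x : R) : 0 <= x <= 1 -> `|lower hb x| < M.
  move=> x01; have := bound 0 x (or_introl erefl) x01.
  rewrite /lower clampE// normrM (ger0_norm q0).
  by have := normr_ge0 (hb x 0); rewrite /M; nra.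
have hiM (x : R) : 0 <= x <= 1 -> `|upper hb x| < M.
  move=> x01; have := bound 1 x (or_intror erefl) x01.
  rewrite /upper clampE// normrM (ger0_norm q0).
  have := ler_normD 1 (hb x 1); rewrite normr1.
  by have := normr_ge0 (1 + hb x 1); rewrite /M; nra.
have lohi x : lower hb x + Num.sqrt 2 / 2 <= upper hb x.
  by rewrite /lower /upper; have := boundary_le hb_height x; nra.
have loL := lower_lipschitz hb_height; have hiL := upper_lipschitz hb_height.
pose rf := ramp (lower hb) (upper hb) M.
have rh : heights (lower hb) (upper hb) rf by exact: ramp_heights.
have rc : (total_cost M rf < +oo)%E by exact: ramp_cost.
have [f hf fmin] := exists_minimizer M0 loM (ex_intro2 _ _ rf rh rc).
have ffin : (total_cost M f < +oo)%E by exact: le_lt_trans (fmin _ rh) rc.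
have tl k : heights (lower hb) (upper hb) k -> tilted k by case.
have a0 := untilt_admissible hb_height hb_const0 hb_const1 hf.
have t0 := tilt_untilt hb_height hb_const0 hb_const1 hf.
have c0 : total_cost M (tilt (untilt hb f)) = total_cost M f.
  by apply: total_cost_eq => //; apply: tl => //; exact: tilt_heights.
have EE := Ent_total_cost hb_height M0 loM hiM.
exists (untilt hb f); split.
  split; first exact: a0.
  move=> g ag; rewrite (EE _ ag) (EE _ a0) c0; apply: leeB; first exact: lexx.
  by apply: fmin; exact: tilt_heights.
move=> h [ah hmax] x y Dxy.
have hh := tilt_heights ah.
have hc : (total_cost M (tilt h) <= total_cost M f)%E.
  apply: (@lee_cancel_sub _ (2 * M)); first by rewrite ffin (total_cost_ge0 M (tl _ hf)).
  by have := hmax _ a0; rewrite (EE _ ah) (EE _ a0) c0.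
have th : forall x v : R, 0 <= x <= 1 -> f x v = tilt h x v.
  apply: (unique_minimizer M0 loM hiM hf hh ffin fmin) => k hk.
  exact: le_trans hc (fmin _ hk).
have ht x' v' : 0 <= x' <= 1 -> tilt h x' v' = f x' v' by move=> x01; rewrite th.
apply/eqP; rewrite eq_le; apply/andP; split.
- by apply: (tilt_inj_le loM hiM (tl _ hf) ffin a0 ah t0 ht).
- by apply: (tilt_inj_le loM hiM (tl _ hf) ffin ah a0 ht t0).
Qed.
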